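(* Let $1<s\le\infty$ and let $\Omega\in L_s(S^{n-1})$ be $A_t$-homogeneous of degree zero. Let $1\le s'<p<q<\infty$ and $0<\alpha<\frac{\gamma}{p}$. Let $\varphi(x,t)$ be a positive measurable function on $\mathbb{R}^n\times(0,\infty)$ satisfying $$\sup_{r<t<\infty}t^{-\gamma}\operatorname*{ess\,inf}_{t<\tau<\infty}\varphi(x,\tau)\,\tau^{\gamma}\le C\varphi(x,r)$$ and $$\int_r^\infty t^{\alpha}\varphi(x,t)^{\frac1p}\,\frac{dt}{t}\le C r^{-\frac{\alpha p}{q-p}},$$ where $C$ does not depend on $x\in\mathbb{R}^n$ and $r>0$. Then the operators $M^P_{\Omega,\alpha}$ and $I^P_{\Omega,\alpha}$ are bounded from $M_{p,\varphi^{1/p},P}$ to $M_{q,\varphi^{1/q},P}$ for $p>1$ and from $M_{1,\varphi,P}$ to $WM_{q,\varphi^{1/q},P}$ for $p=1$.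
   Context: Setting. $n\ge2$; $P$ is a real $n\times n$ matrix all of whose eigenvalues have positive real part; $A_t=t^P$ ($t>0$); $\gamma=\operatorname{tr}P$. $\rho$ is a quasi-distance associated with $P$: $\rho(A_tx)=t\rho(x)$ for $t>0$, $x\in\mathbb{R}^n$; $\rho(0)=0$, $\rho(x-y)=\rho(y-x)\ge0$ (with $\rho(x)>0$ for $x\neq0$), and $\rho(x-y)\le k(\rho(x-z)+\rho(y-z))$ for a constant $k$; and $dx=\rho^{\gamma-1}d\sigma(w)\,d\rho$ where $\rho=\rho(x)$, $w=A_{\rho^{-1}}x$ and $d\sigma(w)$ is a measure on $\{w:\rho(w)=1\}$. The ellipsoid is $E(x,r)=\{y\in\mathbb{R}^n:\rho(x-y)<r\}$; its Lebesgue measure is $|E(x,r)|=\upsilon_\rho r^\gamma$, where $\upsilon_\rho$ is the volume of the unit ellipsoid. $S^{n-1}$ is the Euclidean unit sphere with normalized surface measure. A real-valued measurable $\Omega$ on $\mathbb{R}^n$ is $A_t$-homogeneous of degree zero if $\Omega(A_tx)=\Omega(x)$ for all $t>0$, $x\in\mathbb{R}^n$; $\Omega\in L_s(S^{n-1})$ refers to its restriction to the sphere. $s'=s/(s-1)$ (with $\infty'=1$). Operators: $M^P_{\Omega,\alpha}f(x)=\sup_{t>0}|E(x,t)|^{-1+\frac{\alpha}{\gamma}}\int_{E(x,t)}|\Omega(x-y)||f(y)|\,dy$ and $I^P_{\Omega,\alpha}f(x)=\int_{\mathbb{R}^n}\frac{\Omega(x-y)}{\rho(x-y)^{\gamma-\alpha}}f(y)\,dy$.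 Spaces. For $\psi(x,r)$ positive measurable on $\mathbb{R}^n\times(0,\infty)$ and $1\le p<\infty$, $M_{p,\psi,P}$ is the set of $f\in L_p^{loc}(\mathbb{R}^n)$ with $\|f\|_{M_{p,\psi,P}}=\sup_{x\in\mathbb{R}^n,\,r>0}\psi(x,r)^{-1}|E(x,r)|^{-1/p}\|f\|_{L_p(E(x,r))}<\infty$; $WM_{p,\psi,P}$ is defined likewise with $WL_p$ (weak $L_p$) in place of $L_p$. $\varphi^{1/p}$ denotes the function $\varphi(x,r)^{1/p}$. Bounded means the norm inequality $\|Tf\|\le C\|f\|$ with $C$ independent of $f$. *)

(* Defs.v *)
From HB Require Import structures.
From mathcomp Require Import all_boot all_order all_algebra.
From mathcomp Require Import all_classical all_reals all_analysis.
From mathcomp Require Import measurable_realfun ess_sup_inf.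
From mathcomp Require Import complex.

Set Implicit Arguments.
Unset Strict Implicit.
Unset Printing Implicit Defensive.

Import Order.TTheory GRing.Theory Num.Theory.
Import numFieldNormedType.Exports.

Local Open Scope classical_set_scope.
Local Open Scope ring_scope.

(* Points of R^n are column vectors 'cV[R]_n. Matrices carry the product
   sigma-algebra of their entries, i.e. the Borel sigma-algebra. *)
Section measurable_matrix.
Context {R : realType} (m n : nat).

Definition mx_measurable : set (set 'M[R]_(m, n)) :=
  <<s \bigcup_ij preimage_set_system setT
        (fun x : 'M[R]_(m, n) => x ij.1 ij.2) measurable >>.

Let mx_measurable0 : mx_measurable set0.
Proof. exact: sigma_algebra0. Qed.

Let mx_measurableC A : mx_measurable A -> mx_measurable (~` A).
Proof. exact: sigma_algebraC. Qed.

Let mx_measurable_bigcup (F : (set 'M[R]_(m, n))^nat) :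
  (forall i, mx_measurable (F i)) -> mx_measurable (\bigcup_i F i).
Proof. exact: sigma_algebra_bigcup. Qed.

HB.instance Definition _ := @isMeasurable.Build default_measure_display
  'M[R]_(m, n) mx_measurable mx_measurable0 mx_measurableC
  mx_measurable_bigcup.

End measurable_matrix.

Section measurable_entries.
Context {R : realType}.

Lemma measurable_mx_entry m n (i : 'I_m) (j : 'I_n) :
  measurable_fun setT (fun x : 'M[R]_(m, n) => x i j).
Proof.
move=> _ Y mY; rewrite setTI; apply: sub_sigma_algebra.
by exists (i, j) => //; exists Y => //; rewrite setTI.
Qed.

Lemma measurable_fun_mxP d (T : measurableType d) m n (f : T -> 'M[R]_(m, n)) :
  (forall i j, measurable_fun setT (fun t => f t i j)) -> measurable_fun setT f.
Proof.
move=> mf; apply: (@measurability _ _ _ _ _ _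
  (\bigcup_ij preimage_set_system setT
     (fun x : 'M[R]_(m, n) => x ij.1 ij.2) measurable)) => //.
move=> _ [_ [[i j] _ [Y mY <-]] <-].
rewrite !setTI /=.
rewrite -[X in measurable X]setTI; exact: mf.
Qed.

End measurable_entries.

Section lebesgue_cV.
Context {R : realType}.

Definition cVcons n (z : measurableTypeR R * 'cV[R]_n) : 'cV[R]_n.+1 :=
  @col_mx R 1 n 1 (z.1 : R)%:M z.2.

Lemma measurable_cVcons n : measurable_fun setT (@cVcons n).
Proof.
apply: measurable_fun_mxP => i j; rewrite ord1.
rewrite /cVcons; have [k ->|k ->] := @split_ordP 1 n i.
- rewrite (_ : (fun _ => _) = fst) //; apply/funext => z.
  by apply: etrans (@col_mxEu R 1 n 1 _ _ k 0) _; rewrite mxE ord1 eqxx mulr1n.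
- rewrite (_ : (fun _ => _) = (fun x : 'cV[R]_n => x k 0) \o snd); last first.
    by apply/funext => z; apply: etrans (@col_mxEd R 1 n 1 _ _ k 0) _.
  by apply: measurableT_comp => //; exact: measurable_mx_entry.
Qed.

HB.instance Definition _ n :=
  isMeasurableFun.Build _ _ _ _ (@cVcons n) (@measurable_cVcons n).

Section cVcons_measure.
Local Open Scope ereal_scope.
Context n (mu : {sigma_finite_measure set 'cV[R]_n -> \bar R}).

Definition cVcons_measure : set 'cV[R]_n.+1 -> \bar R :=
  pushforward (@lebesgue_measure R \x mu) (@cVcons n).

Let cVcons_measure0 : cVcons_measure set0 = 0.
Proof. exact: measure0. Qed.

Let cVcons_measure_ge0 A : 0 <= cVcons_measure A.
Proof. exact: measure_ge0. Qed.

Let cVcons_measure_semi_sigma_additive : semi_sigma_additive cVcons_measure.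
Proof. exact: measure_semi_sigma_additive. Qed.

HB.instance Definition _ := isMeasure.Build _ _ _ cVcons_measure
  cVcons_measure0 cVcons_measure_ge0 cVcons_measure_semi_sigma_additive.

Let uncons (x : 'cV[R]_n.+1) : measurableTypeR R * 'cV[R]_n :=
  (x ord0 ord0, @dsubmx R 1 n 1 x).

Let measurable_uncons : measurable_fun setT uncons.
Proof.
apply/measurable_fun_pairP; split; first exact: measurable_mx_entry.
apply: measurable_fun_mxP => i j.
rewrite (_ : (fun _ => _) = fun x : 'cV[R]_n.+1 => x (@rshift 1 n i) j).
  exact: measurable_mx_entry.
by apply/funext => x; rewrite /= mxE.
Qed.

Let cVconsK : cancel (@cVcons n) uncons.
Proof.
move=> [a y]; rewrite /uncons /cVcons; congr pair; last exact: col_mxKd.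
have -> : ord0 = @lshift 1 n ord0 by apply: val_inj.
by apply: etrans (@col_mxEu R 1 n 1 _ _ _ ord0) _; rewrite mxE eqxx mulr1n.
Qed.

Let cVcons_measure_sigma_finite : sigma_finite setT cVcons_measure.
Proof.
have /sigma_finiteP[F [TF ndF Foo]] := sigma_finiteT (@lebesgue_measure R).
have /sigma_finiteP[G [TG ndG Goo]] := sigma_finiteT mu.
exists (fun k => uncons @^-1` (F k `*` G k)).
  rewrite -preimage_bigcup (_ : \bigcup_k _ = setT) ?preimage_setT//.
  rewrite -subTset => -[x y] _.
  have [k _ Fkx] : (\bigcup_k F k) x by rewrite -TF.
  have [l _ Gly] : (\bigcup_k G k) y by rewrite -TG.
  exists (maxn k l) => //; split => /=.
  - by move: x Fkx; exact/subsetPset/ndF/leq_maxl.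
  - by move: y Gly; exact/subsetPset/ndG/leq_maxr.
move=> k; have [mF Fk] := Foo k; have [mG Gk] := Goo k; split.
  rewrite -[X in measurable X]setTI; apply: measurable_uncons => //.
  exact: measurableX.
rewrite /cVcons_measure /pushforward -comp_preimage.
rewrite (_ : uncons \o _ = id) ?preimage_id.
  by rewrite product_measure1E// lte_mul_pinfty// ge0_fin_numE.
by apply/funext => z; exact: cVconsK.
Qed.

HB.instance Definition _ := Measure_isSigmaFinite.Build _ _ _ cVcons_measure
  cVcons_measure_sigma_finite.

End cVcons_measure.

(* Lebesgue measure on R^n, as an n-fold product of the one-dimensional one *)
Fixpoint lebesgue_cV n : {sigma_finite_measure set 'cV[R]_n -> \bar R} :=
  match n return {sigma_finite_measure set 'cV[R]_n -> \bar R} with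
  | 0 => [the {sigma_finite_measure set 'cV[R]_0 -> \bar R} 
            of dirac (0 : 'cV[R]_0)]
  | n'.+1 => [the {sigma_finite_measure set 'cV[R]_n'.+1 -> \bar R} of
              cVcons_measure (lebesgue_cV n')]
  end.

End lebesgue_cV.

Section sphere.
Context {R : realType} (n : nat).
Local Notation U := 'cV[R]_n.

Definition enorm (x : U) : R := Num.sqrt (\sum_(i < n) x i ord0 ^+ 2).

Lemma enorm_ge0 (x : U) : 0 <= enorm x.
Proof. exact: sqrtr_ge0. Qed.

Lemma measurable_enorm : measurable_fun setT enorm.
Proof.
rewrite (_ : enorm = @Num.sqrt R \o fun x => \sum_(i < n) x i ord0 ^+ 2)//.
apply: measurableT_comp.
  apply: continuous_measurable_fun; exact: sqrt_continuous.
apply: measurable_sum => i; apply: measurable_funX.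
exact: measurable_mx_entry.
Qed.

Definition punctured_eball : set U := [set x | 0 < enorm x <= 1].

Lemma measurable_punctured_eball : measurable punctured_eball.
Proof.
rewrite (_ : punctured_eball = enorm @^-1` `]0, 1]).
  by rewrite -[X in measurable X]setTI; exact: measurable_enorm.
by apply/seteqP; split => x /=; rewrite in_itv.
Qed.

Definition radial_proj (x : U) : U := (enorm x)^-1 *: x.

Lemma measurable_radial_proj : measurable_fun setT radial_proj.
Proof.
apply: measurable_fun_mxP => i j.
rewrite (_ : (fun _ => _) = (fun x => enorm x `^ (-1) * x i j)).
  apply: measurable_funM; last exact: measurable_mx_entry.
  rewrite (_ : (fun _ => _) = (@powR R ^~ (- 1)) \o enorm)//.
  by apply: measurableT_comp => //; exact: measurable_enorm.
by apply/funext => x; rewrite mxE powR_inv1// enorm_ge0.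
Qed.

HB.instance Definition _ :=
  isMeasurableFun.Build _ _ _ _ radial_proj measurable_radial_proj.

(* volume of the cone {r *: w | 0 < r <= 1, w in A}, A in the unit sphere *)
Definition cone_measure : set U -> \bar R :=
  pushforward (mrestr (lebesgue_cV n) measurable_punctured_eball) radial_proj.

Let cone_measure0 : cone_measure set0 = 0%E.
Proof. exact: measure0. Qed.

Let cone_measure_ge0 A : (0 <= cone_measure A)%E.
Proof. exact: measure_ge0. Qed.

Let cone_measure_semi_sigma_additive : semi_sigma_additive cone_measure.
Proof. exact: measure_semi_sigma_additive. Qed.

HB.instance Definition _ := isMeasure.Build _ _ _ cone_measure
  cone_measure0 cone_measure_ge0 cone_measure_semi_sigma_additive.

Lemma inv_ball_volume_ge0 : 0 <= (fine (lebesgue_cV n punctured_eball))^-1.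
Proof. by rewrite invr_ge0 fine_ge0. Qed.

(* Normalized surface measure of the Euclidean unit sphere, defined by polar
   coordinates (cone volume over volume of the unit ball) and regarded as a
   measure on R^n that is carried by the sphere. *)
Definition sphere_measure : set U -> \bar R :=
  mscale (NngNum inv_ball_volume_ge0) cone_measure.

HB.instance Definition _ := Measure.on sphere_measure.

End sphere.

Section dilations.
Context {R : realType} (n : nat).

Definition expmx (A : 'M[R]_n) : 'M[R]_n :=
  limn (series (fun k => (k`!%:R)^-1 *: A ^+ k)).

(* t^P = exp ((ln t) P) *)
Definition dilation (P : 'M[R]_n) (t : R) : 'M[R]_n := expmx (ln t *: P).

Definition eigenvalues_Re_gt0 (P : 'M[R]_n) :=
  forall z : R[i], eigenvalue (map_mx (real_complex R) P) z -> 0 < complex.Re z.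

End dilations.

Section quasi_distance.
Context {R : realType} (n : nat) (P : 'M[R]_n) (rho : 'cV[R]_n -> R).
Local Notation U := 'cV[R]_n.

(* dx = r^(gamma - 1) dsigma(w) dr, with x = A_r w, r = rho(x), rho(w) = 1 *)
Definition polar_decomposition (sigma : {measure set U -> \bar R}) :=
  sigma (~` [set w | rho w = 1]) = 0%E /\
  forall f : U -> \bar R, measurable_fun setT f -> (forall x, (0 <= f x)%E) ->
  (\int[lebesgue_cV n]_x f x =
   \int[lebesgue_measure]_(r in `]0%R, +oo[)
     \int[sigma]_w (f (dilation P r *m w) * (r `^ (\tr P - 1))%:E))%E.

Record quasi_distance : Prop := QuasiDistance {
  qdist_measurable : measurable_fun setT rho ;
  qdist_homogeneous : forall t x, 0 < t -> rho (dilation P t *m x) = t * rho x ;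
  qdist0 : rho 0 = 0 ;
  qdist_sym : forall x y, rho (x - y) = rho (y - x) ;
  qdist_ge0 : forall x, 0 <= rho x ;
  qdist_gt0 : forall x, x != 0 -> 0 < rho x ;
  qdist_triangle : exists k : R,
    forall x y z, rho (x - y) <= k * (rho (x - z) + rho (y - z)) ;
  qdist_polar : exists sigma, polar_decomposition sigma
}.

Definition ellipsoid (x : U) (r : R) : set U := [set y | rho (x - y) < r].

End quasi_distance.

Section morrey.
Local Open Scope ereal_scope.
Context {R : realType} (n : nat) (rho : 'cV[R]_n -> R).
Local Notation U := 'cV[R]_n.
Local Notation mu := (lebesgue_cV n : {measure set U -> \bar R}).
Local Notation E := (ellipsoid rho).
Implicit Types (p : R) (psi : U -> R -> R) (f : U -> \bar R).

(* Functions are extended-real valued because a maximal function may take the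
   value +oo; finite norms force finiteness almost everywhere. *)
Definition Lnorm_on p (D : set U) f : \bar R := 'N[mu]_p%:E[f \_ D].

Definition weak_Lnorm_on p (D : set U) f : \bar R :=
  ereal_sup [set t%:E * mu (D `&` [set y | t%:E < `|f y|]) `^ p^-1
            | t in `]0%R, +oo[].

(* The spaces M_{p,psi,P} and WM_{p,psi,P} differ only in the local quasi-norm
   N, which is Lnorm_on p or weak_Lnorm_on p. *)
Definition gen_morrey_norm p psi (N : set U -> (U -> \bar R) -> \bar R) f :=
  ereal_sup [set ((psi z.1 z.2)^-1)%:E * mu (E z.1 z.2) `^ (- p^-1)
                 * N (E z.1 z.2) f
            | z in [set: U] `*` `]0%R, +oo[].

Definition gen_morrey_space p psi (N : set U -> (U -> \bar R) -> \bar R) f :=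
  [/\ measurable_fun setT f,
      forall K : set U, compact K -> N K f < +oo &
      gen_morrey_norm p psi N f < +oo].

Definition morrey_norm p psi := gen_morrey_norm p psi (Lnorm_on p).
Definition morrey p psi := gen_morrey_space p psi (Lnorm_on p).
Definition weak_morrey_norm p psi := gen_morrey_norm p psi (weak_Lnorm_on p).
Definition weak_morrey p psi := gen_morrey_space p psi (weak_Lnorm_on p).

Definition bounded_operator (X : set (U -> \bar R)) (NX : (U -> \bar R) -> \bar R)
    (Y : set (U -> \bar R)) (NY : (U -> \bar R) -> \bar R)
    (T : (U -> \bar R) -> (U -> \bar R)) :=
  exists C : R, forall f, X f -> Y (T f) /\ NY (T f) <= C%:E * NX f.

End morrey.

Section rough_operators.
Local Open Scope ereal_scope.
Context {R : realType} (n : nat) (P : 'M[R]_n) (rho : 'cV[R]_n -> R).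
Local Notation U := 'cV[R]_n.
Local Notation mu := (lebesgue_cV n : {measure set U -> \bar R}).
Local Notation E := (ellipsoid rho).
Local Notation gamma := (\tr P).
Variables (Omega : U -> R) (alpha : R).

Definition homogeneous0 := forall t x, (0 < t)%R ->
  Omega (dilation P t *m x) = Omega x.

Definition frac_maximal (f : U -> \bar R) (x : U) : \bar R :=
  ereal_sup [set mu (E x t) `^ (- 1 + alpha / gamma) *
                 \int[mu]_(y in E x t) (`|Omega (x - y)%R|%:E * `|f y|)
            | t in `]0%R, +oo[].

(* Where the integral does not converge absolutely its value is +oo or -oo
   (the library sets +oo - oo = -oo), so a function of this form which has
   finite norm is given by an absolutely convergent integral a.e. *)
Definition frac_integral (f : U -> \bar R) (x : U) : \bar R :=
  \int[mu]_y ((Omega (x - y) / rho (x - y) `^ (gamma - alpha))%:E * f y).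

End rough_operators.

(* Main.v *)
(** Averages over ellipsoids of [|Omega(x - .) f|] are controlled by two
    Hoelder inequalities.  By the first one, with the homogeneous kernel in
    some [L_s0] on the unit ellipsoid, they are at most [t^gamma] times the
    mean of [|f|^u] to the power [1/u], [u = s0' < p].  By the second one they
    are at most [C N t^(gamma - b)], [b = alpha q / (q - p)], where [N] is the
    Morrey norm of [f]; this uses the integral condition on [phi].  For [x] in
    [E(x0, r)] the first bound is uniform in [t]: radii [t <= r] only see
    [f 1_E(x0, 2Kr)] and are bounded by its maximal function, radii [t > r]
    are bounded by [N phi(x0, r)^(1/p)] because of the condition on the
    essential infimum.  Interpolating (Hedberg's argument; the layer cake
    formula in the case of the potential) gives
    [|T f(x)| <= C A(x)^(p/q) N^(1 - p/q)], and the maximal theorem bounds the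
    integral of [A^p] over [E(x0, r)].

    The integrability of [Omega] on the unit ellipsoid follows from that on the
    Euclidean sphere since the orbits of the dilations identify the two shells
    by a Lipschitz map; a Lipschitz image of a measure absolutely continuous
    with respect to Lebesgue's is estimated through a density argument.  The
    Vitali covering for ellipsoids needs only the quasi-triangle inequality.

    For [p = 1] the hypotheses [1 <= s' < p] are contradictory. *)

Require Import Defs.
From HB Require Import structures.
From mathcomp Require Import all_boot all_order all_algebra.
From mathcomp Require Import all_classical all_reals all_analysis.
From mathcomp Require Import measurable_realfun ess_sup_inf.
From mathcomp Require Import ring lra.

Set Implicit Arguments.
Unset Strict Implicit.
Unset Printing Implicit Defensive.

Import Order.TTheory GRing.Theory Num.Theory.
Import numFieldNormedType.Exports.

Local Open Scope classical_set_scope.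
Local Open Scope ring_scope.

(** * Lebesgue measure on column vectors *)

(** [rho] is known to be measurable, positive off 0 and quasi-subadditive, but not continuous, and
    the measure [sigma] in its polar decomposition is given by existence only. A Steinhaus argument
    meets the first obstacle: measure alone makes [rho] locally bounded, and homogeneity along the
    orbits [expmx (s *: P) *m x] then relates small [rho] to small norm. The second is met by
    working with dilation-invariant functions, for which [sigma] enters through one common factor
    that drops out between ellipsoids and shells.

    The number b is forced: with theta = p/q, the powers of t in (t^alpha A)^theta (B t^(alpha -
    b))^(1 - theta) cancel exactly when b (1 - theta) = alpha. The exponent u must stay strictly
    below p because a maximal function of |f|^u is later raised to the power p/u, and the maximal
    theorem needs p/u > 1; this is where s' < p enters.

    Suprema are reduced to countable families with rational data: this gives measurability, and
    level sets that are exhausted by finite covers. *)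

Section norm_cV.
Context {R : realType}.

Lemma norm_mx_lt m n (x : 'M[R]_(m, n)) r : 0 < r ->
  (`|x| < r) <-> (forall i j, `|x i j| < r).
Proof.
move=> r0; rewrite /Num.norm/= mx_normrE; split.
  by move/bigmax_ltP => [_ h] i j; exact: (h (i, j)).
by move=> h; apply/bigmax_ltP; split => // -[i j] _; exact: h.
Qed.

Lemma norm_mx_le m n (x : 'M[R]_(m, n)) r : 0 <= r ->
  (`|x| <= r) <-> (forall i j, `|x i j| <= r).
Proof.
move=> r0; rewrite /Num.norm/= mx_normrE; split.
  by move/bigmax_leP => [_ h] i j; exact: (h (i, j)).
by move=> h; apply/bigmax_leP; split => // -[i j] _; exact: h.
Qed.

Lemma norm_mx_entry m n (x : 'M[R]_(m, n)) i j : `|x i j| <= `|x|.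
Proof. by have [+ _] := norm_mx_le x (normr_ge0 x); apply. Qed.

Lemma norm_mulmx m n p (A : 'M[R]_(m, n)) (B : 'M[R]_(n, p)) :
  `|A *m B| <= n%:R * `|A| * `|B|.
Proof.
apply/norm_mx_le; first by rewrite !mulr_ge0.
move=> i j; rewrite mxE; apply: (le_trans (ler_norm_sum _ _ _)).
apply: (@le_trans _ _ (\sum_(k < n) `|A| * `|B|)); last first.
  by rewrite sumr_const card_ord -[leLHS]mulr_natl mulrA.
by apply: ler_sum => k _; rewrite normrM ler_pM// norm_mx_entry.
Qed.

Lemma dense_rat_cV n (x : 'cV[R]_n) (e : R) : 0 < e ->
  exists q : 'cV[rat]_n, `|x - map_mx ratr q| < e.
Proof.
move=> e0.
have h (i : 'I_n) : exists q : rat, `|x i ord0 - ratr q| < e.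
  have [q] : exists q : rat, ratr q \in `](x i ord0 - e), (x i ord0 + e)[.
    by apply: rat_in_itvoo; lra.
  rewrite in_itv/= => /andP[h1 h2]; exists q.
  by rewrite ltr_norml; apply/andP; split; lra.
have /choice [q hq] := h.
exists (\col_i q i); apply/norm_mx_lt => // i j.
by rewrite !mxE ord1; exact: hq.
Qed.

End norm_cV.

Section measurable_cV.
Context {R : realType} (n : nat).
Local Notation U := 'cV[R]_n.

Lemma measurable_subcV (x : U) : measurable_fun setT (fun y : U => x - y).
Proof.
apply: measurable_fun_mxP => i j; rewrite (_ : (fun _ => _) = fun y : U => x i j - y i j).
  by apply: measurable_funB => //; exact: measurable_mx_entry.
by apply/funext => y; rewrite !mxE.
Qed.

Lemma measurable_mulcV m (A : 'M[R]_(m, n)) : measurable_fun setT (fun y : U => A *m y).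
Proof.
apply: measurable_fun_mxP => i j.
rewrite (_ : (fun _ => _) = fun y : U => \sum_(k < n) A i k * y k j).
  apply: measurable_sum => k; apply: measurable_funM => //.
  exact: measurable_mx_entry.
by apply/funext => y; rewrite !mxE.
Qed.

Lemma measurable_subcV2 : measurable_fun setT (fun z : U * U => z.1 - z.2).
Proof.
apply: measurable_fun_mxP => i j.
rewrite (_ : (fun _ => _) =
  ((fun y : U => y i j) \o fst) \- ((fun y : U => y i j) \o snd)).
  by apply: measurable_funB; apply: measurableT_comp => //; exact: measurable_mx_entry.
by apply/funext => y; rewrite !mxE.
Qed.

Lemma measurable_norm_lt (c : U) r : measurable [set y : U | `|c - y| < r].
Proof.
have [r0|r0] := ltP 0 r; last first.
  rewrite (_ : mkset _ = set0)//; apply/seteqP; split => // y /=.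
  by move=> h; have := lt_le_trans h r0; rewrite normr_lt0.
rewrite (_ : mkset _ = \bigcap_(i in [set: 'I_n])
    ((fun y : U => y i ord0) @^-1` [set t | `|c i ord0 - t| < r])).
  apply: fin_bigcap_measurable => // i _.
  rewrite -[X in measurable X]setTI; apply: measurable_mx_entry => //.
  rewrite (_ : mkset _ = `](c i ord0 - r), (c i ord0 + r)[%classic)//.
  by apply/seteqP; split => t /=; rewrite in_itv/= ltr_norml => h; apply/andP; lra.
apply/seteqP; split => y /=.
  by move/(norm_mx_lt _ r0) => h i _ /=; have := h i ord0; rewrite !mxE.
by move=> h; apply/norm_mx_lt => // i j; rewrite ord1 !mxE; exact: (h i).
Qed.

Lemma open_norm_lt (A : set U) : open A <->
  forall x, A x -> exists2 e, 0 < e & [set y | `|x - y| < e] `<=` A.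
Proof.
rewrite openE; split => h x Ax.
  have := h _ Ax; rewrite /= /interior => /(nbhs_normP (x : 'cV[R]_n))[e/= e0 he]; exists e => //.
have [e e0 he] := h x Ax; apply/(nbhs_normP (x : 'cV[R]_n)); exists e => //.
Qed.

(** Links the sup-norm topology with the sigma-algebra generated by the entries: an open set is the
    union of the countably many rational balls [F z] that it contains. *)
Lemma open_measurable_cV (A : set U) : open A -> measurable A.
Proof.
move=> /open_norm_lt oA.
pose F (z : 'cV[rat]_n * rat) : set U :=
  [set y | `|map_mx ratr z.1 - y| < ratr z.2].
rewrite (_ : A = \bigcup_(z in [set z | F z `<=` A]) F z).
  rewrite bigcup_mkcond; apply: countable_bigcupT_measurable => // z.
  by case: ifP => _ //; exact: measurable_norm_lt.
apply/seteqP; split => [x Ax|x [z zA]]; last exact: zA.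
have [e e0 he] := oA _ Ax.
have [r] : exists r : rat, ratr r \in `](0 : R), (e / 2)[.
  by apply: rat_in_itvoo; lra.
rewrite in_itv/= => /andP[r0 r1].
have [q hq] := dense_rat_cV x r0.
exists (q, r) => //; last by rewrite /F/= -normrN opprB.
move=> y /= hy; apply: he => /=.
rewrite -[x](subrK (map_mx ratr q)) -addrA (le_lt_trans (ler_normD _ _))//.
rewrite /F/= in hy; lra.
Qed.

End measurable_cV.

(** * Reflection invariance and the volume of cubes *)

Section reflection.
Context {R : realType}.

Definition reflectR (a : R) (t : measurableTypeR R) : measurableTypeR R := a - t.

Lemma measurable_reflectR a : measurable_fun setT (reflectR a).
Proof. by apply: measurable_funB. Qed.

HB.instance Definition _ a :=
  isMeasurableFun.Build _ _ _ _ (reflectR a) (measurable_reflectR a).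

Lemma lebesgue_measure_reflect a (A : set R) : measurable A ->
  lebesgue_measure (reflectR a @^-1` A) = lebesgue_measure A.
Proof.
move=> mA; apply/esym.
apply: (@lebesgue_measure_unique _
  [the {measure set (measurableTypeR R) -> \bar R} of pushforward lebesgue_measure (reflectR a)]) => //=.
move=> _ [[b c]] _ <-.
(* The reflection exchanges the open and the closed end of the interval, which its length does not
   see. *)
rewrite /pushforward (_ : _ @^-1` _ = `[a - c, a - b[%classic); last first.
  by apply/seteqP; split => t /=; rewrite /reflectR !in_itv/= => /andP[? ?]; apply/andP; split; lra.
rewrite !lebesgue_measure_itv/= !lte_fin.
have -> : (a - c < a - b) = (b < c) by apply/idP/idP => ?; lra.
by case: ifP => // _; rewrite -!EFinD; congr EFin; lra.
Qed.

Variable n : nat.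
(** Reflections take the place of translations: kernels and ellipsoids depend on [x - y], so a
    single change of variables recentres them at the origin. *)
Definition reflect_cV (x y : 'cV[R]_n) : 'cV[R]_n := x - y.

HB.instance Definition _ x :=
  isMeasurableFun.Build _ _ _ _ (reflect_cV x) (measurable_subcV x).
End reflection.

Section reflection_measure.
Context {R : realType}.
Local Notation mu n := (lebesgue_cV n : {measure set 'cV[R]_n -> \bar R}).

Definition reflect_cons n (x : 'cV[R]_n.+1) (z : measurableTypeR R * 'cV[R]_n) :
   measurableTypeR R * 'cV[R]_n :=
  (reflectR (x ord0 ord0) z.1, reflect_cV (@dsubmx R 1 n 1 x) z.2).

Lemma measurable_reflect_cons n (x : 'cV[R]_n.+1) : measurable_fun setT (reflect_cons x).
Proof.
apply/measurable_fun_pairP; split.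
  by apply: (measurableT_comp (measurable_reflectR _)).
by apply: (measurableT_comp (measurable_subcV _)).
Qed.

HB.instance Definition _ n (x : 'cV[R]_n.+1) :=
  isMeasurableFun.Build _ _ _ _ (reflect_cons x) (measurable_reflect_cons x).

Lemma cVcons_reflect n (x : 'cV[R]_n.+1) z :
  reflect_cV x (cVcons z) = cVcons (reflect_cons x z).
Proof.
rewrite /reflect_cV /reflect_cons /cVcons/=.
have {1}-> : x = @col_mx R 1 n 1 (x ord0 ord0)%:M (@dsubmx R 1 n 1 x).
  rewrite -[LHS](@vsubmxK R 1 n 1); congr (@col_mx R 1 n 1 _ _).
  rewrite [LHS]mx11_scalar !mxE; congr (x _ _)%:M; exact: val_inj.
rewrite (@opp_col_mx R 1 n 1) (@add_col_mx R 1 n 1); congr (@col_mx R 1 n 1 _ _).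
by rewrite /reflectR raddfB.
Qed.

(** Induction on the dimension: a reflection is a product of a one-dimensional and a
    lower-dimensional one, and a product measure is determined by its values on rectangles. *)
Lemma lebesgue_cV_reflect n (x : 'cV[R]_n) (A : set 'cV[R]_n) : measurable A ->
  mu n (reflect_cV x @^-1` A) = mu n A.
Proof.
elim: n x A => [x A mA|n IH x A mA].
  by rewrite (_ : _ @^-1` _ = A)//; apply/seteqP; split => y /=; rewrite !(flatmx0 _).
rewrite /= /cVcons_measure /pushforward/=.
set S := @cVcons R n @^-1` A.
have mS : measurable S by rewrite -[S]setTI; exact: measurable_cVcons.
rewrite (_ : _ @^-1` _ = reflect_cons x @^-1` S); last first.
  by apply/seteqP; split => z; rewrite /S/= cVcons_reflect.
apply/esym.
apply: (@product_measure_unique _ _ _ _ _ _ _ [the measure _ _ of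
  pushforward (lebesgue_measure \x lebesgue_cV n)%E (reflect_cons x)]) => // B C mB mC.
rewrite /= /pushforward (_ : _ @^-1` _ =
  (reflectR (x ord0 ord0) @^-1` B) `*` (reflect_cV (@dsubmx R 1 n 1 x) @^-1` C))//.
have m1 : measurable (reflectR (x ord0 ord0) @^-1` B).
  by rewrite -[X in measurable X]setTI; exact: measurable_reflectR.
have m2 : measurable (reflect_cV (@dsubmx R 1 n 1 x) @^-1` C).
  by rewrite -[X in measurable X]setTI; exact: measurable_subcV.
rewrite product_measure1E//; congr (_ * _)%E; first exact: lebesgue_measure_reflect.
exact: IH.
Qed.

Lemma ge0_integral_reflect n (x : 'cV[R]_n) (f : 'cV[R]_n -> \bar R) :
  measurable_fun setT f -> (forall y, 0 <= f y)%E ->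
  (\int[mu n]_y f (x - y)%R = \int[mu n]_y f y)%E.
Proof.
move=> mf f0.
transitivity (\int[pushforward (mu n) (reflect_cV x)]_y f y)%E.
  by rewrite ge0_integral_pushforward//; exact: measurable_subcV.
by apply: eq_measure_integral => A mA _; exact: lebesgue_cV_reflect.
Qed.

(** In the sup norm a ball is a cube of side 2r, hence a product over the entries. The centre is
    kept as [0 -] to match the shape of a general ball. *)
Lemma lebesgue_cV_ball0 n (r : R) : 0 < r ->
  mu n [set y : 'cV[R]_n | `|0 - y| < r] = ((2 * r) ^+ n)%:E.
Proof.
have subE m (v : 'cV[R]_m) i j : (0 - v) i j = - v i j by rewrite !mxE sub0r.
move=> r0; elim: n => [|n IH].
  rewrite expr0 /= diracE mem_set//=.
  by apply/norm_mx_lt => // -[].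
rewrite /= /cVcons_measure /pushforward/=.
rewrite (_ : _ @^-1` _ = `]-r, r[%classic `*` [set y : 'cV[R]_n | `|0 - y| < r]).
  rewrite product_measure1E//=; last exact: measurable_norm_lt.
  rewrite [X in (_ * X)%E]IH lebesgue_measure_itv/= lte_fin ifT; last lra.
  by rewrite -EFinD -EFinM exprS; congr (_ * _)%:E; lra.
apply/seteqP; split => -[a y] /=.
  move/(norm_mx_lt _ r0) => h; split.
    have := h (@lshift 1 n ord0) ord0.
    rewrite subE normrN /cVcons.
    rewrite (@col_mxEu R 1 n 1 (a%:M) y ord0 ord0) mxE mulr1n.
    by rewrite in_itv/= ltr_norml.
  apply/norm_mx_lt => // i j; have := h (@rshift 1 n i) j.
  rewrite subE normrN /cVcons.
  by rewrite (@col_mxEd R 1 n 1 (a%:M) y i j) => ?; rewrite subE normrN.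
rewrite in_itv/= => -[ha] /(norm_mx_lt _ r0) h.
apply/norm_mx_lt => // i j; rewrite subE normrN /cVcons.
have [k ->|k ->] := @split_ordP 1 n i.
  rewrite (@col_mxEu R 1 n 1 (a%:M) y k j) !ord1 mxE mulr1n.
  by rewrite ltr_norml.
by rewrite (@col_mxEd R 1 n 1 (a%:M) y k j); have := h k j; rewrite subE normrN.
Qed.

Lemma lebesgue_cV_ball n (x : 'cV[R]_n) (r : R) : 0 < r ->
  mu n [set y : 'cV[R]_n | `|x - y| < r] = ((2 * r) ^+ n)%:E.
Proof.
move=> r0; rewrite -(lebesgue_cV_ball0 n r0).
rewrite -(lebesgue_cV_reflect x); last exact: measurable_norm_lt.
congr (mu n _); apply/seteqP; split => y /=; rewrite /reflect_cV sub0r normrN//.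
  by rewrite opprB addrC subrK.
by rewrite opprB addrC subrK.
Qed.

End reflection_measure.

(** * Outer regularity and Lipschitz images *)

Section regularity.
Context {R : realType} (n : nat).
Local Notation U := 'cV[R]_n.
Variable nu : {finite_measure set U -> \bar R}.
Local Open Scope ereal_scope.

(** Squeezing A between a closed and an open set, rather than approximating from outside only, makes
    the property stable under complements. *)
Definition regular_set (A : set U) := forall e : R, (0 < e)%R -> exists V F,
  [/\ open V, closed F, F `<=` A, A `<=` V & nu (V `\` F) <= e%:E].

Let mV (A : set U) : open A -> measurable A := @open_measurable_cV R n A.
Lemma closed_measurable_cV (A : set U) : closed A -> measurable A.
Proof.
by move=> cA; rewrite -[A]setCK; apply: measurableC; apply: mV; exact: closed_openC.
Qed.
Let mF := closed_measurable_cV.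

Let finite_nonincreasing_small (G : (set U)^nat) (e : R) : (0 < e)%R ->
  (forall k, measurable (G k)) -> nonincreasing_seq G -> \bigcap_k G k = set0 ->
  exists N, nu (G N) <= e%:E.
Proof.
move=> e0 mG dG G0.
have h : nu (G k) @[k --> \oo] --> 0.
  rewrite -[0](measure0 nu) -G0; apply: nonincreasing_cvg_mu => //.
    by rewrite ltey_eq fin_num_measure.
  by rewrite G0.
have /fine_cvgP[_ /cvgrPdist_le/(_ e e0)] := h.
case=> N _ /(_ N (leqnn N)); rewrite sub0r normrN ger0_norm; last exact: fine_ge0.
move=> hN; exists N; rewrite -lee_fin fineK// in hN; exact: fin_num_measure.
Qed.

Lemma regular_setC A : regular_set A -> regular_set (~` A).
Proof.
move=> rA e e0; have [V [F [opV cF FA AV VF]]] := rA _ e0.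
exists (~` F), (~` V); split; [exact: closed_openC|exact: open_closedC| | |].
- exact: subsetC.
- exact: subsetC.
- by rewrite setDE setCK setIC -setDE.
Qed.

(** An infinite union of closed sets need not be closed, so only finitely many [F k] are kept: the
    remainders [G N] decrease to the empty set, and finiteness of [nu] makes one of them small. *)
Lemma regular_bigcup (A : (set U)^nat) :
  (forall k, regular_set (A k)) -> regular_set (\bigcup_k A k).
Proof.
move=> rA e e0.
(* Half of e pays for the gaps between [V k] and [F k], summed geometrically, the other half for the
   remainder [G N]. *)
have e2 k : (0 < e / 2 / (2 ^ k.+1)%:R)%R by rewrite !divr_gt0// ltr0n expn_gt0.
have /choice[V hO] : forall k, exists V, exists F,
    [/\ open V, closed F, F `<=` A k, A k `<=` V & nu (V `\` F) <= (e / 2 / (2 ^ k.+1)%:R)%:E].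
  by move=> k; exact: rA.
have /choice[F hF] := hO.
pose G N := \bigcup_k F k `\` \big[setU/set0]_(k < N) F k.
have mFk k : measurable (F k) by have [_ + _ _ _] := hF k; exact: mF.
have mOk k : measurable (V k) by have [+ _ _ _ _] := hF k; exact: mV.
have mG N : measurable (G N).
  apply: measurableD; first exact: bigcupT_measurable.
  exact: bigsetU_measurable.
have [N hN] : exists N, nu (G N) <= (e / 2)%:E.
  apply: finite_nonincreasing_small => //; first by rewrite divr_gt0.
    apply/nonincreasing_seqP => k; apply/subsetPset => x [Fx nx]; split => //.
    by move=> h; apply: nx; rewrite big_ord_recr/=; left.
  apply/seteqP; split => // x h; have [[k _ Fx] _] := h 0%N I.
  have [_ /(_ _)] := h k.+1 I; apply.
  by rewrite big_ord_recr/=; right.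
exists (\bigcup_k V k), (\big[setU/set0]_(k < N) F k); split.
- by apply: bigcup_open => k _; have [] := hF k.
- by apply: closed_bigsetU => k _; have [] := hF k.
- move=> x; rewrite -bigcup_mkord => -[k _ Fx]; exists k => //.
  by have [_ _ + _ _] := hF k; apply.
- by apply: subset_bigcup => k _; have [] := hF k.
apply: (@le_trans _ _ (nu (\bigcup_k (V k `\` F k) `|` G N))).
  apply: le_measure; rewrite ?inE.
  - apply: measurableD; first exact: bigcupT_measurable.
    exact: bigsetU_measurable.
  - apply: measurableU => //; apply: bigcupT_measurable => k; exact: measurableD.
  - move=> x [[k _ Ox] nx]; have [Fx|nF] := pselect ((\bigcup_k F k) x).
      by right.
    by left; exists k => //; split => // Fx; apply: nF; exists k.
apply: le_trans (measureU2 _ _ _) _ => //.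
  by apply: bigcupT_measurable => k; exact: measurableD.
rewrite [e]splitr EFinD; apply: leeD => //.
have mVF k : measurable (V k `\` F k) by exact: measurableD.
apply: (@le_trans _ _ (\sum_(k <oo) nu (V k `\` F k))).
  by apply: generalized_Boole_inequality => //; exact: bigcupT_measurable.
apply: le_trans (epsilon_trick0 xpredT _) => //; last by rewrite divr_ge0// ltW.
by apply: lee_nneseries => [k _|k _]; [by []|by have [] := hF k].
Qed.

Lemma regular_entry_gt i (a : R) : regular_set [set x : U | (a < x i ord0)%R].
Proof.
move=> e e0.
pose F k := [set x : U | (a + k.+1%:R^-1 <= x i ord0)%R].
have cF k : closed (F k).
  rewrite (_ : F k = (fun x : U => x i ord0) @^-1` [set t | (a + k.+1%:R^-1 <= t)%R])//.
  apply: closed_comp; last exact: closed_ge.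
  by move=> x _; exact: coord_continuous.
have oA : open [set x : U | (a < x i ord0)%R].
  rewrite (_ : mkset _ = (fun x : U => x i ord0) @^-1` [set t | (a < t)%R])//.
  by apply: open_comp; [move=> x _; exact: coord_continuous|exact: open_gt].
have [N hN] : exists N, nu ([set x : U | (a < x i ord0)%R] `\` F N) <= e%:E.
  apply: finite_nonincreasing_small => //.
  - by move=> k; apply: measurableD; [exact: mV|exact: mF].
  - apply/nonincreasing_seqP => k; apply/subsetPset => x [ax nF]; split => //.
    apply: contra_not nF; rewrite /F/=; apply: le_trans.
    by rewrite lerD2l lef_pV2 ?posrE// ler_nat.
  - apply/seteqP; split => // x h.
    have [ax _] := h 0%N I; rewrite /= in ax.
    have [k hk] : exists k, (k.+1%:R^-1 <= x i ord0 - a)%R.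
      have ax0 : (0 < x i ord0 - a)%R by rewrite subr_gt0.
      exists (Num.truncn (x i ord0 - a)^-1).
      rewrite invf_ple ?posrE//; apply: ltW; exact: truncnS_gt.
    have [_] := h k I; apply; rewrite /F/=; by rewrite -lerBrDl.
exists [set x : U | (a < x i ord0)%R], (F N); split => //.
by move=> x; rewrite /F/=; apply: lt_le_trans; rewrite ltrDl.
Qed.

Lemma measurable_regular (A : set U) : measurable A -> regular_set A.
Proof.
have r0 : regular_set set0.
  by move=> e e0; exists set0, set0; split; [exact: open0|exact: closed0|by []|by []|rewrite setD0 measure0 lee_fin ltW].
have sr : sigma_algebra setT regular_set.
  by split => // [B rB|]; [rewrite setTD; exact: regular_setC|exact: regular_bigcup].
move=> mA; apply: (mA); split => // _ [[i j] _ [Y mY <-]]/=.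
rewrite setTI ord1.
(* The sets of reals whose cylinder is regular form a sigma-algebra, so it suffices to treat the
   open rays, which generate the Borel sets. *)
have sr' : sigma_algebra setT [set Y : set R | regular_set ((fun x : U => x i ord0) @^-1` Y)].
  split => //=.
  - by move=> B rB; rewrite setTD preimage_setC; exact: regular_setC.
  - by move=> B rB; rewrite preimage_bigcup; exact: regular_bigcup.
have : (@ocitv R).-sigma.-measurable Y by exact: mY.
rewrite RGenOInfty.measurableE => {}mY; apply: (mY [set Y : set R | regular_set ((fun x : U => x i ord0) @^-1` Y)]); split => //.
move=> _ [a ->]/=; rewrite (_ : _ @^-1` _ = [set x : U | (a < x i ord0)%R]).
  exact: regular_entry_gt.
by apply/seteqP; split => x/=; rewrite in_itv/= andbT.
Qed.

Lemma outer_regular_cV (A : set U) (e : R) : measurable A -> (0 < e)%R ->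
  exists2 V, open V & A `<=` V /\ nu V <= nu A + e%:E.
Proof.
move=> mA e0; have [V [F [opV cF FA AV VF]]] := measurable_regular mA e0.
exists V => //; split => //.
rewrite -[V](setDUK AV).
apply: le_trans (measureU2 _ _ _) _ => //; first by apply: measurableD => //; exact: mV.
rewrite leeD2l//; apply: le_trans VF; apply: le_measure; rewrite ?inE.
- by apply: measurableD => //; exact: mV.
- by apply: measurableD; [exact: mV|exact: mF].
- exact: setDS.
Qed.

End regularity.

(** * Domination of Lebesgue measure through lower densities *)

Section density.
Context {R : realType} (n : nat).
Local Notation U := 'cV[R]_n.
Local Notation mu := (lebesgue_cV n : {measure set U -> \bar R}).
Local Open Scope ereal_scope.

Let neighborhood (V : set U) (r : R) : set (U * U) :=
  [set z | V z.2 /\ (`|z.1 - z.2| < r)%R].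

Let measurable_neighborhood V r : measurable V -> measurable (neighborhood V r).
Proof.
move=> mV.
rewrite (_ : neighborhood V r = snd @^-1` V `&`
   (fun z : U * U => (z.1 - z.2)%R) @^-1` [set y | (`|0 - y| < r)%R]).
  apply: measurableI; rewrite -[X in measurable X]setTI.
    exact: measurable_snd.
  by apply: measurable_subcV2 => //; exact: measurable_norm_lt.
by apply/seteqP; split => -[x y]; rewrite /neighborhood/= sub0r normrN.
Qed.

(** Chebyshev's inequality for the function y |-> nu (V cut with the r-ball about y). Its Lebesgue
    integral is computed by Tonelli in the other order, where each z in V contributes the volume
    (2r)^n of a ball. *)
Let weak_density (nu : {finite_measure set U -> \bar R}) (V : set U) (a r : R) :
  measurable V -> (0 < r)%R -> (0 < a)%R ->
  let S := [set y | a%:E <= nu (V `&` [set z | (`|y - z| < r)%R])] in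
  measurable S /\ a%:E * mu S <= ((2 * r) ^+ n)%:E * nu V.
Proof.
move=> mV r0 a0 S.
have mN := measurable_neighborhood r mV.
have xE y : xsection (neighborhood V r) y = V `&` [set z | (`|y - z| < r)%R].
  by apply/seteqP; split => z; rewrite /xsection/= inE.
have mS : measurable S.
  rewrite (_ : S = setT `&` (nu \o xsection (neighborhood V r)) @^-1` `[a%:E, +oo[).
    by apply: (measurable_fun_xsection nu mN) => //; exact: emeasurable_itv.
  by rewrite setTI; apply/seteqP; split => y; rewrite /S/= in_itv/= andbT xE.
split => //.
apply: (@le_trans _ _ (\int[mu]_(y in S) (nu \o xsection (neighborhood V r)) y)).
  rewrite -integral_cst//; apply: ge0_le_integral => //.
  - by move=> y _; rewrite lee_fin ltW.
  - by apply: measurable_funTS; exact: measurable_fun_xsection.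
  - by move=> y; rewrite /S/= xE.
apply: (@le_trans _ _ (\int[mu]_y (nu \o xsection (neighborhood V r)) y)).
  apply: ge0_subset_integral => //; exact: measurable_fun_xsection.
rewrite -(indic_fubini_tonelli_FE nu mN) (indic_fubini_tonelli _ nu mN).
rewrite (indic_fubini_tonelli_GE _ mN).
rewrite -integral_cst// [X in _ <= X]integral_mkcond.
apply: ge0_le_integral => //.
- exact: measurable_fun_ysection.
- by apply/(measurable_restrictT _ _).1.
- move=> y _; rewrite patchE; case: ifPn => [|yV].
    rewrite inE => Vy /=; rewrite -(lebesgue_cV_ball y r0); apply: le_measure; rewrite ?inE.
    + exact: measurable_ysection.
    + exact: measurable_norm_lt.
    + by move=> z; rewrite /ysection/= inE /neighborhood/= distrC => -[].
  rewrite /= (_ : ysection _ _ = set0) ?measure0//.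
  apply/seteqP; split => // z; rewrite /ysection/= inE => -[] /= Vy _.
  by move: yV; rewrite notin_setE.
Qed.

(** At scale L / (m + 1) the constant from [weak_density] is L^n whatever m is, so the bound passes
    to the lower limit of the sets [S m]. To contain D this limit needs the small balls to lie
    inside the tested set; hence D is replaced by an open V, and outer regularity makes the
    replacement cost at most e. *)
Lemma density_domination (nu : {finite_measure set U -> \bar R}) (D : set U) (L : R) :
  measurable D -> (0 < L)%R ->
  (forall y, D y -> \forall m \near \oo,
     ((2 / m.+1%:R) ^+ n)%:E <= nu [set z | (`|y - z| < L / m.+1%:R)%R]) ->
  mu D <= (L ^+ n)%:E * nu D.
Proof.
move=> mD L0 hD; apply/lee_addgt0Pr => e e0.
have Ln0 : (0 < L ^+ n)%R by rewrite exprn_gt0.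
have [V opV [DV nuV]] := outer_regular_cV nu mD (divr_gt0 e0 Ln0).
have mV := open_measurable_cV opV.
pose S m := [set y | ((2 / m.+1%:R) ^+ n)%:E <= nu (V `&` [set z | (`|y - z| < L / m.+1%:R)%R])].
have d0 m : (0 < L / m.+1%:R)%R by rewrite divr_gt0.
have a0 m : (0 < (2 / m.+1%:R) ^+ n :> R)%R by rewrite exprn_gt0// divr_gt0.
have hS m : measurable (S m) /\ mu (S m) <= (L ^+ n)%:E * nu V.
  have [mS h] := weak_density nu mV (d0 m) (a0 m); split => //.
  rewrite -(@lee_pmul2l _ ((2 / m.+1%:R) ^+ n)%:E)// ?lte_fin//.
  apply: (le_trans h); rewrite muleA -EFinM -exprMn lee_wpmul2r// lee_fin.
  by rewrite mulrA [(2 * L)%R]mulrC -mulrA mulrC.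
pose T N := \bigcap_(m in [set m | (N <= m)%N]) S m.
have mT N : measurable (T N).
  by apply: bigcap_measurableType => m _; exact: (hS m).1.
have DT : D `<=` \bigcup_N T N.
  move=> y Dy.
  have [N1 _ h1] := hD _ Dy.
  have [r r0 hr] := (open_norm_lt V).1 opV y (DV _ Dy).
  exists (maxn N1 (Num.truncn (L / r))) => // m; rewrite /= geq_max => /andP[N1m rm].
  rewrite /S/= (_ : V `&` _ = [set z | (`|y - z| < L / m.+1%:R)%R]); first exact: (h1 m).
  apply/seteqP; split => [z []//|z/= hz]; split => //; apply: hr => /=.
  apply: (lt_le_trans hz); rewrite ler_pdivrMr// mulrC -ler_pdivrMr//.
  apply/ltW/(lt_le_trans (truncnS_gt _)).
  by rewrite ler_nat ltnS.
have mUT : measurable (\bigcup_N T N) by exact: bigcupT_measurable.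
apply: (@le_trans _ _ (mu (\bigcup_N T N))); first by rewrite le_measure ?inE.
have ndT : nondecreasing_seq T.
  apply/nondecreasing_seqP => N; apply/subsetPset => y h m /= Nm; apply: h => /=.
  exact: ltnW.
have cT := nondecreasing_cvg_mu (mu := mu) mT mUT ndT.
rewrite -(cvg_lim _ cT)//.
apply: (@le_trans _ _ ((L ^+ n)%:E * nu V)).
  apply: lime_le; first by apply/cvg_ex; eexists; exact: cT.
  apply: nearW => N /=; apply: le_trans (hS N).2.
  rewrite le_measure ?inE//; first exact: (hS N).1.
  by move=> y; apply => /=.
apply: (@le_trans _ _ ((L ^+ n)%:E * (nu D + (e / L ^+ n)%:E))).
  by rewrite lee_pmul2l// lte_fin.
rewrite ge0_muleDr//; last by rewrite lee_fin divr_ge0// ltW.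
have h : (L ^+ n * (e / L ^+ n) = e)%R by rewrite mulrCA divff ?mulr1 ?gt_eqF.
by rewrite -EFinM h.
Qed.

End density.

Section lipschitz_image.
Context {R : realType} (n : nat).
Local Notation U := 'cV[R]_n.
Local Notation mu := (lebesgue_cV n : {measure set U -> \bar R}).
Variables (X : set U) (mX : measurable X) (Xfin : (mu X < +oo)%E).
Variable Phi : U -> U.

(** Lebesgue measure on X pushed forward by [Phi]. The measurability proof is an argument, so that
    the measure structure is recovered from the term itself. *)
Definition image_measure & measurable_fun setT Phi : set U -> \bar R :=
  fun A => mfrestr mX Xfin (Phi @^-1` A).

Hypothesis mPhi : measurable_fun setT Phi.

Let mphi_mixin := isMeasurableFun.Build _ _ _ _ Phi mPhi.
Let mphi_pack : {mfun _ >-> _} := HB.pack Phi mphi_mixin.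

Let image_measure0 : image_measure mPhi set0 = 0%E.
Proof. exact: (measure0 (pushforward (mfrestr mX Xfin) mphi_pack)). Qed.

Let image_measure_ge0 A : (0 <= image_measure mPhi A)%E.
Proof. exact: measure_ge0. Qed.

Let image_measure_additive : semi_sigma_additive (image_measure mPhi).
Proof.
exact: (@measure_semi_sigma_additive _ _ _ (pushforward (mfrestr mX Xfin) mphi_pack)).
Qed.

HB.instance Definition _ := isMeasure.Build _ _ _ (image_measure mPhi)
  image_measure0 image_measure_ge0 image_measure_additive.

Let image_measure_fin : fin_num_fun (image_measure mPhi).
Proof.
move=> A mA; rewrite /image_measure; apply: fin_num_measure.
by rewrite -[X in measurable X]setTI; exact: mPhi.
Qed.

HB.instance Definition _ := Measure_isFinite.Build _ _ _ (image_measure mPhi) image_measure_fin.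

(** If y = Phi x, the ball of radius 1 / (m + 1) about x is mapped into the ball of radius L / (m +
    1) about y, which therefore has image measure at least (2 / (m + 1))^n. This is the density
    required by [density_domination]; openness of X keeps the small balls inside X. *)
Lemma lipschitz_image_le (L : R) (D : set U) : open X -> 0 < L -> measurable D ->
  (forall x y, X x -> X y -> `|Phi x - Phi y| <= L * `|x - y|) ->
  D `<=` Phi @` X ->
  (mu D <= (L ^+ n)%:E * mu (X `&` Phi @^-1` D))%E.
Proof.
move=> opX L0 mD lipPhi DX.
have := @density_domination _ _ [the {finite_measure set U -> \bar R} of image_measure mPhi] D L mD L0.
rewrite /= {2}/image_measure /mfrestr /mrestr setIC; apply.
move=> y /DX[x Xx xy].
have [r r0 hr] := (open_norm_lt X).1 opX x Xx.
near=> m.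
have m0 : (0 : R) < m.+1%:R^-1 by rewrite invr_gt0.
rewrite -(lebesgue_cV_ball x m0).
rewrite /image_measure /mfrestr /mrestr; apply: le_measure; rewrite ?inE.
- exact: measurable_norm_lt.
- apply: measurableI => //; rewrite -[X in measurable X]setTI; apply: mPhi => //.
  exact: measurable_norm_lt.
- move=> z /= hz.
  have Xz : X z.
    apply: hr => /=; apply: (lt_le_trans hz).
    rewrite invf_ple ?posrE//.
    near: m; exists (Num.truncn r^-1) => // m /= hm.
    by apply/ltW/(lt_le_trans (truncnS_gt _)); rewrite ler_nat ltnS.
  split => //; rewrite -xy; apply: (le_lt_trans (lipPhi _ _ Xx Xz)).
  by rewrite ltr_pM2l.
Unshelve. all: by end_near. Qed.

End lipschitz_image.

(** * The matrix exponential *)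

Section expmx_theory.
Context {R : realType} (n : nat).
Implicit Types (P Q : 'M[R]_n).

Lemma cvg_mx_entries m k (u : nat -> 'M[R]_(m, k)) (M : 'M[R]_(m, k)) :
  (forall i j, u x i j @[x --> \oo] --> M i j) -> u x @[x --> \oo] --> M.
Proof.
move=> h; apply/cvgrPdist_lt => e e0.
have : \forall x \near \oo, forall ij : 'I_m * 'I_k, `|M ij.1 ij.2 - u x ij.1 ij.2| < e.
  have h' ij : \forall x \near \oo, `|M ij.1 ij.2 - u x ij.1 ij.2| < e.
    by have /cvgrPdist_lt := h ij.1 ij.2; apply.
  have /choice[N hN] : forall ij : 'I_m * 'I_k, exists N, forall x, (N <= x)%N ->
      `|M ij.1 ij.2 - u x ij.1 ij.2| < e.
    by move=> ij; have [N _ hN] := h' ij; exists N => x /hN.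
  exists (\max_ij N ij)%N => // x /= Nx ij; apply: hN; apply: leq_trans Nx.
  exact: leq_bigmax.
by apply: filterS => x hx; apply/norm_mx_lt => // i j; rewrite !mxE; exact: (hx (i, j)).
Qed.

Let cvg_sum m (f : 'I_m -> nat -> R) (a : 'I_m -> R) :
  (forall k, f k x @[x --> \oo] --> a k) ->
  \sum_(k < m) f k x @[x --> \oo] --> \sum_(k < m) a k.
Proof.
move=> fa; elim: (index_enum _) => [|k r IH].
  by under eq_fun do rewrite big_nil; rewrite big_nil; exact: cvg_cst.
under eq_fun do rewrite big_cons; rewrite big_cons; exact: cvgD.
Qed.

Let mulE (A B : 'M[R]_n) : A * B = A *m B. Proof. by []. Qed.

Lemma norm_mxX P k : `|P ^+ k| <= (n%:R * `|P|) ^+ k.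
Proof.
elim: k => [|k IH].
  rewrite !expr0; apply/norm_mx_le => // i j; rewrite mxE.
  by case: (i == j); rewrite ?normr1 ?normr0.
rewrite !exprS mulE; apply: (le_trans (norm_mulmx _ _)).
by rewrite ler_wpM2l// mulr_ge0.
Qed.

Lemma exprZmx (s : R) P k : (s *: P) ^+ k = s ^+ k *: P ^+ k.
Proof.
elim: k => [|k IH]; first by rewrite !expr0 scale1r.
by rewrite !exprS IH !mulE -scalemxAl -scalemxAr scalerA.
Qed.

(** Coefficients of the scalar power series in s of an entry of Q exp(sP). The factor Q makes the
    family closed under differentiation, which replaces Q by QP. *)
Definition expmx_coef P Q i j (k : nat) : R := k`!%:R^-1 * (Q * P ^+ k) i j.

Lemma pseries_diffs_expmx_coef P Q i j :
  pseries_diffs (expmx_coef P Q i j) = expmx_coef P (Q * P) i j.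
Proof.
apply/funext => k; rewrite /pseries_diffs /expmx_coef exprS mulrA factS natrM invfM.
by rewrite mulrA mulrA divff ?mul1r// pnatr_eq0.
Qed.

(** The dominating exponential series; the factors n appear because the sup norm of matrices is
    submultiplicative only up to n. *)
Let expmx_bound P Q (s : R) := (n%:R * `|Q|) *: exp_coeff (n%:R * `|P| * `|s|).

Let expmx_coef_le P Q i j s k :
  `|expmx_coef P Q i j k * s ^+ k| <= expmx_bound P Q s k.
Proof.
rewrite /expmx_bound /expmx_coef /exp_coeff/= !normrM normfV normr_nat normrX.
rewrite -mulrA mulrC.
apply: (@le_trans _ _ ((n%:R * `|Q| * (n%:R * `|P|) ^+ k) * `|s| ^+ k / k`!%:R)).
  rewrite ler_wpM2r ?invr_ge0// ler_wpM2r ?exprn_ge0//.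
  apply: (le_trans (norm_mx_entry _ _ _)); apply: (le_trans (norm_mulmx _ _)).
  by rewrite ler_wpM2l ?mulr_ge0// norm_mxX.
rewrite -[leRHS]/(n%:R * `|Q| * ((n%:R * `|P| * `|s|) ^+ k / k`!%:R)).
by rewrite [in leRHS]exprMn !mulrA.
Qed.

Let is_cvg_expmx_bound P Q s : cvgn (series (expmx_bound P Q s)).
Proof. by apply: is_cvg_seriesZ; exact: is_cvg_series_exp_coeff. Qed.

Let is_cvg_norm_expmx_coef P Q i j s :
  cvgn [normed series (fun k => expmx_coef P Q i j k * s ^+ k)].
Proof.
apply: (@series_le_cvg _ _ (expmx_bound P Q s)).
- by move=> k /=.
- by move=> k; apply: le_trans (expmx_coef_le P Q i j s k).
- by move=> k; exact: expmx_coef_le.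
- exact: is_cvg_expmx_bound.
Qed.

Lemma is_cvg_expmx_coef P Q i j s : cvgn (pseries (expmx_coef P Q i j) s).
Proof. exact/normed_cvg/is_cvg_norm_expmx_coef. Qed.

Lemma expmx_entry P (s : R) i j :
  expmx (s *: P) i j = limn (pseries (expmx_coef P 1 i j) s).
Proof.
pose M : 'M[R]_n := \matrix_(i, j) limn (pseries (expmx_coef P 1 i j) s).
suff h : series (fun k => k`!%:R^-1 *: (s *: P) ^+ k) x @[x --> \oo] --> M.
  by rewrite /expmx (cvg_lim _ h)// mxE.
apply: cvg_mx_entries => a b; rewrite mxE.
rewrite (_ : (fun _ => _) = pseries (expmx_coef P 1 a b) s); first exact: is_cvg_expmx_coef.
apply/funext => x; rewrite /pseries /series/= summxE; apply: eq_bigr => k _.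
by rewrite exprZmx !mxE /expmx_coef mul1r mulrAC mulrA.
Qed.

Lemma mul_expmx_entry P Q (s : R) i j :
  limn (pseries (expmx_coef P Q i j) s) = (Q *m expmx (s *: P)) i j.
Proof.
apply/cvg_lim => //; rewrite mxE.
rewrite (_ : pseries _ _ =
   fun x => \sum_(k < n) Q i k * pseries (expmx_coef P 1 k j) s x); last first.
  apply/funext => x; rewrite /pseries /series/=.
  under [RHS]eq_bigr do rewrite big_distrr/=.
  rewrite exchange_big/=; apply: eq_bigr => l _.
  rewrite /expmx_coef mulE mxE mulrAC big_distrr/=.
  by apply: eq_bigr => k _; rewrite mul1r; ring.
apply: cvg_sum => k; apply: cvgMl_tmp; rewrite expmx_entry; exact: is_cvg_expmx_coef.
Qed.

Lemma expmx0 : expmx (0 : 'M[R]_n) = 1%:M.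
Proof.
suff h : series (fun k => k`!%:R^-1 *: (0 : 'M[R]_n) ^+ k) x @[x --> \oo] --> (1%:M : 'M[R]_n).
  by rewrite /expmx (cvg_lim _ h).
apply: cvg_near_cst; exists 1%N => // k.
case: k => // k _.
rewrite /series/= big_mkord big_ord_recl/= fact0 invr1 scale1r expr0 big1 ?addr0// => i _.
by rewrite exprS mul0r scaler0.
Qed.

Lemma is_derive_expmx P (s : R) i j :
  is_derive s (1 : R) (fun s : R => expmx (s *: P) i j) ((P *m expmx (s *: P)) i j).
Proof.
rewrite (_ : (fun _ => _) = fun s => limn (pseries (expmx_coef P 1 i j) s)); last first.
  by apply/funext => x; exact: expmx_entry.
rewrite -mul_expmx_entry.
have -> : expmx_coef P P i j = pseries_diffs (expmx_coef P 1 i j).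
  by rewrite pseries_diffs_expmx_coef mul1r.
(* The series and its derived series converge everywhere, so any point of modulus larger than that
   of s serves as radius. *)
apply: (@pseries_snd_diffs _ _ (`|s| + 1)).
- exact: is_cvg_expmx_coef.
- rewrite pseries_diffs_expmx_coef; exact: is_cvg_expmx_coef.
- rewrite !pseries_diffs_expmx_coef; exact: is_cvg_expmx_coef.
- by rewrite ltr_normr ltrDl ltr01.
Qed.

Lemma expmx_comm P (s : R) : P *m expmx (s *: P) = expmx (s *: P) *m P.
Proof.
apply/matrixP => i j; rewrite -mul_expmx_entry mxE; apply/cvg_lim => //.
rewrite (_ : pseries _ _ =
   fun x => \sum_(k < n) pseries (expmx_coef P 1 i k) s x * P k j); last first.
  apply/funext => x; rewrite /pseries /series/=.
  under [RHS]eq_bigr do rewrite big_distrl/=.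
  rewrite exchange_big/=; apply: eq_bigr => l _.
  rewrite /expmx_coef -exprS exprSr mulE mxE mulrAC big_distrr/=.
  by apply: eq_bigr => k _; rewrite mul1r; ring.
apply: cvg_sum => k; apply: cvgMr_tmp; rewrite expmx_entry; exact: is_cvg_expmx_coef.
Qed.

(** Each entry of exp(-tP) exp(tP) has derivative zero, because P commutes with its exponential; its
    value is thus the one at t = 0. *)
Lemma expmxN_mul P (s : R) : expmx ((- s) *: P) *m expmx (s *: P) = 1%:M.
Proof.
pose E (t : R) := expmx (t *: P).
have dN t i j : is_derive t (1 : R) (fun t => E (- t) i j) (- (P *m E (- t)) i j).
  have dn : is_derive t (1 : R) (-%R : R -> R) (- 1 : R) by exact: is_deriveN.
  have := @is_derive1_comp _ (fun t => E t i j) -%R t _ _ (is_derive_expmx P (- t) i j) dn.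
  by rewrite ?mulrN1 ?mulN1r.
apply/matrixP => i j.
pose g (t : R) := \sum_(k < n) (E (- t) i k * E t k j).
have -> : (E (- s) *m E s) i j = g s by rewrite mxE.
suff dg t : is_derive t (1 : R) g 0.
  have -> : g s = g 0 by apply: is_derive_0_is_cst.
  transitivity ((1%:M *m 1%:M : 'M[R]_n) i j); last by rewrite mul1mx.
  by rewrite mxE /g oppr0 /E scale0r expmx0.
suff <- : \sum_(k < n) (E (- t) i k *: (P *m E t) k j + E t k j *: - (P *m E (- t)) i k) = 0.
  rewrite (_ : g = \sum_(k < n) (fun t => E (- t) i k * E t k j)); last first.
    by apply/funext => x; rewrite fct_sumE.
  apply: is_derive_sum => k; apply: is_deriveM; exact: is_derive_expmx.
rewrite big_split/=.
have -> : \sum_(k < n) E t k j *: - (P *m E (- t)) i k = - ((E (- t) *m P) *m E t) i j.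
  rewrite -expmx_comm mxE -sumrN; apply: eq_bigr => k _.
  by rewrite scalerN [_ *: _]mulrC.
by rewrite -mulmxA [X in _ - X]mxE subrr.
Qed.

Lemma mul_expmx_le P Q (s : R) i j :
  `|(Q *m expmx (s *: P)) i j| <= n%:R * `|Q| * expR (n%:R * `|P| * `|s|).
Proof.
have -> : n%:R * `|Q| * expR (n%:R * `|P| * `|s|) = limn (series (expmx_bound P Q s)).
  by rewrite /expmx_bound lim_seriesZ//; exact: is_cvg_series_exp_coeff.
rewrite -mul_expmx_entry; apply: le_trans (lim_series_norm _) _; first exact: is_cvg_norm_expmx_coef.
apply: lim_series_le; [exact: is_cvg_norm_expmx_coef|exact: is_cvg_expmx_bound|].
by move=> k; exact: expmx_coef_le.
Qed.

Lemma expmx_lipschitz P (T : R) : 0 < T ->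
  exists2 L : R, 0 < L & forall s t, `|s| <= T -> `|t| <= T ->
    `|expmx (s *: P) - expmx (t *: P)| <= L * `|s - t|.
Proof.
(* The bound of [mul_expmx_le] on the derivative, uniform over times up to T; adding 1 makes L
   positive. *)
move=> T0; pose L := n%:R * `|P| * expR (n%:R * `|P| * T) + 1.
have L0 : 0 < L by rewrite ltr_wpDl// !mulr_ge0// expR_ge0.
exists L => // s t; wlog st : s t / s <= t => [h sT tT|sT tT].
  have /orP[|] := le_total s t => h'; first exact: h.
  by rewrite distrC [X in _ * X]distrC; exact: h.
apply/norm_mx_le; first by rewrite mulr_ge0// ltW.
move=> i j; rewrite !mxE distrC [X in _ * X]distrC.
have [|c cst ->] := @MVT_segment R (fun s => expmx (s *: P) i j)
   (fun s => (P *m expmx (s *: P)) i j) s t st (fun x _ => is_derive_expmx P x i j).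
  apply: continuous_subspaceT => x; apply/differentiable_continuous/derivable1_diffP.
  by apply: ex_derive; exact: is_derive_expmx.
rewrite normrM ler_wpM2r//; apply: (le_trans (mul_expmx_le _ _ _ _ _)).
rewrite /L ler_wpDr// ler_wpM2l ?mulr_ge0// ler_expR ler_wpM2l ?mulr_ge0//.
move: cst sT tT; rewrite in_itv/= !ler_norml => /andP[? ?] /andP[? ?] /andP[? ?].
by apply/andP; lra.
Qed.

End expmx_theory.

(** * Geometry of the quasi-distance *)

Lemma bernoulli_ge {R : realType} (x : R) (n : nat) : 0 <= x <= 1 -> 1 - n%:R * x <= (1 - x) ^+ n.
Proof.
move=> /andP[x0 x1]; elim: n => [|n IH]; first by rewrite mul0r subr0 expr0.
rewrite exprS; apply: (@le_trans _ _ ((1 - x) * (1 - n%:R * x))); last first.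
  by rewrite ler_wpM2l// subr_ge0.
rewrite -natr1; have : 0 <= n%:R * x ^+ 2 by rewrite mulr_ge0// sqr_ge0.
by rewrite expr2; lra.
Qed.

Section euclidean_norm.
Context {R : realType} (n : nat).
Implicit Types x y : 'cV[R]_n.

Lemma sqr_enorm x : enorm x ^+ 2 = \sum_(i < n) x i ord0 ^+ 2.
Proof. by rewrite sqr_sqrtr// sumr_ge0// => i _; exact: sqr_ge0. Qed.

Lemma enorm_entry x i : `|x i ord0| <= enorm x.
Proof.
rewrite -(@ler_pXn2r _ 2)// ?nnegrE ?enorm_ge0//.
rewrite sqr_enorm real_normK ?num_real// (bigD1 i)//= lerDl.
by rewrite sumr_ge0// => j _; exact: sqr_ge0.
Qed.

Lemma norm_le_enorm x : `|x| <= enorm x.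
Proof. by apply/norm_mx_le; rewrite ?enorm_ge0// => i j; rewrite ord1 enorm_entry. Qed.

(** The difference of squares is a sum of products (x_i - y_i)(x_i + y_i); dividing by
    [enorm x + enorm y] leaves the constant n, which is not sharp but comes without
    Cauchy-Schwarz. *)
Lemma enorm_lipschitz x y : `|enorm x - enorm y| <= n%:R * `|x - y|.
Proof.
have [h|h] := eqVneq (enorm x + enorm y) 0.
  have := enorm_ge0 x; have := enorm_ge0 y => hx hy.
  have -> : enorm x = 0 by lra.
  have -> : enorm y = 0 by lra.
  by rewrite subrr normr0 mulr_ge0.
have h0 : 0 < enorm x + enorm y by rewrite lt_neqAle eq_sym h addr_ge0// enorm_ge0.
rewrite -(ler_pM2r h0) -{1}(gtr0_norm h0) -normrM -subr_sqr !sqr_enorm -sumrB.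
apply: (le_trans (ler_norm_sum _ _ _)).
apply: (@le_trans _ _ (\sum_(i < n) `|x - y| * (enorm x + enorm y))); last first.
  by rewrite sumr_const card_ord -[leLHS]mulr_natl mulrA.
apply: ler_sum => i _; rewrite subr_sqr normrM ler_pM//.
  by have := norm_mx_entry (x - y) i ord0; rewrite !mxE.
by rewrite (le_trans (ler_normD _ _))// lerD// enorm_entry.
Qed.

Lemma enorm0 : enorm (0 : 'cV[R]_n) = 0.
Proof. by rewrite /enorm big1 ?sqrtr0// => i _; rewrite mxE expr0n. Qed.

Lemma enorm_le_norm x : enorm x <= n%:R * `|x|.
Proof.
have := enorm_lipschitz x 0; rewrite enorm0 !subr0 ger0_norm//; exact: enorm_ge0.
Qed.

Lemma enormZ (t : R) x : 0 <= t -> enorm (t *: x) = t * enorm x.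
Proof.
move=> t0; apply/eqP; rewrite -(@eqrXn2 _ 2)// ?mulr_ge0 ?enorm_ge0//.
rewrite exprMn !sqr_enorm mulr_sumr; apply/eqP/eq_bigr => i _.
by rewrite mxE exprMn.
Qed.

Lemma expmx_mul_continuous (P : 'M[R]_n) x : continuous (fun s : R => expmx (s *: P) *m x).
Proof.
move=> s; apply/cvgrPdist_lt => e e0.
have T0 : 0 < `|s| + 1 by rewrite ltr_wpDl.
have [L L0 hL] := expmx_lipschitz P T0.
have C0 : 0 < n%:R * L * `|x| + 1 by rewrite ltr_wpDl// !mulr_ge0// ltW.
near=> t; rewrite -mulmxBl; apply: (le_lt_trans (norm_mulmx _ _)).
have st1 : `|s - t| < 1.
  by near: t; apply/(nbhs_normP (s : R)); exists 1 => //=.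
have ste : `|s - t| < e / (n%:R * L * `|x| + 1).
  by near: t; apply/(nbhs_normP (s : R)); exists (e / (n%:R * L * `|x| + 1)) => //=; rewrite divr_gt0.
have sT : `|s| <= `|s| + 1 by rewrite lerDl.
have tT : `|t| <= `|s| + 1.
  rewrite -[t](subrK s) addrC (le_trans (ler_normD _ _))// lerD2l distrC ltW//.
rewrite ltr_pdivlMr// in ste; apply: le_lt_trans ste.
apply: (@le_trans _ _ (n%:R * (L * `|s - t|) * `|x|)).
  by rewrite ler_wpM2r// ler_wpM2l// hL.
rewrite -[n%:R * (L * `|s - t|) * `|x|]/(n%:R * (L * `|s - t|) * `|x|).
have -> : n%:R * (L * `|s - t|) * `|x| = `|s - t| * (n%:R * L * `|x|) by ring.
by rewrite ler_wpM2l// lerDl.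
Unshelve. all: by end_near. Qed.

Lemma enorm_expmx_continuous (P : 'M[R]_n) x :
  continuous (fun s : R => enorm (expmx (s *: P) *m x)).
Proof.
move=> s; apply/cvgrPdist_lt => e e0.
have d0 : 0 < e / (n%:R + 1) by rewrite divr_gt0// ltr_wpDl.
have /cvgrPdist_lt/(_ _ d0) := @expmx_mul_continuous P x s.
apply: filterS => t; rewrite ltr_pdivlMr ?ltr_wpDl// => h.
apply: (le_lt_trans (enorm_lipschitz _ _)); apply: le_lt_trans h.
by rewrite mulrC ler_wpM2l// lerDl.
Qed.

End euclidean_norm.

Section quasi_distance_geometry.
Context {R : realType} (n : nat) (P : 'M[R]_n) (rho : 'cV[R]_n -> R).
Hypothesis hrho : quasi_distance P rho.
Local Notation U := 'cV[R]_n.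
Local Notation mu := (lebesgue_cV n : {measure set U -> \bar R}).

Lemma qdistN x : rho (- x) = rho x.
Proof. by rewrite -[LHS](congr1 rho (sub0r x)) (qdist_sym hrho) subr0. Qed.

Lemma qdist_quasi_add : exists2 K : R, 1 <= K &
  forall x y, rho (x + y) <= K * (rho x + rho y).
Proof.
have [k hk] := qdist_triangle hrho.
exists (Num.max k 1); first by rewrite le_max lexx orbT.
move=> x y; have := hk x (- y) 0; rewrite opprK !subr0 qdistN => /le_trans; apply.
by rewrite ler_wpM2r ?addr_ge0 ?(qdist_ge0 hrho)// le_max lexx.
Qed.

Let level (L : R) (N : nat) : set U :=
  [set y | rho y <= N%:R] `&` [set y | `|0 - y| < L].

Let measurable_level L N : measurable (level L N).
Proof.
apply: measurableI; last exact: measurable_norm_lt.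
rewrite (_ : mkset _ = setT `&` rho @^-1` `]-oo, N%:R]).
  exact: (qdist_measurable hrho).
by rewrite setTI; apply/seteqP; split => y; rewrite /= in_itv.
Qed.

(** A Steinhaus argument. For N large, [level L N] has more than half the volume of the cube of
    radius T. That cube contains both the level set and its reflection y |-> z - y, so the two meet,
    and z = (z - y) + y is a sum of two vectors with [rho] at most N. *)
Lemma qdist_locally_bounded (M : R) : exists B : R, forall x, `|x| <= M -> rho x <= B.
Proof.
wlog M0 : M / 0 < M => [h|].
  have [|B hB] := h (Num.max M 1); first by rewrite lt_max ltr01 orbT.
  by exists B => x xM; apply: hB; rewrite le_max xM.
(* T exceeds 2nM, so by Bernoulli (1 - M/T)^n > 1/2: shrinking the cube from radius T to L = T - M
   keeps more than half of its volume. *)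
have [K K1 hK] := qdist_quasi_add.
pose T := 2 * n%:R * M + 1 + M.
have n0 : 0 <= n%:R * M by rewrite mulr_ge0// ltW.
pose L := T - M.
have L0 : 0 < L by rewrite /L /T; lra.
have T0 : 0 < T by rewrite /T; lra.
have cube : (2 * T) ^+ n < 2 * (2 * L) ^+ n.
  have -> : 2 * L = (1 - M / T) * (2 * T) by rewrite /L mulrBl mul1r; field; rewrite gt_eqF.
  rewrite [in ltRHS]exprMn mulrA ltr_pMl ?exprn_gt0 ?mulr_gt0//.
  have MT : M / T <= 1 by rewrite ler_pdivrMr// mul1r /T; lra.
  have MT0 : 0 <= M / T by apply: divr_ge0; exact: ltW.
  have h := @bernoulli_ge R (M / T) n (introT andP (conj MT0 MT)).
  suff : n%:R * (M / T) < 2^-1 by lra.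
  by rewrite mulrA ltr_pdivrMr// /T; lra.
have [N hN] : exists N, (((2 * T) ^+ n)%:E < 2%:E * mu (level L N))%E.
  have ndl : nondecreasing_seq (level L).
    apply/nondecreasing_seqP => k; apply/subsetPset => y [/= h1 h2]; split => //=.
    by apply: (le_trans h1); rewrite ler_nat.
  have Ul : \bigcup_k level L k = [set y | `|0 - y| < L].
    apply/seteqP; split => [y [k _ []]//|y yL].
    exists (Num.truncn (rho y)).+1 => //; split => //=; exact/ltW/truncnS_gt.
  have cl : (mu \o level L) x @[x --> \oo] --> mu [set y | `|0 - y| < L].
    rewrite -Ul; apply: nondecreasing_cvg_mu => //; rewrite Ul; exact: measurable_norm_lt.
  rewrite lebesgue_cV_ball0// in cl.
  have /fine_cvgP[fl] := cl.
  have d0 : 0 < (2 * L) ^+ n - (2 * T) ^+ n / 2 by lra.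
  move=> /cvgrPdist_lt/(_ _ d0)[N1 _ h1].
  case: fl => N2 _ h2; exists (maxn N1 N2).
  have := h1 (maxn N1 N2) (leq_maxl _ _); have := h2 (maxn N1 N2) (leq_maxr _ _).
  move=> /= /fineK <-; rewrite -EFinM lte_fin ltr_distlC => /andP[]; lra.
exists (K * (N%:R + N%:R)) => z zM.
have [[y [[/= ly1 _] [/= ly2 _]]]|disj] := pselect ((level L N `&` (reflect_cV z @^-1` level L N)) !=set0).
  rewrite -[z](subrK y); apply: (le_trans (hK _ _)).
  by rewrite ler_wpM2l ?lerD// (le_trans ler01).
have mr : measurable (reflect_cV z @^-1` level L N).
  by rewrite -[X in measurable X]setTI; apply: measurable_subcV.
exfalso; move: hN; apply/negP; rewrite -leNgt.
rewrite (_ : 2%:E * _ = mu (level L N) + mu (level L N))%E; last by rewrite -[2]/(1 + 1)%R EFinD ge0_muleDl ?mul1e.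
rewrite -{2}(lebesgue_cV_reflect z)// -measureU//; last first.
  by apply/seteqP; split => // y hy; apply: disj; exists y.
rewrite -(lebesgue_cV_ball0 n T0); apply: le_measure; rewrite ?inE.
- exact: measurableU.
- exact: measurable_norm_lt.
- move=> y [[/= _]|[/= _]]; rewrite /reflect_cV !sub0r !normrN => h.
    by apply: (lt_trans h); rewrite /L; lra.
  rewrite -(subrK z y) (le_lt_trans (ler_normD _ _))// distrC.
  by rewrite /L in h; lra.
Qed.

Lemma qdist_expmx s x : rho (expmx (s *: P) *m x) = expR s * rho x.
Proof. by rewrite -{1}[s](expRK s) -/(dilation P (expR s)) (qdist_homogeneous hrho)// expR_gt0. Qed.

(** Continuity at 0. If x is small enough, its image under the inverse dilation lies in the unit
    ball, where [rho] is at most B; the dilation then multiplies [rho] by expR s = e / (2 (B +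
    1)). *)
Lemma qdist_small (e : R) : 0 < e -> exists2 d, 0 < d & forall x, `|x| < d -> rho x < e.
Proof.
move=> e0; have [B hB] := qdist_locally_bounded 1.
have B0 : 0 <= B by apply: le_trans (hB 0 _); rewrite ?(qdist_ge0 hrho)// normr0.
pose s := ln (e / (B + 1) / 2).
have h0 : 0 < e / (B + 1) / 2 by rewrite !divr_gt0//; lra.
pose d := (n%:R * `|expmx (- s *: P)| + 1)^-1.
have d0 : 0 < n%:R * `|expmx (- s *: P)| + 1 by rewrite ltr_wpDl// mulr_ge0.
exists d; first by rewrite invr_gt0.
move=> x xd.
have -> : x = expmx (s *: P) *m (expmx (- s *: P) *m x).
  by rewrite mulmxA -{1}[s]opprK expmxN_mul mul1mx.
rewrite qdist_expmx lnK// -mulrA -mulrA gtr_pMr//.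
set y := (X in rho X).
have yB : rho y <= B.
  apply: hB; apply: (le_trans (norm_mulmx _ _)).
  apply: (@le_trans _ _ ((n%:R * `|expmx (- s *: P)| + 1) * d)); last first.
    by rewrite /d divff// gt_eqF.
  by apply: ler_pM; rewrite ?mulr_ge0// ?lerDl//; exact: ltW.
rewrite mulrA -invfM ltr_pdivrMl; lra.
Qed.

(** The quasi-triangle inequality and [qdist_small] replace lower semicontinuity: every w close to v
    has rho w >= rho v / (2K). Compactness of the annulus makes the bound uniform. Row vectors are
    used because [bounded_closed_compact] is about these. *)
Lemma qdist_annulus (d M : R) : 0 < d ->
  exists2 c, 0 < c & forall x, d <= `|x| -> `|x| <= M -> c <= rho x.
Proof.
move=> d0; have [K K1 hK] := qdist_quasi_add.
pose A := [set v : 'rV[R]_n | d <= `|v| /\ `|v| <= M].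
have cA : compact A.
  apply: bounded_closed_compact.
    by exists M; split => [|M' MM' v [_ vM]]; [exact: num_real|exact/ltW/(le_lt_trans vM)].
  apply: closedI.
    apply: (@closed_comp _ _ (fun v : 'rV[R]_n => `|v|) [set t | d <= t]) => [v _|].
      exact: norm_continuous.
    exact: closed_ge.
  apply: (@closed_comp _ _ (fun v : 'rV[R]_n => `|v|) [set t | t <= M]) => [v _|].
    exact: norm_continuous.
  exact: closed_le.
have norm_tr m k (x : 'M[R]_(m, k)) : `|x^T| = `|x|.
  apply/eqP; rewrite eq_le; apply/andP; split; apply/norm_mx_le => // i j.
    by rewrite mxE norm_mx_entry.
  by have := norm_mx_entry x^T j i; rewrite mxE.
have : \forall c \near (0 : R)^'+, A `<=` (fun v => c <= rho v^T).
  have /compact_near_coveringP ncA := cA; apply: ncA => v [dv _].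
  have rv : 0 < rho v^T.
    by apply: (qdist_gt0 hrho); rewrite -normr_gt0 norm_tr (lt_le_trans d0).
  have e0 : 0 < rho v^T / (2 * K) by rewrite divr_gt0// mulr_gt0//; lra.
  have [r r0 hr] := qdist_small e0.
  exists ([set w | `|v - w| < r], [set c : R | c < rho v^T / (2 * K)]).
    split => /=; first by apply/(nbhs_normP (v : 'rV[R]_n)); exists r.
    exact: nbhs_right_lt.
  move=> [w c] [/= vw ce]; apply/ltW/(lt_le_trans ce).
  have := hK (v^T - w^T) w^T; rewrite subrK.
  have := hr (v^T - w^T); rewrite -raddfB norm_tr => /(_ vw) h h'.
  rewrite ler_pdivrMr; last by lra.
  have : K * rho (v - w)^T <= rho v^T / 2.
    have := ltW h; rewrite ler_pdivlMr; last lra.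
    by lra.
  lra.
move=> [e/= e0 he]; exists (e / 2); first by rewrite divr_gt0.
move=> x dx xM.
have := he (e / 2); rewrite /ball_/= sub0r normrN gtr0_norm ?divr_gt0//.
move=> /(_ _ _ x^T); rewrite trmxK; apply; [lra|lra|by rewrite /A/= norm_tr].
Qed.

(** [qdist_annulus] controls bounded regions only, so points far away with small [rho] must be
    excluded separately. This is done by following the orbit of y backwards in time, along which
    [rho] tends to 0. *)
Lemma qdist_small_norm (d : R) : 0 < d ->
  exists2 e, 0 < e & forall y, rho y < e -> `|y| < d.
Proof.
move=> d0; have [K K1 hK] := qdist_quasi_add.
wlog d1 : d d0 / d <= 1 => [h|].
  have [|//|e e0 he] := h (Num.min d 1); first by rewrite lt_min d0 ltr01.
    by rewrite ge_min lexx orbT.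
  by exists e => // y /he; rewrite lt_min => /andP[].
have [c c0 hc] := qdist_annulus 1 ltr01.
have [c2 c20 hc2] := qdist_annulus 2 d0.
have K0 : 0 < 2 * K by lra.
exists (Num.min (c / (2 * K)) c2); first by rewrite lt_min c20 andbT divr_gt0.
move=> y; rewrite lt_min => /andP[yc yc2].
pose p (s : R) := expmx (s *: P) *m y.
have p0 : p 0 = y by rewrite /p scale0r expmx0 mul1mx.
(* Otherwise the distance from y would equal 1 at some time t <= 0. There the annulus bound gives
   rho (p t - y) >= c, while rho (p t) <= rho y gives rho (p t - y) <= 2K rho y < c. *)
have stay s : s <= 0 -> `|p s - y| < 1.
  move=> s0; rewrite ltNge; apply/negP => h1.
  have [||t] := @IVT R (fun s => `|p s - y|) s 0 1 s0.
  - apply: continuous_subspaceT => t.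
    apply: (@continuous_comp _ _ _ (fun s => p s - y) (Num.norm)); last exact: norm_continuous.
    by apply: cvgB; [exact: expmx_mul_continuous|exact: cvg_cst].
  - by rewrite p0 subrr normr0 ge_min le_max h1 ler01 orbT.
  rewrite in_itv/= => /andP[_ t0] pt.
  have : c <= rho (p t - y) by apply: hc; rewrite pt.
  apply/negP; rewrite -ltNge; apply: (le_lt_trans (hK _ _)).
  rewrite qdistN qdist_expmx.
  have : expR t * rho y <= rho y.
    by rewrite ler_piMl ?(qdist_ge0 hrho)// -expR0 ler_expR.
  move: yc; rewrite ltr_pdivlMr// => yc h.
  apply: le_lt_trans yc; rewrite mulrA [leRHS]mulrC ler_wpM2l//.
    exact: le_trans ler01 K1.
  by rewrite mulr_natr mulr2n lerD2r.
(* If the norm of y were at least 2, the backward orbit would stay at norm between 1 and that of y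
   plus 1, where [rho] is at least c3 > 0, although rho (p s) = expR s * rho y becomes arbitrarily
   small. *)
have y2 : `|y| < 2.
  rewrite ltNge; apply/negP => y2.
  have [c3 c30 hc3] := qdist_annulus (`|y| + 1) ltr01.
  have ry : 0 < rho y + 1 by rewrite ltr_wpDl// (qdist_ge0 hrho).
  pose s := Num.min 0 (ln (c3 / (rho y + 1) / 2)).
  have h0 : 0 < c3 / (rho y + 1) / 2 by rewrite !divr_gt0.
  have s0 : s <= 0 by rewrite /s ge_min lexx.
  have := stay s s0 => ps.
  have : c3 <= rho (p s).
    apply: hc3.
      have := ler_normB (p s - y) (p s); rewrite addrAC subrr sub0r normrN; lra.
    by rewrite -[p s](subrK y) addrC (le_trans (ler_normD _ _))// lerD2l ltW.
  apply/negP; rewrite -ltNge qdist_expmx.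
  apply: (@le_lt_trans _ _ (c3 / (rho y + 1) / 2 * rho y)).
    rewrite ler_wpM2r ?(qdist_ge0 hrho)// -[leRHS]lnK// ler_expR.
    by rewrite /s ge_min lexx orbT.
  have -> : c3 / (rho y + 1) / 2 * rho y = c3 * (rho y / (rho y + 1) / 2) by field; rewrite gt_eqF.
  rewrite gtr_pMr// ltr_pdivrMr// ltr_pdivrMr//.
  have := qdist_ge0 hrho y; lra.
rewrite ltNge; apply/negP => yd.
by have := hc2 y yd (ltW y2); rewrite leNgt yc2.
Qed.

(** At time T every such orbit is outside the open Euclidean ball, since [rho] there exceeds its
    bound on the unit ball; at time -T it is inside, by [qdist_small_norm]. A crossing exists by the
    intermediate value theorem, and T depends only on the bounds 1 and 2 of the shell. *)
Lemma qdist_orbit_sphere : exists2 T : R, 0 < T & forall x, 1 <= rho x < 2 ->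
  exists2 s, `|s| < T & enorm (expmx (s *: P) *m x) = 1.
Proof.
have [B hB] := qdist_locally_bounded 1.
have d0 : 0 < (n%:R + 1)^-1 :> R by rewrite invr_gt0 ltr_wpDl.
have [e e0 he] := qdist_small_norm d0.
(* The first term forces expR T > B, the second makes expR (- T) at most e / 4, so that rho < 2
   becomes rho < e. *)
pose T1 := Num.max (ln (`|B| + 1)) (- ln (e / 4)).
pose T := Num.max T1 1.
have T0 : 0 < T by rewrite /T lt_max ltr01 orbT.
exists (T + 1) => [|x /andP[x1 x2]]; first by rewrite ltr_wpDl// ltW.
pose g (s : R) := enorm (expmx (s *: P) *m x).
have gT : 1 <= g T.
  rewrite leNgt; apply/negP => gT.
  have := hB _ (le_trans (norm_le_enorm _) (ltW gT)).
  apply/negP; rewrite -ltNge qdist_expmx.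
  apply: (@lt_le_trans _ _ (expR T)); last by rewrite ler_peMr// expR_ge0.
  apply: (@lt_le_trans _ _ (expR (ln (`|B| + 1)))).
    rewrite lnK; last by rewrite posrE ltr_wpDl.
    by rewrite (le_lt_trans (ler_norm B))// ltrDl.
  by rewrite ler_expR /T /T1 !le_max lexx.
have gNT : g (- T) <= 1.
  apply: (le_trans (enorm_le_norm _)).
  suff : `|expmx (- T *: P) *m x| < (n%:R + 1)^-1.
    rewrite -[(_)^-1]mul1r ltr_pdivlMr ?ltr_wpDl// => h.
    apply: le_trans (ltW h); rewrite mulrC ler_wpM2l// lerDl//.
  apply: he; rewrite qdist_expmx.
  apply: (@le_lt_trans _ _ (e / 4 * rho x)); last by rewrite mulrAC ltr_pdivrMr// ltr_pM2l// (lt_trans x2)// ltr_nat.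
  rewrite ler_wpM2r ?(qdist_ge0 hrho)// -[leRHS]lnK ?posrE ?divr_gt0// ler_expR.
  by rewrite lerNl /T /T1 !le_max lexx orbT.
have [|||s] := @IVT R g (- T) T 1.
- by rewrite (@le_trans _ _ 0)// ?oppr_le0 ltW.
- apply: continuous_subspaceT => t.
  exact: enorm_expmx_continuous.
- by apply/andP; split; [rewrite ge_min; apply/orP; left|rewrite le_max; apply/orP; right].
rewrite in_itv/= => /andP[sT1 sT2] gs; exists s => //.
by rewrite (@le_lt_trans _ _ T) ?ltrDl// ler_norml sT1.
Qed.

End quasi_distance_geometry.

(** * Comparison of integrals of nonnegative functions *)

Section nonneg_integral.
Local Open Scope ereal_scope.
Context d (T : measurableType d) (R : realType).
Import HBNNSimple.

(* Unlike the library's [ge0_le_integral], no measurability is required: the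
   integral of a nonnegative function is a supremum over simple minorants. *)
Lemma ge0_subset_le_integral (mu : {measure set T -> \bar R}) (D1 D2 : set T)
    (f g : T -> \bar R) :
  D1 `<=` D2 -> (forall x, D1 x -> 0 <= f x) -> (forall x, D2 x -> 0 <= g x) ->
  (forall x, D1 x -> f x <= g x) ->
  \int[mu]_(x in D1) f x <= \int[mu]_(x in D2) g x.
Proof.
move=> D12 f0 g0 fg; rewrite !ge0_integralE//.
apply: le_ereal_sup => _ [h /= hf <-]; exists h => // x /=.
apply: (le_trans (hf x)); rewrite !patchE; case: ifPn => [xD1|_].
  by rewrite ifT ?fg//; [rewrite inE in xD1|rewrite inE in xD1; rewrite inE; exact: D12].
by case: ifPn => // xD2; rewrite g0//; rewrite inE in xD2.
Qed.

(** The integral is a supremum over simple functions below f on S and below 0 elsewhere. Their level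
    sets at nonzero values are measurable subsets of S, which is where the measures are compared. *)
Lemma ge0_measure_le_integral (mu nu : {measure set T -> \bar R}) (c : R)
    (S : set T) (f : T -> \bar R) : (0 <= c)%R ->
  (forall A, measurable A -> A `<=` S -> mu A <= c%:E * nu A) ->
  (forall x, 0 <= f x) ->
  \int[mu]_(x in S) f x <= c%:E * \int[nu]_x f x.
Proof.
move=> c0 munu f0.
rewrite ge0_integralE//; apply: ge_ereal_sup => _ [h /= hf <-].
apply: (@le_trans _ _ (c%:E * sintegral nu h)); last first.
  rewrite lee_wpmul2l ?lee_fin// -integralT_nnsfun.
  apply: ge0_subset_le_integral => // [x _|x _]; first by rewrite lee_fin.
  by apply: (le_trans (hf x)); rewrite patchE; case: ifPn.
rewrite !sintegralE ge0_mule_fsumr; last by move=> r; exact: nnsfun_mulemu_ge0.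
apply: lee_fsum => // _ [x _ <-].
rewrite muleCA; have [->|hx] := eqVneq (h x) 0%R; first by rewrite !mul0e.
rewrite lee_wpmul2l ?lee_fin//; apply: munu => // y /= hy.
have := hf y; rewrite patchE; case: ifPn => [|_]; first by rewrite inE.
by rewrite hy lee_fin => h0; have := @fun_ge0 _ _ h x; move: hx; rewrite eq_le h0 => /= /negbTE ->.
Qed.

End nonneg_integral.

(** * Integrals of powers *)

Section power_integral.
Context {R : realType}.
Local Open Scope ereal_scope.

Lemma integral_powR_itv (g a b : R) : g != 0%R -> (0 < a < b)%R ->
  \int[lebesgue_measure]_(t in `[a, b]) (t `^ (g - 1))%:E = ((b `^ g - a `^ g) / g)%:E.
Proof.
move=> g0 /andP[a0 ab].
have pos t : (t \in `[a, b] -> 0 < t)%R.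
  by rewrite in_itv/= => /andP[+ _]; exact: lt_le_trans.
rewrite (@continuous_FTC2 _ _ (fun t => t `^ g / g)%R)//.
- by rewrite -EFinD mulrBl.
- apply: derivable_within_continuous => t /pos t0.
  by apply: derivable_powR; rewrite in_itv/= t0.
- have d t : (0 < t)%R -> derivable (fun t => t `^ g / g)%R t 1.
    by move=> t0; apply: derivableM => //; apply: derivable_powR; rewrite in_itv/= t0.
  have c t : (0 < t)%R -> {for t, continuous (fun t => t `^ g / g)%R}.
    by move=> t0; apply/differentiable_continuous/derivable1_diffP/d.
  split.
  + by move=> t; rewrite in_itv/= => /andP[at0 _]; apply: d; exact: lt_trans at0.
  + by apply: cvg_at_right_filter; exact: c.
  + by apply: cvg_at_left_filter; apply: c; exact: lt_trans ab.
- move=> t tab; have t0 : (0 < t)%R by apply: pos; exact: subset_itv_oo_cc.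
  have h : is_derive t (1%R : R) (fun t => t `^ g / g)%R (g * t `^ (g - 1) / g)%R.
    have -> : (g * t `^ (g - 1) / g = t `^ g *: 0 + g^-1 *: (g * t `^ (g - 1)))%R.
      by rewrite scaler0 add0r [RHS]mulrC.
    exact: (@is_deriveM _ _ (fun t : R => t `^ g)%R (cst g^-1%R) t 1%R _ _
      (is_derive1_powR g t0) (is_derive_cst _ _ _)).
  by rewrite derive1E (@derive_val _ _ _ _ _ _ _ h) mulrAC divff ?mul1r.
Qed.

Lemma integral_powR_0 (g b : R) : (0 < g)%R -> (0 < b)%R ->
  \int[lebesgue_measure]_(t in `]0%R, b[) (t `^ (g - 1))%:E = (b `^ g / g)%:E.
Proof.
move=> g0 b0.
(* With halved endpoints the powers [a k] to the g form a geometric sequence, whose limit 0 is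
   immediate. *)
pose a k := (b / (2 ^ k.+1)%:R)%R.
have a0 k : (0 < a k)%R by rewrite divr_gt0// ltr0n expn_gt0.
have ab k : (a k < b)%R by rewrite /a ltr_pdivrMr ?ltr0n ?expn_gt0// ltr_pMr// ltr1n (@ltn_exp2l 2 0).
pose S k : set R := `[a k, b]%classic.
have US : \bigcup_k S k = `]0%R, b]%classic.
  apply/seteqP; split => t /=.
    by move=> [k _]; rewrite /S/= !in_itv/= => /andP[h ->]; rewrite (lt_le_trans (a0 k)).
  rewrite in_itv/= => /andP[t0 tb].
  exists (Num.truncn (b / t)) => //; rewrite /S/= in_itv/= tb andbT.
  rewrite /a ler_pdivrMr ?ltr0n ?expn_gt0// -ler_pdivrMl// mulrC.
  apply/ltW/(lt_le_trans (truncnS_gt _)); rewrite ler_nat.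
  by apply: ltnW; exact: ltn_expl.
have c1 : (\int[lebesgue_measure]_(t in S k) (t `^ (g - 1))%:E) @[k --> \oo] -->
    \int[lebesgue_measure]_(t in `]0%R, b]) (t `^ (g - 1))%:E.
  rewrite -US; apply: ge0_nondecreasing_set_cvg_integral => //.
  - apply/nondecreasing_seqP => k; apply/subsetPset => t; rewrite /S/= !in_itv/= => /andP[h ->].
    rewrite andbT (le_trans _ h)// /a ler_pM2l// lef_pV2 ?posrE ?ltr0n ?expn_gt0//.
    by rewrite ler_nat leq_exp2l.
  - by move=> k; exact: measurable_itv.
  - move=> k; apply: measurable_funTS; apply/measurable_EFinP.
    exact: measurable_powR.
  - by move=> k t _; rewrite lee_fin powR_ge0.
have c2 : (\int[lebesgue_measure]_(t in S k) (t `^ (g - 1))%:E) @[k --> \oo] --> (b `^ g / g)%:E.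
  under eq_fun do rewrite integral_powR_itv ?a0 ?ab ?gt_eqF//.
  apply: cvg_EFin; first exact: nearW.
  rewrite -[X in _ --> X](@subr0 _ (b `^ g / g)%R).
  under eq_fun do rewrite mulrBl.
  apply: cvgB; first exact: cvg_cst.
  rewrite -[X in _ --> X](@mul0r _ (g^-1)%R); apply: cvgMr_tmp.
  have -> : (fun k => a k `^ g)%R = geometric (b `^ g * 2 `^ (- g))%R (2 `^ (- g))%R.
    apply/funext => k /=; rewrite /a powRM ?invr_ge0//; last exact: ltW.
    rewrite -mulrA -exprS -powR_mulrn ?powR_ge0// -powRrM natrX -powR_inv1 ?exprn_ge0//.
    by rewrite -powR_mulrn// -!powRrM; congr (_ * _ `^ _)%R; ring.
  apply: cvg_geometric; rewrite ger0_norm ?powR_ge0// powRN invf_lt1 ?powR_gt0//.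
  rewrite /powR gt_eqF//. rewrite -[ltLHS]expR0 ltr_expR mulr_gt0// ln_gt0//; lra.
rewrite integral_itv_bndo_bndc//; last first.
  by apply: measurable_funTS; apply/measurable_EFinP; exact: measurable_powR.
exact: (cvg_unique _ c1 c2).
Qed.

(** Every truncated integral is already below the claimed bound, so an inequality needs no limit of
    powers at infinity. *)
Lemma integral_powR_tail (g b : R) : (0 < g)%R -> (0 < b)%R ->
  \int[lebesgue_measure]_(t in `[b, +oo[) (t `^ (- g - 1))%:E <= (b `^ (- g) / g)%:E.
Proof.
move=> g0 b0.
have g0' : (- g != 0)%R by rewrite oppr_eq0 gt_eqF.
pose c (k : nat) : R := (b + k.+1%:R)%R.
have bc k : (b < c k)%R by rewrite ltrDl.
pose S k : set R := `[b, c k]%classic.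
have US : \bigcup_k S k = `[b, +oo[%classic.
  apply/seteqP; split => t /=.
    by move=> [k _]; rewrite /S/= !in_itv/= => /andP[->].
  rewrite in_itv/= andbT => bt; exists (Num.truncn t) => //; rewrite /S/= in_itv/= bt.
  by rewrite /c ltW// (lt_le_trans (truncnS_gt t))// lerDr ltW.
have c1 : (\int[lebesgue_measure]_(t in S k) (t `^ (- g - 1))%:E) @[k --> \oo] -->
    \int[lebesgue_measure]_(t in `[b, +oo[) (t `^ (- g - 1))%:E.
  rewrite -US; apply: ge0_nondecreasing_set_cvg_integral => //.
  - apply/nondecreasing_seqP => k; apply/subsetPset => t; rewrite /S/= !in_itv/= => /andP[->] h.
    by rewrite (le_trans h)// /c lerD2l ler_nat.
  - by move=> k; exact: measurable_itv.
  - move=> k; apply: measurable_funTS; apply/measurable_EFinP.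
    exact: measurable_powR.
  - by move=> k t _; rewrite lee_fin powR_ge0.
rewrite -(cvg_lim _ c1)//; apply: lime_le; first by apply/cvg_ex; eexists; exact: c1.
apply: nearW => k; rewrite integral_powR_itv ?b0 ?bc//.
rewrite lee_fin invrN mulrN -mulNr opprB; apply: ler_wpM2r; first by rewrite invr_ge0 ltW.
by rewrite gerBl powR_ge0.
Qed.

End power_integral.

(** * Polar coordinates *)

Section polar_coordinates.
Context {R : realType} (n : nat) (P : 'M[R]_n) (rho : 'cV[R]_n -> R).
Hypothesis hrho : quasi_distance P rho.
Hypothesis trP : 0 < \tr P.
Local Notation U := 'cV[R]_n.
Local Notation mu := (lebesgue_cV n : {measure set U -> \bar R}).
Local Notation gamma := (\tr P).
Local Open Scope ereal_scope.

Definition dilation_invariant (h : U -> \bar R) :=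
  forall t x, (0 < t)%R -> h (dilation P t *m x) = h x.

Lemma measurable_qdist_preimage (I : set R) : measurable I -> measurable (rho @^-1` I).
Proof.
by move=> mI; rewrite -[X in measurable X]setTI; exact: (qdist_measurable hrho).
Qed.

(** An invariant h takes the value h w at the point of polar coordinates (r, w), and the indicator
    of the region depends on r only; the double integral factors. *)
Lemma polar_invariant sigma (I : set R) (h : U -> \bar R) :
  polar_decomposition P rho sigma -> measurable I ->
  measurable_fun setT h -> (forall x, 0 <= h x) -> dilation_invariant h ->
  \int[mu]_(x in rho @^-1` I) h x =
  \int[lebesgue_measure]_(r in `]0%R, +oo[ `&` I) (r `^ (gamma - 1))%:E * \int[sigma]_w h w.
Proof.
move=> [sigma0 polar] mI mh h0 hinv.
have mpI := measurable_qdist_preimage mI.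
have f0 x : 0 <= (h \_ (rho @^-1` I)) x by apply: erestrict_ge0.
have mf : measurable_fun setT (h \_ (rho @^-1` I)).
  by apply/(measurable_restrictT _ _).1 => //; exact: measurable_funTS.
have mk : measurable_fun setT ((fun r : R => (r `^ (gamma - 1))%:E) \_ I).
  apply/(measurable_restrictT _ _).1 => //; apply: measurable_funTS; apply/measurable_EFinP.
  exact: measurable_powR.
have k0 r : 0 <= ((fun r : R => (r `^ (gamma - 1))%:E) \_ I) r.
  by apply: erestrict_ge0 => x _; rewrite lee_fin powR_ge0.
rewrite integral_mkcond (polar _ mf f0) integral_mkcondr -ge0_integralZr//; last 2 first.
  exact: measurable_funTS.
  exact: integral_ge0.
apply: eq_integral => r; rewrite inE/= in_itv/= andbT => r0.
(* The identity rho (A_r w) = r needs rho w = 1. This holds outside a null set of [sigma], so the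
   integrands agree almost everywhere. *)
transitivity (\int[sigma]_w (((fun r : R => (r `^ (gamma - 1))%:E) \_ I) r * h w)).
  apply: ge0_ae_eq_integral => //.
  - apply: emeasurable_funM => //; apply: (measurableT_comp mf); exact: measurable_mulcV.
  - by apply: emeasurable_funM.
  - by move=> x _; rewrite mule_ge0// lee_fin powR_ge0.
  - by move=> x _; rewrite mule_ge0.
  - exists (~` [set w | rho w = 1%R]); split => //.
      apply: measurableC; rewrite (_ : mkset _ = rho @^-1` [set 1%R])//.
      by apply: measurable_qdist_preimage; exact: measurable_set1.
    move=> w /= hw h1; apply: hw => _.
    rewrite !patchE hinv//.
    have -> : (dilation P r *m w \in rho @^-1` I) = (r \in I).
      by apply/idP/idP; rewrite !inE/= (qdist_homogeneous hrho)// h1 mulr1.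
    by case: ifP => _; rewrite ?mul0e// muleC.
by rewrite ge0_integralZl.
Qed.

Let vol sigma (h : U -> \bar R) (r : R) :
  polar_decomposition P rho sigma -> (0 < r)%R ->
  measurable_fun setT h -> (forall x, 0 <= h x) -> dilation_invariant h ->
  \int[mu]_(x in [set x | (rho x < r)%R]) h x = (r `^ gamma / gamma)%:E * \int[sigma]_w h w.
Proof.
move=> polar r0 mh h0 hinv.
have := polar_invariant polar (measurable_itv `]-oo, r[) mh h0 hinv.
rewrite (_ : rho @^-1` _ = [set x | (rho x < r)%R]); last first.
  by apply/seteqP; split => x/=; rewrite in_itv.
move=> ->; congr (_ * _); rewrite -integral_powR_0//.
congr (integral _ _ _); apply/seteqP; split => t /=; rewrite !in_itv/= ?andbT.
  by case=> -> ->.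
by move/andP.
Qed.

Let shell sigma (h : U -> \bar R) :
  polar_decomposition P rho sigma ->
  measurable_fun setT h -> (forall x, 0 <= h x) -> dilation_invariant h ->
  \int[mu]_(x in [set x | (1 <= rho x < 2)%R]) h x =
  ((2 `^ gamma - 1) / gamma)%:E * \int[sigma]_w h w.
Proof.
move=> polar mh h0 hinv.
have := polar_invariant polar (measurable_itv `[1%R, 2%R[) mh h0 hinv.
rewrite (_ : rho @^-1` _ = [set x | (1 <= rho x < 2)%R]); last first.
  by apply/seteqP; split => x/=; rewrite in_itv.
move=> ->; congr (_ * _).
have -> : (2 `^ gamma - 1 = 2 `^ gamma - 1 `^ gamma :> R)%R by rewrite powR1.
rewrite -integral_powR_itv ?gt_eqF//; last by apply/andP; split; lra.
rewrite -integral_itv_bndo_bndc; last first.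
  by apply: measurable_funTS; apply/measurable_EFinP; exact: measurable_powR.
congr (integral _ _ _); apply/seteqP; split => t /=; rewrite !in_itv/= ?andbT.
  by case=> _ ->.
by case/andP => t1 t2; split; [exact: lt_le_trans t1|rewrite t1].
Qed.

Lemma integral_qball_invariant (h : U -> \bar R) (r : R) : (0 < r)%R ->
  measurable_fun setT h -> (forall x, 0 <= h x) -> dilation_invariant h ->
  \int[mu]_(x in [set x | (rho x < r)%R]) h x =
  (r `^ gamma)%:E * \int[mu]_(x in [set x | (rho x < 1)%R]) h x.
Proof.
move=> r0 mh h0 hinv; have [sigma polar] := qdist_polar hrho.
by rewrite !(vol polar)// powR1 muleA -EFinM mul1r.
Qed.

(** Ball and shell integrals are positive multiples of one integral against [sigma]. The shell is
    the accessible one: its points reach the Euclidean sphere in bounded time. *)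
Lemma integral_qball_lty (h : U -> \bar R) :
  measurable_fun setT h -> (forall x, 0 <= h x) -> dilation_invariant h ->
  \int[mu]_(x in [set x | (1 <= rho x < 2)%R]) h x < +oo ->
  \int[mu]_(x in [set x | (rho x < 1)%R]) h x < +oo.
Proof.
move=> mh h0 hinv; have [sigma polar] := qdist_polar hrho.
rewrite (vol polar)// (shell polar)//.
have c0 : (0 < (2 `^ gamma - 1) / gamma :> R)%R.
  rewrite divr_gt0// subr_gt0 /powR gt_eqF// -[ltLHS]expR0 ltr_expR mulr_gt0// ln_gt0//; lra.
have : 0 <= \int[sigma]_w h w by exact: integral_ge0.
case: (\int[sigma]_w h w) => [x _ _|_|//]; first by rewrite -EFinM ltry.
by rewrite gt0_muley ?lte_fin// ltxx.
Qed.

Lemma measurable_qball r : measurable [set x | (rho x < r)%R].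
Proof.
rewrite (_ : mkset _ = rho @^-1` `]-oo, r[); last first.
  by apply/seteqP; split => x/=; rewrite in_itv.
exact: measurable_qdist_preimage.
Qed.

Lemma ellipsoid_reflect (x : U) r : ellipsoid rho x r = reflect_cV x @^-1` [set z | (rho z < r)%R].
Proof. by []. Qed.

Lemma measurable_ellipsoid (x : U) r : measurable (ellipsoid rho x r).
Proof.
rewrite ellipsoid_reflect -[X in measurable X]setTI.
by apply: measurable_subcV => //; exact: measurable_qball.
Qed.

(** The constant upsilon_rho; [fine] loses nothing, by [qball1_measure_lty]. *)
Definition unit_volume : R := fine (mu [set x | (rho x < 1)%R]).

Lemma qball_measure r : (0 < r)%R ->
  mu [set x | (rho x < r)%R] = (r `^ gamma)%:E * mu [set x | (rho x < 1)%R].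
Proof.
move=> r0; have := @integral_qball_invariant (cst 1) r r0.
by rewrite !integral_cst ?mul1e//; [apply|exact: measurable_qball|exact: measurable_qball].
Qed.

Lemma qball1_measure_lty : mu [set x | (rho x < 1)%R] < +oo.
Proof.
have [e e0 he] := qdist_small_norm hrho (@ltr01 R).
have : mu [set x | (rho x < e)%R] < +oo.
  apply: (@le_lt_trans _ _ (mu [set y | (`|0 - y| < 1)%R])).
    apply: le_measure; rewrite ?inE.
    - exact: measurable_qball.
    - exact: measurable_norm_lt.
    - by move=> y /= /he; rewrite sub0r normrN.
  by rewrite lebesgue_cV_ball0// ltry.
rewrite qball_measure//; case: (mu [set x | (rho x < 1)%R]) => [x _||//]; first by rewrite ltry.
by rewrite gt0_muley ?ltxx// lte_fin powR_gt0.
Qed.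

Lemma qball1_measureE : mu [set x | (rho x < 1)%R] = unit_volume%:E.
Proof. by rewrite /unit_volume fineK// ge0_fin_numE// qball1_measure_lty. Qed.

(** If it vanished, all ellipsoids about 0 would be null by scaling, yet countably many of them
    cover the unit cube. *)
Lemma unit_volume_gt0 : (0 < unit_volume)%R.
Proof.
rewrite lt_neqAle fine_ge0// andbT; apply/eqP => v0.
have : mu [set y : U | (`|0 - y| < 1)%R] = 0.
  have null k : mu [set x | (rho x < k.+1%:R)%R] = 0.
    by rewrite qball_measure// qball1_measureE -v0 mule0.
  have mk k : measurable [set x | (rho x < k.+1%:R)%R] by exact: measurable_qball.
  apply/eqP; rewrite eq_le measure_ge0 andbT.
  apply: (@le_trans _ _ (mu (\bigcup_k [set x | (rho x < k.+1%:R)%R]))).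
    apply: le_measure; rewrite ?inE; [exact: measurable_norm_lt|exact: bigcupT_measurable|].
    by move=> y _; exists (Num.truncn (rho y)) => //=; exact: truncnS_gt.
  apply: (le_trans (generalized_Boole_inequality _ mk _)); first exact: bigcupT_measurable.
  by rewrite eseries0.
rewrite lebesgue_cV_ball0// mulr1 => -[] /eqP; rewrite expf_eq0; lra.
Qed.

Lemma ellipsoid_measure (x : U) r : (0 < r)%R ->
  mu (ellipsoid rho x r) = (unit_volume * r `^ gamma)%:E.
Proof.
move=> r0; rewrite ellipsoid_reflect lebesgue_cV_reflect; last exact: measurable_qball.
by rewrite qball_measure// qball1_measureE -EFinM mulrC.
Qed.

Lemma integral_ellipsoid_invariant (h : U -> \bar R) (x : U) (r : R) : (0 < r)%R ->
  measurable_fun setT h -> (forall x, 0 <= h x) -> dilation_invariant h ->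
  \int[mu]_(y in ellipsoid rho x r) h (x - y)%R =
  (r `^ gamma)%:E * \int[mu]_(x in [set x | (rho x < 1)%R]) h x.
Proof.
move=> r0 mh h0 hinv; rewrite -integral_qball_invariant// [RHS]integral_mkcond.
rewrite -(ge0_integral_reflect x); last 2 first.
- apply/(measurable_restrictT _ _).1; first exact: measurable_qball.
  exact: measurable_funTS.
- by move=> y; apply: erestrict_ge0.
by rewrite [LHS]integral_mkcond; apply: eq_integral => y _; rewrite !patchE.
Qed.

End polar_coordinates.

(** * From the Euclidean sphere to the unit ellipsoid *)

Section transference.
Context {R : realType} (n : nat) (P : 'M[R]_n) (rho : 'cV[R]_n -> R).
Hypothesis hrho : quasi_distance P rho.
Local Notation U := 'cV[R]_n.
Local Notation mu := (lebesgue_cV n : {measure set U -> \bar R}).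

Variable T : R.

(** The affine map of the interval (1/2, 1) onto (-T, T), the range of the orbit times in
    [qdist_orbit_sphere]. *)
Let tau (r : R) : R := T * (4 * r - 3).

(* [orbit_flow] unrolls the Euclidean shell 1/2 < |x| < 1 along the orbits that
   meet the sphere: the direction of x selects an orbit and |x| the time. *)
Definition orbit_flow (x : U) : U := expmx (tau (enorm x) *: P) *m radial_proj x.

Definition half_shell : set U := [set x | 2^-1 < enorm x < 1].

Lemma measurable_orbit_flow : measurable_fun setT orbit_flow.
Proof.
apply: measurable_fun_mxP => i j.
rewrite (_ : (fun _ => _) = fun x => \sum_(k < n) expmx (tau (enorm x) *: P) i k * radial_proj x k j).
  apply: measurable_sum => k; apply: measurable_funM.
    apply: (@measurableT_comp _ _ _ _ _ _ (fun s : R => expmx (s *: P) i k)).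
      apply: continuous_measurable_fun => s.
      apply/differentiable_continuous/derivable1_diffP.
      by apply: ex_derive; exact: is_derive_expmx.
    apply: measurable_funM => //; apply: measurable_funB => //.
    by apply: measurable_funM => //; exact: measurable_enorm.
  by apply: (measurableT_comp (measurable_mx_entry _ _)); exact: measurable_radial_proj.
by apply/funext => x; rewrite /orbit_flow mxE.
Qed.

Lemma open_half_shell : open half_shell.
Proof.
apply/open_norm_lt => x /andP[x1 x2].
have n1 : 0 < n%:R + 1 :> R by rewrite ltr_wpDl.
pose d := Num.min (enorm x - 2^-1) (1 - enorm x).
have d0 : 0 < d by rewrite lt_min !subr_gt0 x1.
exists (d / (n%:R + 1)); first by rewrite divr_gt0.
move=> y /=; rewrite ltr_pdivlMr// => h.
have : `|enorm x - enorm y| < d.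
  apply: (le_lt_trans (enorm_lipschitz x y)); apply: le_lt_trans h.
  by rewrite mulrC ler_wpM2l// lerDl.
rewrite /d lt_min !ltr_norml /half_shell/= => /andP[/andP[? ?] /andP[? ?]].
by apply/andP; split; lra.
Qed.

Let half_shell_ball x : half_shell x -> `|0 - x| < 1.
Proof.
by move=> /andP[_ x1]; rewrite sub0r normrN (le_lt_trans (norm_le_enorm x)).
Qed.

Lemma measurable_half_shell : measurable half_shell.
Proof. by apply: open_measurable_cV; exact: open_half_shell. Qed.

Lemma half_shell_lty : (mu half_shell < +oo)%E.
Proof.
apply: (@le_lt_trans _ _ (mu [set y | `|0 - y| < 1])).
  apply: le_measure; rewrite ?inE; [exact: measurable_half_shell|exact: measurable_norm_lt|].
  exact: half_shell_ball.
by rewrite lebesgue_cV_ball0// ltry.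
Qed.

Lemma enorm_radial_proj (x : U) : 0 < enorm x -> enorm (radial_proj x) = 1.
Proof.
by move=> x0; rewrite /radial_proj enormZ ?invr_ge0 ?ltW// mulVf// gt_eqF.
Qed.

Lemma radial_proj_lipschitz x y : half_shell x -> half_shell y ->
  `|radial_proj x - radial_proj y| <= (2 + 2 * n%:R) * `|x - y|.
Proof.
move=> /andP[x1 x2] /andP[y1 y2].
have x0 : 0 < enorm x by exact: lt_trans x1.
have y0 : 0 < enorm y by exact: lt_trans y1.
have -> : radial_proj x - radial_proj y =
    (enorm x)^-1 *: (x - y) + ((enorm x)^-1 * (enorm y - enorm x)) *: radial_proj y.
  rewrite /radial_proj scalerA.
  have -> : (enorm x)^-1 * (enorm y - enorm x) / enorm y = (enorm x)^-1 - (enorm y)^-1.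
    by field; rewrite !gt_eqF.
  by rewrite scalerBl scalerBr addrA subrK.
have xi : (enorm x)^-1 <= 2 by rewrite -[leRHS]invrK lef_pV2 ?posrE ?ltW.
rewrite mulrDl; apply: (le_trans (ler_normD _ _)); apply: lerD.
  by rewrite normrZ ger0_norm ?invr_ge0 ?enorm_ge0// ler_wpM2r.
rewrite normrZ normrM ger0_norm ?invr_ge0 ?enorm_ge0//.
rewrite -[leRHS]mulr1; apply: ler_pM => //; rewrite ?mulr_ge0 ?invr_ge0 ?enorm_ge0//.
  rewrite -mulrA; apply: ler_pM; rewrite ?invr_ge0 ?enorm_ge0//.
  by rewrite distrC; exact: enorm_lipschitz.
by rewrite (le_trans (norm_le_enorm _))// enorm_radial_proj.
Qed.

Lemma orbit_flow_lipschitz : 0 < T -> exists2 L : R, 0 < L &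
  forall x y, half_shell x -> half_shell y -> `|orbit_flow x - orbit_flow y| <= L * `|x - y|.
Proof.
move=> T0; have [L L0 hL] := expmx_lipschitz P T0.
have tauT x : half_shell x -> `|tau (enorm x)| <= T.
  move=> /andP[x1 x2]; rewrite /tau normrM gtr0_norm// -[leRHS]mulr1 ler_pM2l// ler_norml.
  by apply/andP; split; lra.
have M1 s : `|s| <= T -> `|expmx (s *: P)| <= 1 + L * T.
  move=> sT; rewrite -[expmx _](subrK (expmx (0 *: P))) addrC.
  apply: (le_trans (ler_normD _ _)); apply: lerD.
    rewrite scale0r expmx0; apply/norm_mx_le => // i j; rewrite mxE.
    by case: (i == j); rewrite ?normr1 ?normr0.
  apply: (le_trans (hL _ _ sT _)); first by rewrite normr0 ltW.
  by rewrite subr0 ler_wpM2l// ltW.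
(* Product rule: the first summand is the bound on the exponential times the Lipschitz constant of
   [radial_proj], the second the Lipschitz constant of the exponential times that of [tau] composed
   with [enorm]. The outer factors n come from [norm_mulmx]. *)
pose C := n%:R * (1 + L * T) * (2 + 2 * n%:R) + n%:R * (L * (T * (4 * n%:R))).
have C0 : 0 <= C.
  by rewrite addr_ge0// !mulr_ge0 ?addr_ge0 ?mulr_ge0// ltW.
exists (C + 1); first by rewrite ltr_wpDl.
move=> x y hx hy; rewrite /orbit_flow.
set a := tau (enorm x); set b := tau (enorm y).
have -> : expmx (a *: P) *m radial_proj x - expmx (b *: P) *m radial_proj y =
  expmx (a *: P) *m (radial_proj x - radial_proj y) + (expmx (a *: P) - expmx (b *: P)) *m radial_proj y.
  by rewrite mulmxBr mulmxBl addrA subrK.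
apply: (le_trans (ler_normD _ _)).
apply: (@le_trans _ _ (C * `|x - y|)); last by rewrite ler_wpM2r// lerDl.
rewrite /C mulrDl; apply: lerD.
  apply: (le_trans (norm_mulmx _ _)); rewrite -[leRHS]mulrA; apply: ler_pM; rewrite ?mulr_ge0//.
    by rewrite ler_wpM2l// M1// tauT.
  exact: radial_proj_lipschitz.
apply: (le_trans (norm_mulmx _ _)).
apply: (@le_trans _ _ (n%:R * `|expmx (a *: P) - expmx (b *: P)| * 1)).
  rewrite ler_wpM2l ?mulr_ge0// (le_trans (norm_le_enorm _))// enorm_radial_proj//.
  by case/andP : hy => hy _; exact: lt_trans hy.
rewrite mulr1 -!mulrA ler_wpM2l// (le_trans (hL _ _ (tauT _ hx) (tauT _ hy)))//.
rewrite ler_wpM2l//; first exact: ltW.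
rewrite /a /b /tau -mulrBr normrM gtr0_norm// ler_pM2l//.
have -> : 4 * enorm x - 3 - (4 * enorm y - 3) = 4 * (enorm x - enorm y) by ring.
by rewrite normrM ger0_norm// ler_wpM2l// enorm_lipschitz.
Qed.

End transference.

Section sphere_integral.
Context {R : realType} (n : nat) (P : 'M[R]_n) (rho : 'cV[R]_n -> R).
Hypothesis hrho : quasi_distance P rho.
Local Notation U := 'cV[R]_n.
Local Notation mu := (lebesgue_cV n : {measure set U -> \bar R}).

Let qshell : set U := [set x | 1 <= rho x < 2].

Lemma qshell_sub_orbit_flow : exists2 T : R, 0 < T &
  qshell `<=` orbit_flow P T @` @half_shell R n.
Proof.
have [T T0 hT] := qdist_orbit_sphere hrho; exists T => // x /hT[s sT xs].
pose w := expmx (s *: P) *m x.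
(* The solution of tau r = -s: flowing from the direction w for the time -s returns to x. *)
pose r := (3 - s / T) / 4.
have [s1 s2] : (- 1 < s / T) /\ (s / T < 1).
  by move: sT; rewrite ltr_norml ltr_pdivlMr// ltr_pdivrMr// mulN1r mul1r => /andP[].
have r1 : 2^-1 < r by rewrite /r; lra.
have r2 : r < 1 by rewrite /r; lra.
have r0 : 0 < r by apply: lt_trans r1.
have er : enorm (r *: w) = r by rewrite enormZ ?ltW// xs mulr1.
exists (r *: w); first by rewrite /half_shell/= er r1.
rewrite /orbit_flow /radial_proj er scalerA mulVf ?gt_eqF// scale1r.
have -> : T * (4 * r - 3) = - s by rewrite /r; field; rewrite gt_eqF.
by rewrite mulmxA expmxN_mul mul1mx.
Qed.

(** An invariant h has the same value at [orbit_flow x] and at [radial_proj x]. Its integral against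
    the image measure is therefore a cone integral over the half shell, which is part of the
    punctured ball; the Lipschitz bound compares the image measure with Lebesgue's. *)
Lemma qshell_le_cone : exists2 C : R, 0 <= C & forall h : U -> \bar R,
  measurable_fun setT h -> (forall x, 0 <= h x)%E -> dilation_invariant P h ->
  (\int[mu]_(x in qshell) h x <= C%:E * \int[@cone_measure R n]_x h x)%E.
Proof.
have [T T0 hT] := qshell_sub_orbit_flow.
have [L L0 hL] := @orbit_flow_lipschitz R n P T T0.
exists (L ^+ n); first by rewrite exprn_ge0// ltW.
move=> h mh h0 hinv.
pose nu := image_measure (@measurable_half_shell R n) (@half_shell_lty R n) (measurable_orbit_flow P T).
apply: (@le_trans _ _ ((L ^+ n)%:E * \int[nu]_x h x)%E).
  apply: ge0_measure_le_integral => //; first by rewrite exprn_ge0// ltW.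
  move=> A mA AS.
  have := lipschitz_image_le (@measurable_half_shell R n) (@half_shell_lty R n)
    (measurable_orbit_flow P T) (@open_half_shell R n) L0 mA hL (subset_trans AS hT).
  by rewrite /nu /image_measure /mfrestr /mrestr setIC.
apply: lee_wpmul2l; first by rewrite lee_fin exprn_ge0// ltW.
have -> : (\int[nu]_x h x =
    \int[mfrestr (@measurable_half_shell R n) (@half_shell_lty R n)]_x (h (radial_proj x)))%E.
  transitivity (\int[mfrestr (@measurable_half_shell R n) (@half_shell_lty R n)]_x (h (orbit_flow P T x)))%E.
    exact: (ge0_integral_pushforward (measurable_orbit_flow P T)
      (mfrestr (@measurable_half_shell R n) (@half_shell_lty R n))).
  apply: eq_integral => x _; rewrite /orbit_flow.
  set s := (X in expmx (X *: P)).
  by rewrite -[s]expRK -/(dilation P (expR s)) hinv// expR_gt0.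
have -> : (\int[@cone_measure R n]_x h x =
    \int[mrestr (lebesgue_cV n) (@measurable_punctured_eball R n)]_x (h (radial_proj x)))%E.
  exact: (ge0_integral_pushforward (@measurable_radial_proj R n)).
rewrite -[leRHS]mul1e; apply: ge0_measure_le_integral => // A mA _.
rewrite mul1e /mfrestr /mrestr; apply: le_measure; rewrite ?inE.
- by apply: measurableI => //; exact: measurable_half_shell.
- by apply: measurableI => //; exact: measurable_punctured_eball.
- move=> x [Ax /andP[x1 x2]]; split => //; rewrite /punctured_eball/=.
  by rewrite (ltW x2) andbT (lt_trans _ x1).
Qed.

Lemma punctured_eball_lty : (mu (@punctured_eball R n) < +oo)%E.
Proof.
apply: (@le_lt_trans _ _ (mu [set y | `|0 - y| < 2])).
  apply: le_measure; rewrite ?inE; [exact: measurable_punctured_eball|exact: measurable_norm_lt|].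
  move=> x /andP[_ x1] /=; rewrite sub0r normrN (le_lt_trans (norm_le_enorm x))//.
  by rewrite (le_lt_trans x1)// ltr1n.
by rewrite lebesgue_cV_ball0// ltry.
Qed.

Lemma punctured_eball_gt0 : (0 < n)%N -> (0 < mu (@punctured_eball R n))%E.
Proof.
(* A cube with all entries between d and 3d avoids the origin and has Euclidean norm at most 3dn =
   3/4. *)
move=> n0; pose d : R := (4 * n%:R)^-1.
have nR : 0 < n%:R :> R by rewrite ltr0n.
have d0 : 0 < d by rewrite invr_gt0 mulr_gt0.
pose c : U := const_mx (2 * d).
apply: (@lt_le_trans _ _ (mu [set y | `|c - y| < d])).
  by rewrite lebesgue_cV_ball// lte_fin exprn_gt0// mulr_gt0.
apply: le_measure; rewrite ?inE; [exact: measurable_norm_lt|exact: measurable_punctured_eball|].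
move=> y /(norm_mx_lt _ d0) h; rewrite /punctured_eball/=.
have hy i : d < y i ord0 < 3 * d.
  by have := h i ord0; rewrite !mxE ltr_norml => /andP[? ?]; apply/andP; split; lra.
apply/andP; split.
  have /andP[h1 _] := hy (Ordinal n0).
  by apply: lt_le_trans (enorm_entry _ (Ordinal n0)); rewrite normr_gt0 gt_eqF// (lt_trans d0).
apply: (le_trans (enorm_le_norm _)).
have : `|y| <= 3 * d.
  apply/norm_mx_le; first by rewrite mulr_ge0// ltW.
  move=> i j; rewrite ord1; have /andP[h1 h2] := hy i.
  by rewrite gtr0_norm ?ltW// (lt_trans d0).
rewrite -(@ler_pM2l _ n%:R)// => /le_trans; apply.
have -> : n%:R * (3 * d) = 3 / 4 by rewrite /d; field; rewrite gt_eqF.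
by lra.
Qed.

Lemma integral_sphere_measure (h : U -> \bar R) : measurable_fun setT h -> (forall x, 0 <= h x)%E ->
  (\int[@sphere_measure R n]_x h x =
  ((fine (mu (@punctured_eball R n)))^-1)%:E * \int[@cone_measure R n]_x h x)%E.
Proof. by move=> mh h0; rewrite [LHS]ge0_integral_mscale. Qed.

Lemma sphere_measure_lty : (@sphere_measure R n setT < +oo)%E.
Proof.
have : (@cone_measure R n setT < +oo)%E.
  by rewrite /cone_measure /pushforward /mrestr preimage_setT setTI punctured_eball_lty.
have : (0 <= @cone_measure R n setT)%E by exact: measure_ge0.
rewrite /sphere_measure /mscale/=; case: (cone_measure _) => [x _ _|//|//].
by rewrite -EFinM ltry.
Qed.

Lemma integral_qball_sphere (h : U -> \bar R) : (0 < n)%N -> 0 < \tr P ->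
  measurable_fun setT h -> (forall x, 0 <= h x)%E -> dilation_invariant P h ->
  (\int[@sphere_measure R n]_x h x < +oo)%E ->
  (\int[mu]_(x in [set x | (rho x < 1)%R]) h x < +oo)%E.
Proof.
move=> n0 trP mh h0 hinv; rewrite integral_sphere_measure// => hlt.
apply: (integral_qball_lty hrho trP mh h0 hinv).
have [C C0 /(_ h mh h0 hinv)] := qshell_le_cone.
move/le_lt_trans; apply.
(* Volume 0 or +oo would make this factor 0 by convention, and finiteness of the sphere integral
   would then say nothing about the cone integral. *)
have v0 : 0 < (fine (mu (@punctured_eball R n)))^-1.
  by rewrite invr_gt0 fine_gt0// punctured_eball_gt0//= punctured_eball_lty.
move: hlt; have : (0 <= \int[@cone_measure R n]_x h x)%E by exact: integral_ge0.
case: (\int[@cone_measure R n]_x h x)%E => [x _ _||//]; first by rewrite ltry.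
by rewrite gt0_muley ?lte_fin// ltxx.
Qed.

End sphere_integral.

Section kernel_exponent.
Context {R : realType} (n : nat) (P : 'M[R]_n) (rho : 'cV[R]_n -> R).
Hypothesis hrho : quasi_distance P rho.
Local Notation U := 'cV[R]_n.
Local Notation mu := (lebesgue_cV n : {measure set U -> \bar R}).
Variable Omega : U -> R.
Hypothesis mOmega : measurable_fun setT Omega.

Lemma measurable_normr_powR (a : R) : measurable_fun setT (fun x => (`|Omega x| `^ a)%:E).
Proof.
apply/measurable_EFinP; apply: (measurableT_comp (measurable_powR a)).
exact: measurableT_comp.
Qed.

Lemma sphere_Lnorm_finite (s : R) : 0 < s ->
  ('N[@sphere_measure R n]_s%:E[EFin \o Omega] < +oo)%E ->
  (\int[@sphere_measure R n]_x (`|Omega x| `^ s)%:E < +oo)%E.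
Proof.
move=> s0 h.
have <- := @poweR_Lnorm _ _ _ (@sphere_measure R n) (EFin \o Omega) s (lt0r_neq0 s0).
exact: poweR_lty.
Qed.

Lemma sphere_Lnormy_finite (s : R) : 0 < s ->
  ('N[@sphere_measure R n]_+oo[EFin \o Omega] < +oo)%E ->
  (\int[@sphere_measure R n]_x (`|Omega x| `^ s)%:E < +oo)%E.
Proof.
move=> s0 h.
have [M M0 hM] : exists2 M, 0 <= M & \forall x \ae (@sphere_measure R n), `|Omega x| <= M.
  move: h; rewrite unlock; case: ifPn => [_ h|].
    pose e := ess_sup (@sphere_measure R n) (abse \o (EFin \o Omega)).
    exists (Num.max (fine e) 0); first by rewrite le_max lexx orbT.
    have : {ae (@sphere_measure R n), forall x, ((abse \o (EFin \o Omega)) x <= e)%E}.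
      exact: ess_sup_ge.
    apply: filterS => x /=; rewrite le_max.
    by move: h; rewrite -/e; case: e => // r _; rewrite lee_fin => ->.
  (* Zero total mass: the norm is 0 by convention, and every bound holds almost everywhere. *)
  rewrite -leNgt => h0 _; exists 0 => //; exists setT; split => //.
  by apply/eqP; rewrite eq_le h0 measure_ge0.
apply: (@le_lt_trans _ _ (\int[@sphere_measure R n]_x (M `^ s)%:E)%E).
  apply: ae_ge0_le_integral => //.
  - exact: measurable_normr_powR.
  - by move=> x _; rewrite lee_fin powR_ge0.
  - by apply: filterS hM => x hx _; rewrite lee_fin ge0_ler_powR ?nnegrE// ltW.
rewrite integral_cst//.
apply: lte_mul_pinfty => //; first by rewrite lee_fin powR_ge0.
exact: sphere_measure_lty.
Qed.

(** Replaces s, possibly infinite, by a real exponent whose conjugate is still below p. On the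
    sphere, of finite measure, a bounded kernel has all powers integrable. *)
Lemma qball_kernel_exponent (s : \bar R) (p : R) : (0 < n)%N -> 0 < \tr P ->
  homogeneous0 P Omega -> (1 < s)%E ->
  ('N[@sphere_measure R n]_s[EFin \o Omega] < +oo)%E ->
  (1 <= hoelder_conjugate s)%E -> (hoelder_conjugate s < p%:E)%E ->
  exists s0 : R, [/\ 1 < s0, s0 / (s0 - 1) < p &
    (\int[mu]_(x in [set x | (rho x < 1)%R]) (`|Omega x| `^ s0)%:E < +oo)%E].
Proof.
move=> n0 trP hom s1 hN hs' hs'p.
have fin a : 0 < a -> (\int[@sphere_measure R n]_x (`|Omega x| `^ a)%:E < +oo)%E ->
    (\int[mu]_(x in [set x | (rho x < 1)%R]) (`|Omega x| `^ a)%:E < +oo)%E.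
  move=> a0 ha; apply: (integral_qball_sphere hrho n0 trP) => //.
  - exact: measurable_normr_powR.
  - by move=> t x t0; rewrite hom.
case: s s1 hN hs' hs'p => [s||//].
  rewrite lte_fin => s1 hN _ hs'p; exists s.
  have s0 : 0 < s by apply: lt_trans s1.
  split => //; last by apply: fin => //; exact: sphere_Lnorm_finite.
  move: hs'p; rewrite /hoelder_conjugate/= eqe gt_eqF// -EFinB.
  by rewrite inver subr_eq0 gt_eqF// -EFinM lte_fin.
move=> _ hN _; rewrite /hoelder_conjugate eqxx lte_fin => p1.
(* Any exponent beyond the conjugate p / (p - 1) of p has its own conjugate below p. *)
exists (p / (p - 1) + 1).
have p10 : 0 < p - 1 by rewrite subr_gt0.
have p0 : 0 < p by apply: lt_trans p1.
split; first by rewrite ltrDr divr_gt0.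
  rewrite addrK mulrDl divff ?gt_eqF ?divr_gt0// mul1r invf_div -ltrBrDl.
  by rewrite ltr_pdivrMr// -[ltLHS]mulr1 ltr_pM2l.
apply: fin; first by rewrite addr_gt0// divr_gt0.
by apply: sphere_Lnormy_finite => //; rewrite addr_gt0// divr_gt0.
Qed.

End kernel_exponent.

(** * The maximal function *)

Section layer_cake.
Local Open Scope ereal_scope.
Context {R : realType}.

Lemma integral_powR_below (a : R) (y : \bar R) : (0 < a)%R -> 0 <= y ->
  \int[lebesgue_measure]_(t in [set t : R | (0 < t)%R /\ t%:E < y]) (t `^ (a - 1))%:E =
  y `^ a * (a^-1)%:E.
Proof.
move=> a0; case: y => [b| |//]; last first.
  move=> _; rewrite poweRyr ?gt_eqF// gt0_mulye ?lte_fin ?invr_gt0//.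
  apply/eqyP => A A0.
  (* Chosen so that the integral up to b equals the prescribed A. *)
  pose b := ((A * a) `^ a^-1)%R.
  have Aa : (0 < A * a)%R by rewrite mulr_gt0.
  have b0 : (0 < b)%R by rewrite powR_gt0.
  have -> : A%:E = (b `^ a / a)%:E.
    by rewrite /b -powRrM mulVf ?gt_eqF// powRr1 ?ltW// mulfK ?gt_eqF.
  rewrite -integral_powR_0//; apply: ge0_subset_le_integral => //.
  - by move=> t /=; rewrite in_itv/= => /andP[t0 _]; split => //; rewrite ltry.
  - by move=> t _; rewrite lee_fin powR_ge0.
  - by move=> t _; rewrite lee_fin powR_ge0.
rewrite lee_fin le_eqVlt => /predU1P[<-|b0].
  rewrite poweR0r ?gt_eqF// mul0e (_ : mkset _ = set0) ?integral_set0//.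
  apply/seteqP; split => // t [t0]; rewrite lte_fin => /(lt_trans t0).
  by rewrite ltxx.
rewrite poweR_EFin -EFinM -integral_powR_0//.
congr (integral _ _ _); apply/seteqP; split => t /=; rewrite in_itv/= lte_fin.
  by case=> -> ->.
by move/andP.
Qed.

Context d (T : measurableType d) (mu : {sigma_finite_measure set T -> \bar R}).
Variables (g h : T -> \bar R).
Hypotheses (mg : measurable_fun setT g) (mh : measurable_fun setT h).
Hypotheses (g0 : forall x, 0 <= g x) (h0 : forall x, 0 <= h x).

(** Tonelli on the region below the graph of h. The weight g serves three uses: g = 1 for the
    maximal function, g = h on the other side of the maximal inequality, and the kernel times f as
    weight, with h = 1 / rho, for the potential. *)
Lemma layer_cake (a : R) : (0 < a)%R ->
  \int[mu]_x (g x * (h x `^ a * (a^-1)%:E)) =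
  \int[lebesgue_measure]_(t in `]0%R, +oo[)
    ((t `^ (a - 1))%:E * \int[mu]_(x in [set x | t%:E < h x]) g x).
Proof.
move=> a0.
pose A : set (T * measurableTypeR R) := [set z | (0 < z.2)%R /\ z.2%:E < h z.1].
have mA : measurable A.
  rewrite (_ : A = (snd @^-1` `]0%R, +oo[) `&` (setT `&` [set z | z.2%:E < h z.1])).
    apply: measurableI; first by rewrite -[X in measurable X]setTI; exact: measurable_snd.
    apply: measurable_lte => //; last exact: (measurableT_comp mh).
    by apply/measurable_EFinP; exact: measurable_snd.
  by apply/seteqP; split => z; rewrite /A/= in_itv/= andbT ?setTI; [case|case=> ? []].
pose F (z : T * measurableTypeR R) := g z.1 * ((z.2 `^ (a - 1))%:E * (\1_A z)%:E).
have F0 z : 0 <= F z.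
  by rewrite /F !mule_ge0// lee_fin ?powR_ge0.
have mF : measurable_fun setT F.
  apply: emeasurable_funM; first exact: (measurableT_comp mg).
  apply: emeasurable_funM.
    apply/measurable_EFinP; apply: (measurableT_comp (measurable_powR _)).
    exact: measurable_snd.
  by apply/measurable_EFinP; exact: measurable_indic.
have := fubini_tonelli (m1 := mu) (m2 := lebesgue_measure) F mF F0.
rewrite (_ : \int[mu]_x _ = \int[mu]_x (g x * (h x `^ a * (a^-1)%:E))); last first.
  apply: eq_integral => x _; rewrite /F/= ge0_integralZl//; last 2 first.
  - apply: emeasurable_funM; first by apply/measurable_EFinP; exact: measurable_powR.
    apply/measurable_EFinP; apply: measurableT_comp; first exact: measurable_indic.
    exact: pair1_measurable.
  - by move=> t _; rewrite mule_ge0// lee_fin ?powR_ge0.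
  congr (_ * _); rewrite -integral_powR_below// [RHS]integral_mkcond.
  apply: eq_integral => t _; rewrite patchE indicE.
  have -> : ((x, t) \in A) = (t \in [set t : R | (0 < t)%R /\ t%:E < h x]).
    by apply/idP/idP; rewrite !inE.
  by case: ifP => _; rewrite ?mule1 ?mule0.
move=> ->; rewrite [RHS]integral_mkcond; apply: eq_integral => t _.
rewrite patchE mem_setE in_itv/= andbT; case: ifPn => [t0|t0].
  rewrite -ge0_integralZl//; last 3 first.
  - by rewrite -[X in measurable X]setTI; apply: measurable_lte.
  - exact: measurable_funTS.
  - by rewrite lee_fin powR_ge0.
  rewrite [RHS]integral_mkcond; apply: eq_integral => x _.
  rewrite /F/= patchE indicE.
  have -> : ((x, t) \in A) = (x \in [set x | t%:E < h x]).
    by apply/idP/idP; rewrite !inE /A/= ?t0//; case.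
  by case: ifP => _; rewrite ?mule1 ?mule0// muleC.
apply: integral0_eq => x _; rewrite /F/= indicE memNset ?mule0//.
by rewrite /A/= (negbTE t0); case.
Qed.

End layer_cake.

Section maximal_function.
Context {R : realType} (n : nat) (P : 'M[R]_n) (rho : 'cV[R]_n -> R).
Hypothesis hrho : quasi_distance P rho.
Hypothesis trP : 0 < \tr P.
Local Notation U := 'cV[R]_n.
Local Notation mu := (lebesgue_cV n : {measure set U -> \bar R}).
Local Notation gamma := (\tr P).
Local Notation E := (ellipsoid rho).
Local Open Scope ereal_scope.

Let mE x r : measurable (E x r) := measurable_ellipsoid hrho x r.

(** Two quasi-triangle inequalities along x1, z, x2, y give K (r1 + 2 K r1), which is at most 3 K^2
    r1 since K >= 1. *)
Lemma ellipsoid_engulf (K : R) (x1 x2 : U) (r1 r2 : R) : (1 <= K)%R ->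
  (forall x y, rho (x + y) <= K * (rho x + rho y))%R ->
  (0 < r1)%R -> (r2 <= r1)%R -> E x2 r2 `&` E x1 r1 !=set0 ->
  E x2 r2 `<=` E x1 (3 * K ^+ 2 * r1)%R.
Proof.
move=> K1 hK r10 r21 [z [/= z2 z1]] y /= y2; rewrite /ellipsoid/= in z1 z2 y2 *.
have K0 : (0 < K)%R by exact: lt_le_trans K1.
have h1 : (rho (z - y) <= K * (r1 + r1))%R.
  have -> : (z - y = (z - x2) + (x2 - y))%R by rewrite addrA subrK.
  apply: (le_trans (hK _ _)); rewrite ler_pM2l// lerD//.
    by rewrite (qdist_sym hrho) ltW// (lt_le_trans z2).
  by rewrite ltW// (lt_le_trans y2).
have -> : (x1 - y = (x1 - z) + (z - y))%R by rewrite addrA subrK.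
apply: (le_lt_trans (hK _ _)).
apply: (@lt_le_trans _ _ (K * (r1 + K * (r1 + r1)))%R).
  by rewrite ltr_pM2l// ltr_leD.
have : (K * r1 <= K ^+ 2 * r1)%R by rewrite expr2 ler_pM2r// ler_peMl// ltW.
have -> : (K * (r1 + K * (r1 + r1)) = K * r1 + 2 * (K ^+ 2 * r1))%R by ring.
have -> : (3 * K ^+ 2 * r1 = K ^+ 2 * r1 + 2 * (K ^+ 2 * r1))%R by ring.
by rewrite lerD2r.
Qed.

Let seq_argmax (T : eqType) (f : T -> R) (s : seq T) : s <> [::] ->
  exists2 e, e \in s & forall e', e' \in s -> (f e' <= f e)%R.
Proof.
elim: s => // e s IH _; have [->|/eqP/IH [e1 e1s h1]] := eqVneq s [::].
  by exists e; rewrite ?inE// => e'; rewrite inE => /eqP ->.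
have [ee|ee] := leP (f e) (f e1).
  by exists e1 => [|e']; rewrite inE ?e1s ?orbT// => /predU1P[->//|]; exact: h1.
exists e => [|e']; rewrite inE ?eqxx// => /predU1P[->//|/h1 h].
exact: (le_trans h (ltW ee)).
Qed.

Definition seq_cover (s : seq (U * R)) : set U := \bigcup_(e in [set` s]) E e.1 e.2.

Lemma measurable_seq_cover s : measurable (seq_cover s).
Proof. exact: fin_bigcup_measurable. Qed.

(** Greedy selection as an induction: the ellipsoid of largest radius absorbs, after enlargement,
    all those that meet it, and the rest, disjoint from it, is a shorter list. Comparing integrals
    over the covers lets the disjoint subfamily remain implicit. *)
Lemma vitali_seq_cover : exists2 C : R, (0 < C)%R &
  forall (g : U -> \bar R) (l : R) (s : seq (U * R)),
  measurable_fun setT g -> (forall x, 0 <= g x) -> (0 <= l)%R ->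
  (forall e, e \in s -> (0 < e.2)%R /\
     (l * e.2 `^ gamma)%:E <= \int[mu]_(y in E e.1 e.2) g y) ->
  l%:E * mu (seq_cover s) <= C%:E * \int[mu]_(y in seq_cover s) g y.
Proof.
have [K K1 hK] := qdist_quasi_add hrho.
have c0 : (0 < 3 * K ^+ 2)%R by rewrite mulr_gt0// exprn_gt0// (lt_le_trans _ K1).
pose C := (unit_volume rho * (3 * K ^+ 2) `^ gamma)%R.
have C0 : (0 < C)%R by rewrite mulr_gt0 ?powR_gt0// (unit_volume_gt0 hrho trP).
exists C => // g l s mg g0 l0.
have [m] := ubnP (size s); elim: m s => // m IH s /ltnSE sm hs.
have [->|/eqP/(seq_argmax snd)[e1 e1s max1]] := eqVneq s [::].
  rewrite /seq_cover (_ : [set` [::]] = set0); last by apply/seteqP; split.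
  by rewrite bigcup_set0 measure0 integral_set0 !mule0.
pose disj (e : U * R) := `[< E e.1 e.2 `&` E e1.1 e1.2 = set0 >].
pose s2 := [seq e <- s | disj e].
have [r10 h1] := hs _ e1s.
have ss2 : (size s2 < size s)%N.
  rewrite size_filter -(count_predC disj s) -[ltnLHS]addn0 ltn_add2l -has_count.
  apply/hasP; exists e1 => //=; apply/asboolP; rewrite setIid => h.
  suff : E e1.1 e1.2 e1.1 by rewrite h.
  by rewrite /ellipsoid/= subrr (qdist0 hrho).
have /IH {}IH := leq_trans ss2 sm.
have cov : seq_cover s `<=` E e1.1 (3 * K ^+ 2 * e1.2) `|` seq_cover s2.
  move=> y [e /= es ye]; have [de|de] := boolP (disj e).
    by right; exists e => //=; rewrite mem_filter de.
  left; apply: (ellipsoid_engulf K1 hK r10 (max1 _ es)) ye.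
  by apply/set0P; apply: contra de => /eqP h; apply/asboolP.
have s2s : E e1.1 e1.2 `|` seq_cover s2 `<=` seq_cover s.
  move=> y [ye|[e /=]]; first by exists e1.
  by rewrite mem_filter => /andP[_ es] ye; exists e.
apply: (@le_trans _ _ (l%:E * (mu (E e1.1 (3 * K ^+ 2 * e1.2)) + mu (seq_cover s2)))).
  rewrite lee_wpmul2l ?lee_fin//.
  apply: (@le_trans _ _ (mu (E e1.1 (3 * K ^+ 2 * e1.2) `|` seq_cover s2))).
    apply: le_measure; rewrite ?inE//; first exact: measurable_seq_cover.
    by apply: measurableU => //; exact: measurable_seq_cover.
  by apply: measureU2 => //; exact: measurable_seq_cover.
rewrite ge0_muleDr//.
apply: (@le_trans _ _ (C%:E * \int[mu]_(y in E e1.1 e1.2) g y + C%:E * \int[mu]_(y in seq_cover s2) g y)).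
  apply: leeD; last by apply: IH => e; rewrite mem_filter => /andP[_]; exact: hs.
  rewrite (ellipsoid_measure hrho trP); last by rewrite mulr_gt0.
  rewrite -EFinM (powRM _ (ltW c0) (ltW r10)) [X in X%:E](_ : _ = C * (l * e1.2 `^ gamma))%R.
    by rewrite EFinM lee_pmul2l ?lte_fin.
  by rewrite /C; ring.
rewrite -ge0_muleDr ?integral_ge0//.
rewrite lee_pmul2l ?lte_fin//.
rewrite -ge0_integral_setU//; last 3 first.
- exact: measurable_seq_cover.
- exact: measurable_funTS.
- apply/disj_setPRL => y [e /=]; rewrite mem_filter => /andP[/asboolP de es] ye ye1.
  by have : (E e.1 e.2 `&` E e1.1 e1.2) y by []; rewrite de.
apply: ge0_subset_le_integral => //.
Qed.

Lemma seq_cover_lty s : (forall e, e \in s -> (0 < e.2)%R) -> mu (seq_cover s) < +oo.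
Proof.
elim: s => [_|e s IH hs].
  rewrite /seq_cover (_ : [set` [::]] = set0); last by apply/seteqP; split.
  by rewrite bigcup_set0 measure0.
have -> : seq_cover (e :: s) = E e.1 e.2 `|` seq_cover s.
  apply/seteqP; split => [x [f /=]|x [xe|[f /= fs xf]]].
  - by rewrite inE => /predU1P[->|fs] xf; [left|right; exists f].
  - by exists e => //=; rewrite inE eqxx.
  - by exists f => //=; rewrite inE fs orbT.
have h1 : mu (E e.1 e.2) < +oo.
  by rewrite (ellipsoid_measure hrho trP) ?ltry// hs// inE eqxx.
have h2 : mu (seq_cover s) < +oo by apply: IH => f fs; apply: hs; rewrite inE fs orbT.
apply: le_lt_trans (lte_add_pinfty h1 h2); apply: measureU2 => //.
exact: measurable_seq_cover.
Qed.

Section countable_family.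
Variable e : nat -> U * R.
Hypothesis e0 : forall i, (0 < (e i).2)%R.

Definition family_average (g : U -> \bar R) (i : nat) : \bar R :=
  ((e i).2 `^ (- gamma))%:E * \int[mu]_(y in E (e i).1 (e i).2) g y.

(** An uncentred maximal function over countably many ellipsoids: measurable as a countable supremum
    of step functions, with level sets that are increasing unions of finite covers. *)
Definition family_maximal (g : U -> \bar R) (x : U) : \bar R :=
  ereal_sup (range (fun i => if x \in E (e i).1 (e i).2 then family_average g i else 0)).

Let mem_family (g : U -> \bar R) (t : R) : (0 <= t)%R ->
  [set x | t%:E < family_maximal g x] =
  \bigcup_(i in [set i | t%:E < family_average g i]) E (e i).1 (e i).2.
Proof.
move=> t0; apply/seteqP; split => x /=.
  move=> /ereal_sup_gt[_ [i _ <-]]; case: ifPn => [|_]; last first.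
    by rewrite lte_fin ltNge t0.
  by rewrite inE => xi ti; exists i.
move=> [i /= ti xi]; apply: (lt_le_trans ti); apply: ereal_sup_ubound.
by exists i => //; rewrite mem_set.
Qed.

Lemma family_maximal_ge g x i : (forall y, 0 <= g y) -> E (e i).1 (e i).2 x ->
  family_average g i <= family_maximal g x.
Proof. by move=> g0 xi; apply: ereal_sup_ubound; exists i => //; rewrite mem_set. Qed.

Lemma family_maximal_ge0 g x : (forall y, 0 <= g y) -> 0 <= family_maximal g x.
Proof.
move=> g0; apply: (@le_trans _ _ (if x \in E (e 0%N).1 (e 0%N).2 then family_average g 0%N else 0)).
  by case: ifP => // _; rewrite mule_ge0 ?lee_fin ?powR_ge0// integral_ge0.
by apply: ereal_sup_ubound; exists 0%N.
Qed.

Lemma measurable_family_maximal g : measurable_fun setT (family_maximal g).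
Proof.
have -> : family_maximal g = fun x => ereal_sup
    [set (if x \in E (e k).1 (e k).2 then family_average g k else 0) | k in [set k | (0 <= k)%N]].
  apply/funext => x; rewrite /family_maximal; congr ereal_sup.
  by apply/seteqP; split => y [k _ <-]; exists k.
apply: measurable_fun_esups => i.
apply: measurable_fun_ifT => //.
apply: (measurable_fun_bool true).
rewrite setTI (_ : _ @^-1` _ = E (e i).1 (e i).2)//.
by apply/seteqP; split => y /= h; [exact: set_mem|exact: mem_set].
Qed.

(** The weak-type inequality in the refined form that sees only the large values of g; this form is
    what can be integrated in t. *)
Let family_maximal_weak (C : R) (g : U -> \bar R) (t : R) : (0 < C)%R ->
  (forall l s, (0 <= l)%R ->
    (forall e, e \in s -> (0 < e.2)%R /\
       (l * e.2 `^ gamma)%:E <= \int[mu]_(y in E e.1 e.2) g y) ->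
    l%:E * mu (seq_cover s) <= C%:E * \int[mu]_(y in seq_cover s) g y) ->
  measurable_fun setT g -> (forall x, 0 <= g x) -> (0 < t)%R ->
  mu [set x | t%:E < family_maximal g x] <=
  (2 * C / t)%:E * \int[mu]_(x in [set x | t%:E < (2 * C)%:E * g x]) g x.
Proof.
move=> C0 vitali mg g0 t0; rewrite mem_family; last exact: ltW.
set J := \int[mu]_(x in _) g x.
have J0 : 0 <= J by exact: integral_ge0.
pose s N := [seq e i | i <- iota 0 N & t%:E < family_average g i].
have s0 N f : f \in s N -> (0 < f.2)%R by move=> /mapP[i _ ->].
have mB : measurable [set x | t%:E < (2 * C)%:E * g x].
  rewrite -[X in measurable X]setTI; apply: measurable_lte => //.
  by apply: emeasurable_funM.
have cover N : mu (seq_cover (s N)) <= (2 * C / t)%:E * J.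
  set W := seq_cover (s N).
  have mW : measurable W by exact: measurable_seq_cover.
  have Wlty : mu W < +oo by apply: seq_cover_lty; exact: s0.
  have : t%:E * mu W <= C%:E * \int[mu]_(y in W) g y.
    apply: vitali; first exact: ltW.
    move=> f fs; split; first exact: s0 fs.
    move: fs => /mapP[i]; rewrite mem_filter => /andP[+ _] ->.
    rewrite /family_average => /ltW h.
    have rg : (0 < (e i).2 `^ gamma)%R by rewrite powR_gt0.
    rewrite EFinM muleC -(@lee_pmul2l _ ((e i).2 `^ (- gamma))%:E) ?lte_fin ?powR_gt0//.
    by rewrite -!EFinM [X in X%:E <= _]mulrA powRN mulVf ?gt_eqF// mul1r -powRN.
  (* Where 2Cg <= t, the integrand is at most t / (2C), so this part costs half of [t%:E * mu W]. It
     is absorbed on the left because finite covers have finite measure. *)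
  have split_le : C%:E * \int[mu]_(y in W) g y <= C%:E * J + (t / 2)%:E * mu W.
    rewrite -[in leLHS](setUIDK W [set x | t%:E < (2 * C)%:E * g x]).
    rewrite ge0_integral_setU//; last 4 first.
    - exact: measurableI.
    - exact: measurableD.
    - exact: measurable_funTS.
    - by apply/disj_setPS => x [[_ ?] [_ ?]].
    rewrite ge0_muleDr ?integral_ge0//; apply: leeD.
      rewrite lee_pmul2l ?lte_fin//; by apply: ge0_subset_le_integral => //.
    apply: (@le_trans _ _ (C%:E * \int[mu]_(y in W) (t / 2 / C)%:E)).
      rewrite lee_pmul2l ?lte_fin//; apply: ge0_subset_le_integral => //.
      - by move=> x _; rewrite lee_fin !divr_ge0// ltW.
      - move=> x [_ /= /negP]; rewrite -leNgt => h.
        rewrite -(@lee_pmul2l _ (2 * C)%:E) ?lte_fin ?mulr_gt0// (le_trans h)//.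
        by rewrite -EFinM lee_fin le_eqVlt; apply/orP; left; apply/eqP; field; rewrite gt_eqF.
    rewrite integral_cst// muleA -EFinM lee_wpmul2r// lee_fin.
    by rewrite mulrC divfK// gt_eqF.
  move=> /le_trans/(_ split_le).
  have : 0 <= mu W by [].
  clear split_le; move: Wlty J0; case: (mu W) => // m _; clearbody J; case: J => [j| |//].
    rewrite !lee_fin => j0 m0 h.
    rewrite mulrAC ler_pdivlMr//.
    have -> : (m * t = t * m)%R by rewrite mulrC.
    by lra.
  by move=> _ _ _; rewrite gt0_muley ?leey// lte_fin divr_gt0// mulr_gt0.
have nds : nondecreasing_seq (fun N => seq_cover (s N)).
  apply/nondecreasing_seqP => N; apply/subsetPset => x [f /= fs xf]; exists f => //=.
  by rewrite /s -(addn1 N) iotaD filter_cat map_cat mem_cat fs.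
have Us : \bigcup_(i in [set i | t%:E < family_average g i]) E (e i).1 (e i).2 =
    \bigcup_N seq_cover (s N).
  apply/seteqP; split => x [i].
    move=> /= ti xi; exists i.+1 => //; exists (e i) => //=.
    by apply: map_f; rewrite mem_filter ti mem_iota /= ltnS.
  move=> _ [f /= /mapP[j]]; rewrite mem_filter => /andP[tj _] -> xf.
  by exists j.
rewrite Us.
have mU : measurable (\bigcup_N seq_cover (s N)).
  by apply: bigcupT_measurable => N; exact: measurable_seq_cover.
have cU := nondecreasing_cvg_mu (mu := mu) (fun N => measurable_seq_cover (s N)) mU nds.
rewrite -(cvg_lim _ cU)//; apply: lime_le; first by apply/cvg_ex; eexists; exact: cU.
by apply: nearW => N; exact: cover.
Qed.

Let poweR_split (r : R) (y : \bar R) : (1 < r)%R -> 0 <= y -> y `^ r = y * y `^ (r - 1).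
Proof.
move=> r1; have r0 : (0 < r)%R by exact: lt_trans r1.
case: y => [y| |//]; last by rewrite !poweRyr ?gt_eqF ?subr_gt0// mulyy.
rewrite lee_fin => y0; rewrite !poweR_EFin -EFinM; congr EFin.
have -> : (y `^ r = y `^ (1 + (r - 1)))%R by congr (_ `^ _)%R; ring.
have h1 : ((1 + (r - 1))%R == 0%R :> R) = false.
  by have -> : (1 + (r - 1) = r)%R by [ring]; rewrite gt_eqF.
by rewrite (@powRD _ y 1%R (r - 1)%R) ?h1// powRr1.
Qed.

(** Marcinkiewicz interpolation: the weak bound is inserted into the layer cake formula of the
    maximal function, and the result is the layer cake formula of G = 2Cg with weight G and exponent
    r - 1. *)
Lemma family_maximal_strong (r : R) : (1 < r)%R -> exists2 A : R, (0 < A)%R &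
  forall g, measurable_fun setT g -> (forall x, 0 <= g x) ->
  \int[mu]_x family_maximal g x `^ r <= A%:E * \int[mu]_x g x `^ r.
Proof.
move=> r1; have [C C0 vitali] := vitali_seq_cover.
have r0 : (0 < r)%R by exact: lt_trans r1.
have r10 : (0 < r - 1)%R by rewrite subr_gt0.
have C20 : (0 < 2 * C)%R by rewrite mulr_gt0.
exists (r * ((2 * C) `^ r / (r - 1)))%R.
  by rewrite !mulr_gt0 ?powR_gt0 ?invr_gt0.
move=> g mg g0.
have M0 x : 0 <= family_maximal g x by exact: family_maximal_ge0.
have mM := measurable_family_maximal g.
have mMr : measurable_fun setT (fun x => family_maximal g x `^ r).
  exact: (measurableT_comp (measurable_poweR _)).
pose G x := (2 * C)%:E * g x.
have mG : measurable_fun setT G by apply: emeasurable_funM.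
have G0 x : 0 <= G x by rewrite mule_ge0// lee_fin ltW.
have mgr : measurable_fun setT (fun x => g x `^ r).
  exact: (measurableT_comp (measurable_poweR _)).
have lc1 := @layer_cake R _ _ (lebesgue_cV n) (cst 1) _ (measurable_cst 1) mM (fun=> lee01) M0 r r0.
have lc2 := @layer_cake R _ _ (lebesgue_cV n) G _ mG mG G0 G0 (r - 1)%R r10.
have e1 : \int[mu]_x family_maximal g x `^ r =
    r%:E * \int[mu]_x (cst 1 x * (family_maximal g x `^ r * (r^-1)%:E)).
  rewrite -ge0_integralZl//; last 3 first.
  - by apply: emeasurable_funM => //; apply: emeasurable_funM.
  - by move=> x _; rewrite mul1e mule_ge0 ?poweR_ge0// lee_fin invr_ge0 ltW.
  - by rewrite lee_fin ltW.
  apply: eq_integral => x _; rewrite mul1e muleCA -EFinM divff ?mule1//.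
  by rewrite gt_eqF.
rewrite e1 lc1 EFinM -muleA lee_pmul2l ?lte_fin//.
have e2 : ((2 * C) `^ r / (r - 1))%:E * \int[mu]_x g x `^ r =
    \int[mu]_x (G x * (G x `^ (r - 1) * ((r - 1)^-1)%:E)).
  rewrite -ge0_integralZl//; last 2 first.
  - by move=> x _; rewrite poweR_ge0.
  - by rewrite lee_fin mulr_ge0 ?powR_ge0// invr_ge0 ltW.
  apply: eq_integral => x _.
  rewrite [RHS]muleA -poweR_split// /G poweRM//; last by rewrite lee_fin ltW.
  by rewrite poweR_EFin EFinM muleAC.
rewrite e2 lc2; apply: ge0_subset_le_integral => //.
- by move=> t _; rewrite mule_ge0 ?lee_fin ?powR_ge0// integral_ge0.
- by move=> t _; rewrite mule_ge0 ?lee_fin ?powR_ge0// integral_ge0.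
- move=> t; rewrite /= in_itv/= andbT => t0.
  have mB : measurable [set x | t%:E < G x].
    by rewrite -[X in measurable X]setTI; apply: measurable_lte.
  rewrite integral_cst; last first.
    by rewrite -[X in measurable X]setTI; apply: measurable_lte.
  rewrite mul1e.
  have -> : (t `^ (r - 1) = t `^ (r - 1 - 1) * t)%R.
    rewrite -[X in (_ * X)%R](powRr1 (ltW t0)) -powRD; last first.
      by apply/implyP => _; rewrite gt_eqF.
    by congr (_ `^ _)%R; ring.
  rewrite EFinM -muleA lee_wpmul2l ?lee_fin ?powR_ge0//.
  have h := @family_maximal_weak C g t C0 (fun l s => vitali g l s mg g0) mg g0 t0.
  apply: (@le_trans _ _ (t%:E * ((2 * C / t)%:E * \int[mu]_(x in [set x | t%:E < G x]) g x))).
    by rewrite lee_pmul2l ?lte_fin.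
  rewrite muleA -EFinM ge0_integralZl//; last 2 first.
  - exact: measurable_funTS.
  - by rewrite lee_fin ltW.
  by rewrite mulrCA divff ?mulr1// gt_eqF.
Qed.

End countable_family.

End maximal_function.

Section rational_family.
Context {R : realType} (n : nat) (P : 'M[R]_n) (rho : 'cV[R]_n -> R).
Hypothesis hrho : quasi_distance P rho.
Hypothesis trP : 0 < \tr P.
Local Notation U := 'cV[R]_n.
Local Notation mu := (lebesgue_cV n : {measure set U -> \bar R}).
Local Notation gamma := (\tr P).
Local Open Scope ereal_scope.

(** Indices that decode to nothing, and rationals that are not positive, get radius 1, so that every
    member is a genuine ellipsoid. *)
Definition rational_family (i : nat) : U * R :=
  if unpickle i is Some (q, r) then
    (map_mx ratr (q : 'cV[rat]_n), if (0 < ratr (r : rat) :> R)%R then ratr r else 1%R)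
  else (0, 1)%R.

Lemma rational_family_gt0 i : (0 < (rational_family i).2)%R.
Proof.
rewrite /rational_family; case: (unpickle i) => [[q r]|] /=; last exact: ltr01.
by case: ifPn => // _; exact: ltr01.
Qed.

(** A rational centre at [rho]-distance less than t from x and a rational radius between 2Kt and 4Kt
    give a member containing both x and E(x, t); the larger radius costs (4K)^gamma. *)
Lemma family_dominates : exists2 D : R, (0 < D)%R &
  forall (g : U -> \bar R) x t, (forall y, 0 <= g y) -> (0 < t)%R ->
  (t `^ (- gamma))%:E * \int[mu]_(y in ellipsoid rho x t) g y <=
  D%:E * family_maximal P rho rational_family g x.
Proof.
have [K K1 hK] := qdist_quasi_add hrho.
have K0 : (0 < K)%R by apply: lt_le_trans K1.
have K40 : (0 < 4 * K)%R by rewrite mulr_gt0.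
exists ((4 * K) `^ gamma)%R; first by rewrite powR_gt0.
move=> g x t g0 t0.
have [d d0 hd] := qdist_small hrho t0.
have [q hq] := dense_rat_cV x d0.
have xq := hd _ hq.
have [r] : exists r : rat, ratr r \in `](2 * K * t)%R, (4 * K * t)%R[.
  by apply: rat_in_itvoo; rewrite ltr_pM2r// ltr_pM2r// ltr_nat.
rewrite in_itv/= => /andP[r1 r2].
have r0 : (0 < ratr r :> R)%R by apply: lt_trans r1; rewrite !mulr_gt0.
pose i := pickle (q, r).
have ei : rational_family i = (map_mx ratr q, ratr r).
  by rewrite /rational_family /i pickleK r0.
have tr : (t <= ratr r)%R.
  apply: ltW; apply: le_lt_trans r1.
  by rewrite ler_peMl ?(ltW t0)// (le_trans K1)// ler_peMl ?(ltW K0)// ler1n.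
have xE : ellipsoid rho (rational_family i).1 (rational_family i).2 x.
  by rewrite ei /ellipsoid/= (qdist_sym hrho) (lt_le_trans xq).
have sub : ellipsoid rho x t `<=` ellipsoid rho (rational_family i).1 (rational_family i).2.
  move=> y; rewrite ei /ellipsoid/= => yt.
  have -> : (map_mx ratr q - y = (map_mx ratr q - x) + (x - y))%R by rewrite addrA subrK.
  apply: le_lt_trans r1; apply: (le_trans (hK _ _)).
  rewrite (qdist_sym hrho) (mulrC 2%R) -mulrA ler_pM2l// mulr_natl mulr2n.
  by rewrite lerD// ltW.
apply: (@le_trans _ _ (((4 * K) `^ gamma)%:E * family_average P rho rational_family g i)); last first.
  by rewrite lee_pmul2l ?lte_fin ?powR_gt0//; exact: family_maximal_ge.
rewrite /family_average ei/= in sub *.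
rewrite muleA; apply: lee_pmul.
- by rewrite lee_fin powR_ge0.
- exact: integral_ge0.
- rewrite -EFinM lee_fin !powRN ler_pdivlMr ?powR_gt0// mulrC ler_pdivrMr ?powR_gt0//.
  rewrite -(powRM _ (ltW K40) (ltW t0)).
  apply: ge0_ler_powR; rewrite ?nnegrE; [exact: ltW|exact: ltW| |exact: ltW].
  by rewrite mulr_ge0// ltW.
- exact: ge0_subset_le_integral.
Qed.

End rational_family.

(** * Hoelder's inequality for extended-real functions *)

Section hoelder_ereal.
Local Open Scope ereal_scope.
Context d (T : measurableType d) {R : realType}.
Variable mu : {measure set T -> \bar R}.

Lemma le_poweR (r : R) (x y : \bar R) : (0 <= r)%R -> 0 <= x -> x <= y -> x `^ r <= y `^ r.
Proof.
move=> r0 x0 xy; apply: gt0_ler_poweR => //; rewrite in_itv/= leey andbT//.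
exact: le_trans xy.
Qed.

(** A is a positive bound rather than the integral itself, so an infinite second factor makes the
    right side +oo instead of 0. If that factor is finite, G is finite almost everywhere and the
    real inequality applies. *)
Lemma hoelder_ereal (F : T -> R) (G : T -> \bar R) (s u A : R) :
  (0 < s)%R -> (0 < u)%R -> (s^-1 + u^-1 = 1)%R ->
  measurable_fun setT F -> measurable_fun setT G ->
  (forall x, 0 <= F x)%R -> (forall x, 0 <= G x) -> (0 < A)%R ->
  \int[mu]_x (F x `^ s)%:E <= A%:E ->
  \int[mu]_x ((F x)%:E * G x) <= (A `^ s^-1)%:E * (\int[mu]_x (G x `^ u)) `^ u^-1.
Proof.
move=> s0 u0 su mF mG F0 G0 A0 FA.
have u10 : (u^-1 != 0)%R by rewrite invr_eq0 gt_eqF.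
have As : (0 < A `^ s^-1)%R by rewrite powR_gt0.
have mGu : measurable_fun setT (fun x => G x `^ u).
  exact: (measurableT_comp (measurable_poweR _)).
have [Goo|Goo] := eqVneq (\int[mu]_x (G x `^ u)) +oo.
  by rewrite Goo poweRyr// gt0_muley ?leey// lte_fin.
have Gint : mu.-integrable setT (fun x => G x `^ u).
  apply/integrableP; split => //.
  under eq_integral => x _ do rewrite gee0_abs ?poweR_ge0//.
  by rewrite ltey.
have Gfin : {ae mu, forall x, setT x -> G x = (fine (G x))%:E}.
  have := integrable_ae measurableT Gint; apply: filterS => x /= + _ => /(_ I).
  by case: (G x) (G0 x) => [y| |]; rewrite ?poweRyr ?gt_eqF.
have mg : measurable_fun setT (fine \o G) by exact: (measurableT_comp (fine_measurable measurableT)).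
have -> : \int[mu]_x ((F x)%:E * G x) = 'N[mu]_1[EFin \o (F \* (fine \o G))%R].
  rewrite Lnorm1; apply: ge0_ae_eq_integral => //.
  - by apply: emeasurable_funM => //; exact/measurable_EFinP.
  - by apply: measurableT_comp => //; apply/measurable_EFinP; exact: measurable_funM.
  - by move=> x _; rewrite mule_ge0// lee_fin.
  - apply: filterS Gfin => x /(_ I) Gx _; rewrite {1}Gx /= -EFinM ger0_norm// mulr_ge0//.
    exact: fine_ge0.
apply: (le_trans (hoelder _ mF mg s0 u0 su)).
have s10 : (0 <= s^-1)%R by rewrite invr_ge0 ltW.
have u1_ge0 : (0 <= u^-1)%R by rewrite invr_ge0 ltW.
rewrite !Lnorm.unlock; apply: lee_pmul; [exact: poweR_ge0|exact: poweR_ge0| |].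
  rewrite -poweR_EFin; apply: le_poweR => //.
    by apply: integral_ge0 => x _; exact: poweR_ge0.
  apply: le_trans FA; rewrite le_eqVlt; apply/orP; left; apply/eqP.
  by apply: eq_integral => x _; rewrite /= ger0_norm.
apply: le_poweR => //; first by apply: integral_ge0 => x _; exact: poweR_ge0.
apply: ge0_subset_le_integral => // [x _|x _|x _]; rewrite ?poweR_ge0//=.
rewrite -poweR_EFin; apply: le_poweR; [exact: ltW|by rewrite lee_fin|].
by case: (G x) (G0 x) => [y|_|//]; rewrite ?leey//= !lee_fin => y0; rewrite ger0_norm.
Qed.

Lemma hoelder_ereal_on (D : set T) (F : T -> R) (G : T -> \bar R) (s u A : R) :
  measurable D -> (0 < s)%R -> (0 < u)%R -> (s^-1 + u^-1 = 1)%R ->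
  measurable_fun setT F -> measurable_fun setT G ->
  (forall x, 0 <= F x)%R -> (forall x, 0 <= G x) -> (0 < A)%R ->
  \int[mu]_(x in D) (F x `^ s)%:E <= A%:E ->
  \int[mu]_(x in D) ((F x)%:E * G x) <=
  (A `^ s^-1)%:E * (\int[mu]_(x in D) (G x `^ u)) `^ u^-1.
Proof.
move=> mD s0 u0 su mF mG F0 G0 A0 FA.
have FD0 x : (0 <= (F \_ D) x)%R by rewrite patchE; case: ifPn.
have GD0 x : 0 <= (G \_ D) x by exact: erestrict_ge0.
have mFD : measurable_fun setT (F \_ D).
  by apply/(measurable_restrictT _ _).1 => //; exact: measurable_funTS.
have mGD : measurable_fun setT (G \_ D).
  by apply/(measurable_restrictT _ _).1 => //; exact: measurable_funTS.
have FDs : \int[mu]_(x in D) (F x `^ s)%:E = \int[mu]_x ((F \_ D) x `^ s)%:E.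
  rewrite integral_mkcond; apply: eq_integral => x _; rewrite !patchE.
  by case: ifPn => // _; rewrite powR0 ?gt_eqF.
have GDu : \int[mu]_(x in D) (G x `^ u) = \int[mu]_x ((G \_ D) x `^ u).
  rewrite integral_mkcond; apply: eq_integral => x _; rewrite !patchE.
  by case: ifPn => // _; rewrite poweR0r ?gt_eqF.
have FGD : \int[mu]_(x in D) ((F x)%:E * G x) = \int[mu]_x (((F \_ D) x)%:E * (G \_ D) x).
  rewrite integral_mkcond; apply: eq_integral => x _; rewrite !patchE.
  by case: ifPn => // _; rewrite mule0.
rewrite FDs in FA.
by rewrite FGD GDu; exact: (hoelder_ereal s0 u0 su mFD mGD FD0 GD0 A0 FA).
Qed.

End hoelder_ereal.

(** * Interpolation of the averages *)

Section rough_kernels.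
Context {R : realType} (n : nat) (P : 'M[R]_n) (rho : 'cV[R]_n -> R).
Hypothesis hrho : quasi_distance P rho.
Hypothesis trP : 0 < \tr P.
Local Notation U := 'cV[R]_n.
Local Notation mu := (lebesgue_cV n : {measure set U -> \bar R}).
Local Notation gamma := (\tr P).
Local Notation E := (ellipsoid rho).
Local Open Scope ereal_scope.
Variables (alpha p q : R).
Hypotheses (alpha0 : (0 < alpha)%R) (alphag : (alpha < gamma)%R).
Hypotheses (p0 : (0 < p)%R) (pq : (p < q)%R).

Let q0 : (0 < q)%R. Proof. exact: lt_trans pq. Qed.
Let qp0 : (0 < q - p)%R. Proof. by rewrite subr_gt0. Qed.
(** b is the decay exponent of the averages and [th] the interpolation weight; [ath] is the relation
    between them that cancels the powers of t. *)
Let b : R := (alpha * q / (q - p))%R.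
Let th : R := (p / q)%R.
Let b0 : (0 < b)%R. Proof. by rewrite divr_gt0// mulr_gt0. Qed.
Let ab : (alpha < b)%R.
Proof. by rewrite /b ltr_pdivlMr// ltr_pM2l// gtrBl. Qed.
Let th0 : (0 < th)%R. Proof. by rewrite divr_gt0. Qed.
Let th1 : (0 < 1 - th)%R. Proof. by rewrite subr_gt0 ltr_pdivrMr// mul1r. Qed.
Let ath : (alpha = b * (1 - th))%R.
Proof. by rewrite /b /th; field; rewrite !gt_eqF. Qed.

Let powR_interp (A B t : R) : (0 <= A)%R -> (0 <= B)%R -> (0 < t)%R ->
  ((t `^ alpha * A) `^ th * (B * t `^ (alpha - b)) `^ (1 - th) = A `^ th * B `^ (1 - th))%R.
Proof.
move=> A0 B0 t0; rewrite (powRM _ (powR_ge0 _ _) A0) (powRM _ B0 (powR_ge0 _ _)).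
rewrite -!powRrM.
have -> : (t `^ (alpha * th) * A `^ th * (B `^ (1 - th) * t `^ ((alpha - b) * (1 - th))) =
  t `^ (alpha * th) * t `^ ((alpha - b) * (1 - th)) * (A `^ th * B `^ (1 - th)))%R by ring.
rewrite -powRD; last by apply/implyP => _; rewrite gt_eqF.
have -> : (alpha * th + (alpha - b) * (1 - th) = 0)%R by rewrite {1 2}ath; ring.
by rewrite powRr0 mul1r.
Qed.

(** X = X^th X^(1 - th), with one of the two bounds used in each factor. *)
Lemma maximal_interpolation (X t : R) (A : \bar R) (B : R) : (0 <= X)%R -> (0 < t)%R ->
  0 <= A -> (0 <= B)%R ->
  X%:E <= (t `^ alpha)%:E * A -> (X <= B * t `^ (alpha - b))%R ->
  X%:E <= A `^ th * (B `^ (1 - th))%:E.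
Proof.
move=> X0 t0; case: A => [A| |//]; last first.
  (* With A infinite the right side is +oo unless B = 0, where the convention for 0 times +oo makes
     it 0; but then X = 0 too. *)
  move=> _ B0 _ XB; rewrite poweRyr ?gt_eqF//.
  move: B0 XB; rewrite le_eqVlt => /predU1P[<-|B0 XB].
    rewrite mul0r => X00; have -> : X = 0%R by apply/eqP; rewrite eq_le X00.
    by rewrite powR0 ?gt_eqF// mule0.
  by rewrite gt0_mulye ?leey// lte_fin powR_gt0.
rewrite poweR_EFin -!EFinM !lee_fin => A0 B0 XA XB.
rewrite -(powR_interp A0 B0 t0).
have [->|Xn0] := eqVneq X 0%R; first by rewrite mulr_ge0 ?powR_ge0.
have {1}-> : (X = X `^ th * X `^ (1 - th))%R.
  rewrite -powRD; last by apply/implyP => _.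
  by rewrite addrC subrK powRr1.
apply: ler_pM; rewrite ?powR_ge0//; apply: ge0_ler_powR; rewrite ?nnegrE ?(ltW th0) ?(ltW th1)//.
  exact: le_trans XA.
exact: le_trans XB.
Qed.

(** Level t of 1 / rho(x - .) lies in E(x, 1/t), so the potential becomes an integral over t of
    averages. Small t, that is large ellipsoids, are handled by the decay bound B, large t by A. *)
Lemma potential_interpolation : exists2 C : R, (0 < C)%R &
  forall (w : U -> \bar R) (x : U) (A : \bar R) (B : R),
  measurable_fun setT w -> (forall y, 0 <= w y) -> 0 <= A -> (0 <= B)%R ->
  (forall t, (0 < t)%R -> \int[mu]_(y in E x t) w y <= (t `^ gamma)%:E * A) ->
  (forall t, (0 < t)%R -> \int[mu]_(y in E x t) w y <= (B * t `^ (gamma - b))%:E) ->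
  \int[mu]_y (w y * ((rho (x - y))^-1 `^ (gamma - alpha))%:E) <=
  C%:E * (A `^ th * (B `^ (1 - th))%:E).
Proof.
pose a := (gamma - alpha)%R.
have a0 : (0 < a)%R by rewrite subr_gt0.
(* In C the factor a undoes the normalisation of the layer cake formula; 1 / (b - alpha) and 1 /
   alpha come from the power integrals below and above the balancing level [tau]. *)
have ba0 : (0 < b - alpha)%R by rewrite subr_gt0.
pose C := (a * ((b - alpha)^-1 + alpha^-1))%R.
have C0 : (0 < C)%R by rewrite mulr_gt0// addr_gt0// invr_gt0.
exists C => // w x A B mw w0 A0 B0 hA hB.
pose h (y : U) : \bar R := ((rho (x - y))^-1)%:E.
have h0 y : 0 <= h y by rewrite lee_fin invr_ge0 (qdist_ge0 hrho).
have mrho : measurable_fun setT (fun y : U => rho (x - y)).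
  by apply: (measurableT_comp (qdist_measurable hrho)); exact: measurable_subcV.
have mh : measurable_fun setT h.
  apply/measurable_EFinP; rewrite (_ : (fun _ => _) = (fun y : U => rho (x - y) `^ (- 1))%R).
    by apply: (measurableT_comp (measurable_powR _)).
  by apply/funext => y; rewrite powR_inv1// (qdist_ge0 hrho).
have lc := @layer_cake R _ _ (lebesgue_cV n) w h mw mh w0 h0 a a0.
have J_eq : \int[mu]_y (w y * ((rho (x - y))^-1 `^ a)%:E) =
    a%:E * \int[mu]_y (w y * (h y `^ a * (a^-1)%:E)).
  rewrite -ge0_integralZl//.
  - apply: eq_integral => y _; rewrite /h poweR_EFin [in RHS]muleCA -!EFinM.
    by congr (_ * _%:E); rewrite mulrCA divff ?mulr1 ?gt_eqF.
  - by do 2!apply: emeasurable_funM => //; exact: (measurableT_comp (measurable_poweR _)).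
  - by move=> y _; rewrite !mule_ge0 ?poweR_ge0// lee_fin invr_ge0 ltW.
  - by rewrite lee_fin ltW.
have sub t : (0 < t)%R -> [set y | t%:E < h y] `<=` E x t^-1.
  move=> t0 y /=; rewrite /h lte_fin /ellipsoid/= => ht.
  have r0 : (0 < rho (x - y))%R by rewrite -invr_gt0 (lt_trans t0).
  by rewrite -[ltLHS]invrK ltf_pV2 ?posrE ?invr_gt0.
have inner t (t0 : (0 < t)%R) : \int[mu]_(y in [set y | t%:E < h y]) w y <= \int[mu]_(y in E x t^-1) w y.
  by apply: ge0_subset_le_integral => //; exact: sub.
(* Treats A = 0 and B = 0, where the balancing level would degenerate. *)
have zero : (forall t, (0 < t)%R -> \int[mu]_(y in E x t) w y <= 0) ->
    \int[mu]_y (w y * ((rho (x - y))^-1 `^ a)%:E) <= 0.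
  move=> hz; rewrite J_eq lc integral0_eq ?mule0// => t; rewrite /= in_itv/= andbT => t0.
  have : \int[mu]_(y in [set y | t%:E < h y]) w y <= 0.
    by apply: le_trans (inner t t0) (hz _ _); rewrite invr_gt0.
  move=> hz0; have -> : \int[mu]_(y in [set y | t%:E < h y]) w y = 0.
    by apply/eqP; rewrite eq_le hz0 integral_ge0.
  by rewrite mule0.
have R0 : 0 <= C%:E * (A `^ th * (B `^ (1 - th))%:E).
  by rewrite !mule_ge0 ?poweR_ge0 ?lee_fin ?powR_ge0 ?(ltW C0).
have [B00|Bn0] := eqVneq B 0%R.
  apply: le_trans (zero _) R0 => t t0; apply: (le_trans (hB t t0)).
  by rewrite B00 mul0r.
have Bgt : (0 < B)%R by rewrite lt_neqAle eq_sym Bn0.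
case: A A0 hA R0 => [A| |//] A0 hA R0; last first.
  rewrite poweRyr ?gt_eqF// gt0_mulye ?lte_fin ?powR_gt0// gt0_muley ?lte_fin//.
  exact: leey.
rewrite lee_fin in A0.
have [A00|An0] := eqVneq A 0%R.
  apply: le_trans (zero _) R0 => t t0; apply: (le_trans (hA t t0)).
  by rewrite A00 mule0.
have Agt : (0 < A)%R by rewrite lt_neqAle eq_sym An0.
(* At [t = 1 / tau] the two bounds on the averages coincide. *)
pose tau := ((A / B) `^ b^-1)%R.
have tau0 : (0 < tau)%R by rewrite powR_gt0// divr_gt0.
pose k1 (t : R) := (B * t `^ (b - alpha - 1))%:E.
pose k2 (t : R) := (A * t `^ (- alpha - 1))%:E.
have k10 t : 0 <= k1 t by rewrite lee_fin mulr_ge0 ?powR_ge0.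
have k20 t : 0 <= k2 t by rewrite lee_fin mulr_ge0 ?powR_ge0.
have mk1 : measurable_fun setT k1.
  by apply/measurable_EFinP; apply: measurable_funM => //; exact: measurable_powR.
have mk2 : measurable_fun setT k2.
  by apply/measurable_EFinP; apply: measurable_funM => //; exact: measurable_powR.
rewrite J_eq lc.
pose k (t : R) := (k1 \_ `]0%R, tau[) t + (k2 \_ `[tau, +oo[) t.
have J_le : \int[lebesgue_measure]_(t in `]0%R, +oo[)
    ((t `^ (a - 1))%:E * \int[mu]_(y in [set y | t%:E < h y]) w y) <=
    \int[lebesgue_measure]_t k t.
  apply: ge0_subset_le_integral => //.
  - by move=> t _; rewrite mule_ge0 ?lee_fin ?powR_ge0// integral_ge0.
  - by move=> t _; rewrite adde_ge0//; apply: erestrict_ge0.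
  - move=> t; rewrite /= in_itv/= andbT => t0.
    have ti0 : (0 < t^-1)%R by rewrite invr_gt0.
    have invE e : (t^-1 `^ e = t `^ (- e))%R.
      by rewrite -powR_inv1 ?ltW// -powRrM mulN1r.
    have tD c1 c2 : (t `^ c1 * t `^ c2 = t `^ (c1 + c2))%R.
      by rewrite powRD//; apply/implyP => _; rewrite gt_eqF.
    rewrite /k !patchE !mem_setE !in_itv/= t0 andbT /=.
    case: ltP => [ttau|ttau].
      rewrite adde0.
      apply: (@le_trans _ _ ((t `^ (a - 1))%:E * (B * t^-1 `^ (gamma - b))%:E)).
        by rewrite lee_wpmul2l ?lee_fin ?powR_ge0// (le_trans (inner t t0))// hB.
      rewrite -EFinM lee_fin invE mulrCA tD ler_pM2l//.
      by rewrite le_eqVlt; apply/orP; left; apply/eqP; congr (_ `^ _)%R; rewrite /a; ring.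
    rewrite add0e.
    apply: (@le_trans _ _ ((t `^ (a - 1))%:E * ((t^-1 `^ gamma)%:E * A%:E))).
      by rewrite lee_wpmul2l ?lee_fin ?powR_ge0// (le_trans (inner t t0))// hA.
    rewrite muleA -!EFinM lee_fin invE tD mulrC ler_pM2l//.
    by rewrite le_eqVlt; apply/orP; left; apply/eqP; congr (_ `^ _)%R; rewrite /a; ring.
have K_le : \int[lebesgue_measure]_t k t <=
   (B * (tau `^ (b - alpha) / (b - alpha)))%:E + (A * (tau `^ (- alpha) / alpha))%:E.
  rewrite ge0_integralD//; last 4 first.
  - by move=> t _; apply: erestrict_ge0.
  - by apply/(measurable_restrictT _ _).1 => //; exact: measurable_funTS.
  - by move=> t _; apply: erestrict_ge0.
  - by apply/(measurable_restrictT _ _).1 => //; exact: measurable_funTS.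
  rewrite -!integral_mkcond; apply: leeD.
    rewrite /k1; under eq_integral do rewrite EFinM.
    rewrite ge0_integralZl//; last 2 first.
    - by apply: measurable_funTS; apply/measurable_EFinP; exact: measurable_powR.
    - by move=> t _; rewrite lee_fin powR_ge0.
    by rewrite integral_powR_0.
  rewrite /k2; under eq_integral do rewrite EFinM.
  rewrite ge0_integralZl//; last 2 first.
  - by apply: measurable_funTS; apply/measurable_EFinP; exact: measurable_powR.
  - by move=> t _; rewrite lee_fin powR_ge0.
  by rewrite [leRHS]EFinM lee_pmul2l ?lte_fin// integral_powR_tail.
apply: (@le_trans _ _ (a%:E *
  ((B * (tau `^ (b - alpha) / (b - alpha)))%:E + (A * (tau `^ (- alpha) / alpha))%:E))).
  by rewrite lee_pmul2l ?lte_fin//; exact: le_trans K_le.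
rewrite poweR_EFin -EFinD -!EFinM lee_fin.
have AB0 : (0 < A / B)%R by rewrite divr_gt0.
have e1 : (tau `^ (b - alpha) = (A / B) `^ th)%R.
  rewrite /tau -powRrM; congr (_ `^ _)%R; rewrite ath; field; rewrite gt_eqF//.
have e2 : (tau `^ (- alpha) = (A / B) `^ (th - 1))%R.
  rewrite /tau -powRrM; congr (_ `^ _)%R; rewrite ath; field; rewrite gt_eqF//.
have BD c1 c2 : (B `^ c1 * B `^ c2 = B `^ (c1 + c2))%R.
  by rewrite powRD//; apply/implyP => _.
have AD c1 c2 : (A `^ c1 * A `^ c2 = A `^ (c1 + c2))%R.
  by rewrite powRD//; apply/implyP => _.
have iB c : (B^-1 `^ c = B `^ (- c))%R by rewrite -powR_inv1// -powRrM mulN1r.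
have iB0 : (0 <= B^-1)%R by rewrite invr_ge0.
have f1 : (B * (A / B) `^ th = A `^ th * B `^ (1 - th))%R.
  rewrite powRM// iB mulrCA -[X in (_ * (X * _) = _)%R](powRr1 B0) BD.
  by congr (_ * _)%R; congr (_ `^ _)%R; ring.
have f2 : (A * (A / B) `^ (th - 1) = A `^ th * B `^ (1 - th))%R.
  rewrite powRM// iB mulrA -[X in (X * _ * _ = _)%R](powRr1 A0) AD opprB.
  by congr (_ * _)%R; congr (_ `^ _)%R; ring.
rewrite e1 e2 !mulrA f1 f2 /C.
by rewrite le_eqVlt; apply/orP; left; apply/eqP; rewrite -!mulrA; ring.
Qed.

End rough_kernels.

(** * Measurability of the two operators *)

Section rough_operators.
Context {R : realType} (n : nat) (P : 'M[R]_n) (rho : 'cV[R]_n -> R).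
Hypothesis hrho : quasi_distance P rho.
Hypothesis trP : 0 < \tr P.
Local Notation U := 'cV[R]_n.
Local Notation mu := (lebesgue_cV n : {measure set U -> \bar R}).
Local Notation gamma := (\tr P).
Local Notation E := (ellipsoid rho).
Local Open Scope ereal_scope.
Variables (Omega : U -> R) (alpha : R).
Hypothesis mOmega : measurable_fun setT Omega.
Hypothesis alphag : (alpha < gamma)%R.

Definition kernel_integral (f : U -> \bar R) (x : U) (t : R) : \bar R :=
  \int[mu]_(y in E x t) (`|Omega (x - y)%R|%:E * `|f y|).

Lemma kernel_integral_ge0 f x t : 0 <= kernel_integral f x t.
Proof. by apply: integral_ge0 => y _; rewrite mule_ge0 ?lee_fin. Qed.

Lemma measurable_kernel_integrand f x : measurable_fun setT f ->
  measurable_fun setT (fun y : U => `|Omega (x - y)%R|%:E * `|f y|).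
Proof.
move=> mf; apply: emeasurable_funM; last exact: measurableT_comp.
apply/measurable_EFinP; apply: measurableT_comp => //.
by apply: (measurableT_comp mOmega); exact: measurable_subcV.
Qed.

Lemma measurable_kernel_integral f t : measurable_fun setT f ->
  measurable_fun setT (kernel_integral f ^~ t).
Proof.
move=> mf; pose F (z : U * U) := (if (rho (z.1 - z.2) < t)%R then 1%R else 0%R)%:E *
   (`|Omega (z.1 - z.2)%R|%:E * `|f z.2|).
have F0 z : 0 <= F z by rewrite !mule_ge0 ?lee_fin//; case: ifP.
have mF : measurable_fun setT F.
  apply: emeasurable_funM; last apply: emeasurable_funM.
  - apply/measurable_EFinP; apply: measurable_fun_ifT => //.
    apply: measurable_fun_ltr => //.
    by apply: (measurableT_comp (qdist_measurable hrho)); exact: measurable_subcV2.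
  - apply/measurable_EFinP; apply: measurableT_comp => //.
    by apply: (measurableT_comp mOmega); exact: measurable_subcV2.
  - by apply: measurableT_comp => //; apply: measurableT_comp.
have := @measurable_fun_fubini_tonelli_F _ _ _ _ R (lebesgue_cV n) F mF F0.
rewrite (_ : fubini_F _ _ = kernel_integral f ^~ t)//.
apply/funext => x; rewrite /fubini_F /kernel_integral [RHS]integral_mkcond.
apply: eq_integral => y _; rewrite patchE /F/=; case: ifPn => h.
  by rewrite mem_set// mul1e.
by rewrite memNset ?mul0e//; exact/negP.
Qed.

Lemma frac_maximalE f x :
  frac_maximal P rho Omega alpha f x =
  ereal_sup [set (unit_volume rho `^ (-1 + alpha / gamma) * t `^ (alpha - gamma))%:E *
     kernel_integral f x t | t in `]0%R, +oo[].
Proof.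
rewrite /frac_maximal; congr ereal_sup; apply: eq_imagel => /= t; rewrite in_itv/= andbT => t0.
rewrite (ellipsoid_measure hrho trP)// poweR_EFin powRM ?powR_ge0//; last first.
  by rewrite ltW// (unit_volume_gt0 hrho trP).
rewrite -powRrM mulrDr mulrN1 mulrCA divff ?gt_eqF// mulr1.
by rewrite (addrC (- gamma)%R alpha).
Qed.

(** The strict inequality in the ellipsoid makes E(x, t) the union of the smaller ones, so monotone
    convergence applies. *)
Lemma kernel_integral_left_continuous f x t (L : \bar R) : measurable_fun setT f -> (0 < t)%R ->
  (forall s, (0 < s < t)%R -> kernel_integral f x s <= L) -> kernel_integral f x t <= L.
Proof.
move=> mf t0 hL.
(* The offset k + 2 keeps [s 0] positive. *)
pose s k := (t * (1 - (k.+2%:R)^-1))%R.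
have s_in k : (0 < s k < t)%R.
  rewrite /s mulr_gt0 ?subr_gt0 ?invf_lt1 ?ltr1n//=.
  by rewrite gtr_pMr// gtrBl invr_gt0.
have nds : nondecreasing_seq (fun k => E x (s k)).
  move=> i j ij; apply/subsetPset => y; rewrite /ellipsoid/= => /lt_le_trans; apply.
  rewrite ler_pM2l// lerD2l lerN2 lef_pV2 ?posrE ?ltr0n// ler_nat.
  by rewrite !ltnS.
have US : \bigcup_k E x (s k) = E x t.
  apply/seteqP; split => y.
    by move=> [k _]; rewrite /ellipsoid/= => /lt_trans; apply; case/andP: (s_in k).
  rewrite /ellipsoid/= => yt.
  pose d := ((t - rho (x - y)) / t)%R.
  have d0 : (0 < d)%R by rewrite divr_gt0// subr_gt0.
  pose k := Num.truncn d^-1.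
  exists k => //=; rewrite /ellipsoid/= /s.
  have kd : (k.+2%:R^-1 < d)%R.
    rewrite -[ltRHS]invrK ltf_pV2 ?posrE ?invr_gt0//.
    apply: lt_le_trans (truncnS_gt _) _; by rewrite ler_nat.
  have -> : (rho (x - y) = t * (1 - d))%R.
    by rewrite /d mulrBr mulrCA divff ?gt_eqF// !mulr1 opprB addrCA subrr addr0.
  by rewrite ltr_pM2l// ltrD2l ltrN2.
have w0 y : 0 <= `|Omega (x - y)%R|%:E * `|f y| by rewrite mule_ge0 ?lee_fin.
have c := @ge0_nondecreasing_set_cvg_integral _ _ _ _ _ mu nds
  (fun k => measurable_ellipsoid hrho x (s k))
  (fun k => measurable_funTS (measurable_kernel_integrand x mf)) (fun k y _ => w0 y).
rewrite US in c.
rewrite /kernel_integral -(cvg_lim _ c)//; apply: lime_le; first exact: cvgP c.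
by near=> k; apply: hL.
Unshelve. all: by end_near. Qed.

(** Rational radii suffice: for s < r < t with r rational, the weight at t is at most the weight at
    r, since alpha < gamma, and the integral at s is at most the integral at r. Left continuity then
    lets s tend to t. *)
Lemma measurable_frac_maximal f : measurable_fun setT f ->
  measurable_fun setT (frac_maximal P rho Omega alpha f).
Proof.
move=> mf.
pose c (t : R) := (unit_volume rho `^ (-1 + alpha / gamma) * t `^ (alpha - gamma))%R.
have c0 t : (0 <= c t)%R by rewrite mulr_ge0 ?powR_ge0.
pose e k : R :=
  if unpickle k is Some r then (if (0 < ratr (r : rat) :> R)%R then ratr r else 1%R) else 1%R.
have e0 k : (0 < e k)%R by rewrite /e; case: (unpickle k) => // r; case: ifP.
have -> : frac_maximal P rho Omega alpha f =
    fun x => ereal_sup [set (c (e k))%:E * kernel_integral f x (e k) | k in [set k | (0 <= k)%N]].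
  apply/funext => x; rewrite frac_maximalE; apply/eqP; rewrite eq_le; apply/andP; split.
    apply: ge_ereal_sup => _ [t + <-]; rewrite /= in_itv/= andbT => t0.
    rewrite -/(c t); have ct : (0 < c t)%R.
      by rewrite mulr_gt0 ?powR_gt0 ?(unit_volume_gt0 hrho trP).
    rewrite -lee_pdivlMl//; apply: kernel_integral_left_continuous => // s /andP[s0 st].
    rewrite lee_pdivlMl//.
    have [r] : exists r : rat, ratr r \in `]s, t[ by exact: rat_in_itvoo.
    rewrite in_itv/= => /andP[sr rt].
    have r0 : (0 < ratr r :> R)%R by apply: lt_trans sr.
    have er : e (pickle r) = ratr r by rewrite /e pickleK r0.
    apply: (@le_trans _ _ ((c (e (pickle r)))%:E * kernel_integral f x (e (pickle r)))); last first.
      by apply: ereal_sup_ubound; exists (pickle r).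
    rewrite er; apply: lee_pmul; [by rewrite lee_fin|exact: kernel_integral_ge0| |].
      rewrite lee_fin ler_wpM2l ?powR_ge0// -opprB !powRN lef_pV2 ?posrE ?powR_gt0//.
      by apply: ge0_ler_powR; rewrite ?nnegrE ?subr_ge0 ?(ltW rt) ?(ltW r0) ?(ltW t0) ?(ltW alphag).
    apply: ge0_subset_le_integral => [y|y _|y _|//].
    - by rewrite /ellipsoid/= => /lt_trans; apply.
    - by rewrite mule_ge0 ?lee_fin.
    - by rewrite mule_ge0 ?lee_fin.
  apply: ge_ereal_sup => _ [k _ <-]; apply: ereal_sup_ubound; exists (e k) => //=.
  by rewrite in_itv/= andbT.
apply: measurable_fun_esups => k.
by apply: emeasurable_funM => //; exact: measurable_kernel_integral.
Qed.

Lemma measurable_frac_kernel f x : measurable_fun setT f ->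
  measurable_fun setT (fun y : U => (Omega (x - y)%R / rho (x - y)%R `^ (gamma - alpha))%:E * f y).
Proof.
move=> mf; apply: emeasurable_funM => //; apply/measurable_EFinP; apply: measurable_funM.
  by apply: (measurableT_comp mOmega); exact: measurable_subcV.
rewrite (_ : (fun _ => _) = (fun y : U => rho (x - y) `^ (- (gamma - alpha)))%R).
  apply: (measurableT_comp (measurable_powR _)).
  by apply: (measurableT_comp (qdist_measurable hrho)); exact: measurable_subcV.
by apply/funext => y; rewrite powRN.
Qed.

(** Tonelli on the positive and the negative part separately, as the integrand has no sign and need
    not be integrable. *)
Lemma measurable_frac_integral f : measurable_fun setT f ->
  measurable_fun setT (frac_integral P rho Omega alpha f).
Proof.
move=> mf.
pose F (z : U * U) := (Omega (z.1 - z.2) * rho (z.1 - z.2) `^ (- (gamma - alpha)))%:E * f z.2.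
have mF : measurable_fun setT F.
  apply: emeasurable_funM; last exact: measurableT_comp.
  apply/measurable_EFinP; apply: measurable_funM.
    by apply: (measurableT_comp mOmega); exact: measurable_subcV2.
  apply: (measurableT_comp (measurable_powR _)).
  by apply: (measurableT_comp (qdist_measurable hrho)); exact: measurable_subcV2.
have mF1 := @measurable_fun_fubini_tonelli_F _ _ _ _ R (lebesgue_cV n) _
  (measurable_funepos mF) (funepos_ge0 F).
have mF2 := @measurable_fun_fubini_tonelli_F _ _ _ _ R (lebesgue_cV n) _
  (measurable_funeneg mF) (funeneg_ge0 F).
rewrite (_ : frac_integral _ _ _ _ _ = fubini_F mu (F^\+) \- fubini_F mu (F^\-)).
  exact: emeasurable_funB.
apply/funext => x; rewrite /frac_integral integralE /fubini_F; congr (_ - _).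
  by apply: eq_integral => y _; rewrite !funeposE /F/= powRN.
by apply: eq_integral => y _; rewrite !funenegE /F/= powRN.
Qed.

End rough_operators.

(** * Pointwise bounds by interpolation *)

Section pointwise_bounds.
Context {R : realType} (n : nat) (P : 'M[R]_n) (rho : 'cV[R]_n -> R).
Hypothesis hrho : quasi_distance P rho.
Hypothesis trP : 0 < \tr P.
Local Notation U := 'cV[R]_n.
Local Notation mu := (lebesgue_cV n : {measure set U -> \bar R}).
Local Notation gamma := (\tr P).
Local Notation E := (ellipsoid rho).
Local Open Scope ereal_scope.
Variables (Omega : U -> R) (alpha p q : R).
Hypothesis mOmega : measurable_fun setT Omega.
Hypotheses (alpha0 : (0 < alpha)%R) (alphag : (alpha < gamma)%R).
Hypotheses (p0 : (0 < p)%R) (pq : (p < q)%R).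
Local Notation b := (alpha * q / (q - p))%R.

(** The common pointwise estimate of the maximal operator and the potential, isolated so that the
    Morrey estimate is carried out once for both. *)
Definition interpolated_operator (T : (U -> \bar R) -> U -> \bar R) :=
  exists2 C : R, (0 < C)%R &
  forall (f : U -> \bar R) (x : U) (A : \bar R) (B : R),
  measurable_fun setT f -> 0 <= A -> (0 <= B)%R ->
  (forall t, (0 < t)%R -> kernel_integral rho Omega f x t <= (t `^ gamma)%:E * A) ->
  (forall t, (0 < t)%R -> kernel_integral rho Omega f x t <= (B * t `^ (gamma - b))%:E) ->
  `|T f x| <= C%:E * (A `^ (p / q) * (B `^ (1 - p / q))%:E).

Lemma interpolated_frac_maximal :
  interpolated_operator (frac_maximal P rho Omega alpha).
Proof.
pose c := (unit_volume rho `^ (-1 + alpha / gamma))%R.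
have c0 : (0 < c)%R by rewrite powR_gt0// (unit_volume_gt0 hrho trP).
exists c => // f x A B mf A0 B0 hA hB.
rewrite gee0_abs; last first.
  rewrite (frac_maximalE hrho trP); apply: le_ereal_sup_tmp; eexists.
    by exists 1%R; rewrite //= in_itv/= ltr01.
  by rewrite mule_ge0 ?lee_fin ?mulr_ge0 ?powR_ge0// kernel_integral_ge0.
rewrite (frac_maximalE hrho trP); apply: ge_ereal_sup => _ [t + <-].
rewrite /= in_itv/= andbT => t0.
rewrite EFinM -muleA lee_pmul2l ?lte_fin//.
have tD c1 c2 : (t `^ c1 * t `^ c2 = t `^ (c1 + c2))%R.
  by rewrite powRD//; apply/implyP => _; rewrite gt_eqF.
have [X XE] : exists X, kernel_integral rho Omega f x t = X%:E.
  exists (fine (kernel_integral rho Omega f x t)); rewrite fineK// ge0_fin_numE ?kernel_integral_ge0//.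
  by apply: (le_lt_trans (hB _ t0)); rewrite ltry.
have X0 : (0 <= X)%R by rewrite -lee_fin -XE kernel_integral_ge0.
rewrite XE -EFinM; apply: (@maximal_interpolation _ alpha p q p0 pq _ t) => //.
- by rewrite mulr_ge0 ?powR_ge0.
- rewrite EFinM -XE; apply: (@le_trans _ _ ((t `^ (alpha - gamma))%:E * ((t `^ gamma)%:E * A))).
    by rewrite lee_wpmul2l ?lee_fin ?powR_ge0// hA.
  by rewrite muleA -EFinM tD subrK.
- have := hB _ t0; rewrite XE lee_fin => XB.
  apply: (@le_trans _ _ (t `^ (alpha - gamma) * (B * t `^ (gamma - b)))%R).
    by rewrite ler_wpM2l ?powR_ge0.
  by rewrite mulrCA tD addrA subrK.
Qed.

Lemma interpolated_frac_integral :
  interpolated_operator (frac_integral P rho Omega alpha).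
Proof.
have [C C0 hC] := potential_interpolation hrho alpha0 alphag p0 pq.
exists C => // f x A B mf A0 B0 hA hB.
apply: le_trans (hC (fun y => `|Omega (x - y)%R|%:E * `|f y|) x A B _ _ A0 B0 hA hB).
- rewrite /frac_integral.
  apply: (le_trans (le_abse_integral _ measurableT (measurable_frac_kernel hrho alpha mOmega x mf))).
  apply: ge0_subset_le_integral => // [y _|y _].
    by rewrite !mule_ge0 ?lee_fin ?powR_ge0.
  rewrite abseM /= normrM normfV (ger0_norm (powR_ge0 _ _)) EFinM -!muleA.
  have -> : ((rho (x - y))^-1 `^ (gamma - alpha) = (rho (x - y) `^ (gamma - alpha))^-1)%R.
    by rewrite -powR_inv1 ?(qdist_ge0 hrho)// -powRrM mulN1r powRN.
  by rewrite [X in _ <= _ * X]muleC.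
- exact: measurable_kernel_integrand.
- by move=> y; rewrite mule_ge0 ?lee_fin.
Qed.

End pointwise_bounds.

(** * Averages of Morrey functions *)

Section averages.
Context {R : realType} (n : nat) (P : 'M[R]_n) (rho : 'cV[R]_n -> R).
Hypothesis hrho : quasi_distance P rho.
Hypothesis trP : 0 < \tr P.
Local Notation U := 'cV[R]_n.
Local Notation mu := (lebesgue_cV n : {measure set U -> \bar R}).
Local Notation gamma := (\tr P).
Local Notation E := (ellipsoid rho).
Local Open Scope ereal_scope.

(** Hoelder against the constant 1, with exponents p / u and p / (p - u). *)
Lemma power_mean_ellipsoid (u p : R) (g : U -> \bar R) x t :
  (0 < u)%R -> (u < p)%R -> measurable_fun setT g -> (forall y, 0 <= g y) -> (0 < t)%R ->
  (\int[mu]_(y in E x t) g y `^ u) `^ u^-1 <=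
  ((unit_volume rho * t `^ gamma) `^ (u^-1 - p^-1))%:E * (\int[mu]_(y in E x t) g y `^ p) `^ p^-1.
Proof.
move=> u0 up mg g0 t0.
have p0 : (0 < p)%R by apply: lt_trans up.
have pu0 : (0 < p - u)%R by rewrite subr_gt0.
have V0 : (0 < unit_volume rho * t `^ gamma)%R.
  by rewrite mulr_gt0 ?powR_gt0// (unit_volume_gt0 hrho trP).
have mgu : measurable_fun setT (fun y => g y `^ u).
  exact: (measurableT_comp (measurable_poweR _)).
have := @hoelder_ereal_on _ _ _ mu (E x t) (cst 1%R) (fun y => g y `^ u)
  (p / (p - u)) (p / u) (unit_volume rho * t `^ gamma) (measurable_ellipsoid hrho x t).
move=> /(_ (divr_gt0 p0 pu0) (divr_gt0 p0 u0)).
have -> : ((p / (p - u))^-1 + (p / u)^-1 = 1)%R.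
  by field; rewrite !gt_eqF.
move=> /(_ erefl (measurable_cst _) mgu (fun=> ler01) (fun=> poweR_ge0 _ _) V0).
have -> : \int[mu]_(y in E x t) (cst 1%R y `^ (p / (p - u)))%:E = (unit_volume rho * t `^ gamma)%:E.
  under eq_integral do rewrite powR1.
  rewrite integral_cst; last by apply: measurable_ellipsoid hrho _ _.
  by rewrite mul1e (ellipsoid_measure hrho trP).
move=> /(_ (lexx _)).
under eq_integral do rewrite /= mul1e.
have -> : \int[mu]_(y in E x t) (g y `^ u) `^ (p / u) = \int[mu]_(y in E x t) g y `^ p.
  by apply: eq_integral => y _; rewrite -poweRrM mulrCA divff ?gt_eqF// mulr1.
move=> h.
have := le_poweR _ _ h => /(_ u^-1%R).
rewrite invr_ge0 (ltW u0) => /(_ isT).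
rewrite integral_ge0; last by move=> *; exact: poweR_ge0.
move=> /(_ isT) /le_trans; apply.
rewrite poweRM ?lee_fin ?powR_ge0 ?poweR_ge0// -poweRrM poweR_EFin -powRrM.
rewrite le_eqVlt; apply/orP; left; apply/eqP; congr (_%:E * _).
  by congr (_ `^ _)%R; field; rewrite !gt_eqF.
by congr (_ `^ _); field; rewrite !gt_eqF.
Qed.

Section kernel.
Variables (Omega : U -> R) (s0 u p : R).
Hypothesis mOmega : measurable_fun setT Omega.
Hypothesis homOmega : homogeneous0 P Omega.
Hypotheses (s01 : (0 < s0)%R) (u0 : (0 < u)%R) (su : (s0^-1 + u^-1 = 1)%R) (up : (u < p)%R).
Hypothesis Omega_int : \int[mu]_(x in [set x | (rho x < 1)%R]) (`|Omega x| `^ s0)%:E < +oo.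

(** By homogeneity the s0-th power of the kernel integrates over E(x, t) to t^gamma times its
    integral over the unit ellipsoid, whatever x is. *)
Lemma kernel_integral_le_mean : exists2 c : R, (0 < c)%R &
  forall (f : U -> \bar R) x t, measurable_fun setT f -> (0 < t)%R ->
  kernel_integral rho Omega f x t <=
  (c * t `^ (gamma / s0))%:E * (\int[mu]_(y in E x t) `|f y| `^ u) `^ u^-1.
Proof.
pose I := \int[mu]_(x in [set x | (rho x < 1)%R]) (`|Omega x| `^ s0)%:E.
have Ioo : I < +oo := Omega_int.
have I0 : 0 <= I by apply: integral_ge0 => x _; rewrite lee_fin powR_ge0.
have IE : I = (fine I)%:E by rewrite fineK// ge0_fin_numE.
have fI0 : (0 <= fine I)%R by rewrite fine_ge0.
have I10 : (0 < fine I + 1)%R by rewrite ltr_wpDl.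
(* The summand 1 keeps the constant positive even for a kernel that vanishes. *)
exists ((fine I + 1) `^ s0^-1)%R; first by rewrite powR_gt0.
move=> f x t mf t0.
have -> : ((fine I + 1) `^ s0^-1 * t `^ (gamma / s0) = ((fine I + 1) * t `^ gamma) `^ s0^-1)%R.
  by rewrite powRM ?powR_ge0 ?(ltW I10)// -powRrM.
apply: hoelder_ereal_on => //.
- exact: measurable_ellipsoid hrho _ _.
- apply: measurableT_comp => //.
  by apply: (measurableT_comp mOmega); exact: measurable_subcV.
- exact: measurableT_comp.
- by rewrite mulr_gt0 ?powR_gt0.
- have := @integral_ellipsoid_invariant _ _ _ _ hrho trP (fun x => (`|Omega x| `^ s0)%:E) x t t0.
  rewrite -/I => ->.
  + rewrite IE -EFinM lee_fin mulrC ler_wpM2r ?powR_ge0//.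
    by rewrite lerDl.
  + exact: measurable_normr_powR.
  + by move=> y; rewrite lee_fin powR_ge0.
  + by move=> a y a0; rewrite homOmega.
Qed.

(** The exponents of t add up to gamma / s0 + gamma (1/u - 1/p) = gamma - gamma / p, because s0 and
    u are conjugate. *)
Lemma kernel_integral_le_power_mean : exists2 c : R, (0 < c)%R &
  forall (f : U -> \bar R) x t, measurable_fun setT f -> (0 < t)%R ->
  kernel_integral rho Omega f x t <=
  (c * t `^ (gamma - gamma / p))%:E * (\int[mu]_(y in E x t) `|f y| `^ p) `^ p^-1.
Proof.
have [c c0 hc] := kernel_integral_le_mean.
have v0 := unit_volume_gt0 hrho trP.
exists (c * unit_volume rho `^ (u^-1 - p^-1))%R; first by rewrite mulr_gt0 ?powR_gt0.
move=> f x t mf t0; apply: (le_trans (hc f x t mf t0)).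
have mnf : measurable_fun setT (fun y => `|f y|) by exact: measurableT_comp.
have h := power_mean_ellipsoid x u0 up mnf (fun y => abse_ge0 _) t0.
apply: le_trans (lee_wpmul2l _ h) _.
  by rewrite lee_fin mulr_ge0 ?powR_ge0// ltW.
rewrite muleA -EFinM powRM ?powR_ge0 ?(ltW v0)// -powRrM.
rewrite le_eqVlt; apply/orP; left; apply/eqP; congr (_%:E * _).
rewrite mulrACA -powRD; last by apply/implyP => _; rewrite gt_eqF.
congr (_ * _ `^ _)%R; have -> : (s0^-1 = 1 - u^-1)%R by rewrite -su addrK.
ring.
Qed.

End kernel.
End averages.

Section morrey_averages.
Context {R : realType} (n : nat) (P : 'M[R]_n) (rho : 'cV[R]_n -> R).
Hypothesis hrho : quasi_distance P rho.
Hypothesis trP : 0 < \tr P.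
Local Notation U := 'cV[R]_n.
Local Notation mu := (lebesgue_cV n : {measure set U -> \bar R}).
Local Notation gamma := (\tr P).
Local Notation E := (ellipsoid rho).
Local Open Scope ereal_scope.
Variable phi : U -> R -> R.
Hypothesis phi_gt0 : forall x t, (0 < t)%R -> (0 < phi x t)%R.

Definition power_integral (p : R) (f : U -> \bar R) (D : set U) : \bar R :=
  \int[mu]_(y in D) `|f y| `^ p.

Lemma power_integral_ge0 p f D : 0 <= power_integral p f D.
Proof. by apply: integral_ge0 => y _; exact: poweR_ge0. Qed.

Lemma Lnorm_onE p f D : (0 < p)%R -> Lnorm_on p D f = power_integral p f D `^ p^-1.
Proof.
move=> p0; rewrite /Lnorm_on Lnorm.unlock /power_integral [in RHS]integral_mkcond.
congr (_ `^ _); apply: eq_integral => y _; rewrite !patchE.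
by case: ifPn => // _; rewrite abse0 poweR0r ?gt_eqF.
Qed.

Lemma morrey_norm_leP p f M : (0 < p)%R -> (0 <= M)%R ->
  morrey_norm rho p (fun x r => phi x r `^ p^-1)%R f <= M%:E <->
  forall x r, (0 < r)%R ->
    power_integral p f (E x r) <= (M `^ p * (phi x r * (unit_volume rho * r `^ gamma)))%:E.
Proof.
move=> p0 M0.
have v0 := unit_volume_gt0 hrho trP.
pose G x r := power_integral p f (E x r).
pose W x r := (phi x r * (unit_volume rho * r `^ gamma))%R.
have W0 x r : (0 < r)%R -> (0 < W x r)%R by move=> r0; rewrite !mulr_gt0 ?powR_gt0 ?phi_gt0.
have pp : (p^-1 * p = 1)%R by rewrite mulVf ?gt_eqF.
have termE x r : (0 < r)%R ->
  ((phi x r `^ p^-1)^-1)%:E * mu (E x r) `^ (- p^-1) * Lnorm_on p (E x r) f =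
  ((W x r `^ p^-1)^-1)%:E * G x r `^ p^-1.
  move=> r0; rewrite Lnorm_onE// (ellipsoid_measure hrho trP)// poweR_EFin.
  rewrite -EFinM -powRN -powRM ?ltW ?phi_gt0 ?mulr_gt0 ?powR_gt0//.
  by rewrite powRN.
have iff x r : (0 < r)%R ->
  ((W x r `^ p^-1)^-1)%:E * G x r `^ p^-1 <= M%:E <-> G x r <= (M `^ p * W x r)%:E.
  move=> r0; rewrite lee_pdivrMl ?powR_gt0 ?W0//.
  have G0 : 0 <= G x r by exact: power_integral_ge0.
  have Wp : ((W x r `^ p^-1) `^ p = W x r)%R by rewrite -powRrM pp powRr1// ltW// W0.
  split=> h.
    have := le_poweR (ltW p0) (poweR_ge0 _ _) h.
    rewrite -poweRrM pp poweRe1// poweRM ?lee_fin ?powR_ge0//.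
    by rewrite !poweR_EFin -EFinM Wp mulrC.
  have p10 : (0 <= p^-1)%R by rewrite invr_ge0 ltW.
  have := le_poweR p10 G0 h.
  rewrite poweR_EFin powRM ?powR_ge0 ?(ltW (W0 x r r0))// -powRrM (mulrC p) pp powRr1//.
  by rewrite mulrC EFinM.
split=> h.
  move=> x r r0; apply/iff => //; rewrite -termE//; apply: le_trans h.
  apply: ereal_sup_ubound; exists (x, r) => //; split => //=.
  by rewrite in_itv/= andbT.
apply: ge_ereal_sup => _ [[x r] [_ /=]] + <-; rewrite in_itv/= andbT => r0.
by rewrite termE//; apply/iff => //; exact: h.
Qed.

Variables (p q alpha M : R) (f : U -> \bar R).
Hypotheses (p0 : (0 < p)%R) (pq : (p < q)%R) (M0 : (0 < M)%R) (alpha0 : (0 < alpha)%R).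
Local Notation b := (alpha * q / (q - p))%R.
Hypothesis hM : forall x r, (0 < r)%R ->
    power_integral p f (E x r) <= (M `^ p * (phi x r * (unit_volume rho * r `^ gamma)))%:E.

Lemma power_integral_mono x r t : (r <= t)%R ->
  power_integral p f (E x r) <= power_integral p f (E x t).
Proof.
move=> rt; apply: ge0_subset_le_integral => [y|y _|y _|//]; rewrite ?poweR_ge0//.
by rewrite /ellipsoid/= => /lt_le_trans; apply.
Qed.

Lemma power_integral_fin x r : (0 < r)%R ->
  power_integral p f (E x r) = (fine (power_integral p f (E x r)))%:E.
Proof.
move=> r0; rewrite fineK// ge0_fin_numE ?power_integral_ge0//.
by apply: (le_lt_trans (hM _ r0)); rewrite ltry.
Qed.

(** The integral over E(x, t) is at most the one over E(x, tau) for every tau > t. Being independent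
    of tau, it gives a lower bound for the essential infimum of phi(x, tau) tau^gamma, which the
    hypothesis bounds by phi(x, r). *)
Lemma power_integral_ess_inf (C : R) x r t : (0 < r)%R -> (r < t)%R ->
  ereal_sup [set (t `^ (- gamma))%:E *
     ess_inf (mrestr (@lebesgue_measure R) (measurable_itv `]t, +oo[))
       (fun tau => (phi x tau * tau `^ gamma)%:E) | t in `]r, +oo[] <= (C * phi x r)%:E ->
  power_integral p f (E x t) <= (C * M `^ p * phi x r * (unit_volume rho * t `^ gamma))%:E.
Proof.
move=> r0 rt hC.
have t0 : (0 < t)%R by apply: lt_trans rt.
have v0 := unit_volume_gt0 hrho trP.
have k0 : (0 < M `^ p * unit_volume rho)%R by rewrite mulr_gt0 ?powR_gt0.
rewrite power_integral_fin// lee_fin; set g := fine _.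
have : (g / (M `^ p * unit_volume rho))%:E <=
    ess_inf (mrestr (@lebesgue_measure R) (measurable_itv `]t, +oo[))
       (fun tau => (phi x tau * tau `^ gamma)%:E).
  (* The restricted measure ignores the complement of the ray, so only tau > t has to be
     considered. *)
  apply/ess_infP; exists (~` `]t, +oo[%classic); split.
  - exact: measurableC.
  - change (@lebesgue_measure R (~` `]t, +oo[%classic `&` `]t, +oo[%classic) = 0).
    by rewrite setICl measure0.
  - move=> tau/= ; apply: contra_not => ttau.
    have {}ttau : (t < tau)%R by move: ttau; rewrite /= in_itv/= andbT.
    rewrite lee_fin ler_pdivrMr//.
    have := le_trans (power_integral_mono x (ltW ttau)) (hM x (lt_trans t0 ttau)).
    rewrite power_integral_fin// lee_fin -/g => /le_trans; apply.
    by rewrite le_eqVlt; apply/orP; left; apply/eqP; ring.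
move=> h.
have : (t `^ (- gamma))%:E * (g / (M `^ p * unit_volume rho))%:E <= (C * phi x r)%:E.
  apply: le_trans hC; apply: (@le_trans _ _ ((t `^ (- gamma))%:E *
     ess_inf (mrestr (@lebesgue_measure R) (measurable_itv `]t, +oo[))
       (fun tau => (phi x tau * tau `^ gamma)%:E))).
    by apply: lee_wpmul2l; rewrite ?lee_fin ?powR_ge0.
  by apply: ereal_sup_ubound; exists t => //=; rewrite in_itv/= andbT.
rewrite -EFinM lee_fin powRN mulrC ler_pdivrMr ?powR_gt0// ler_pdivrMr// => /le_trans; apply.
by rewrite le_eqVlt; apply/orP; left; apply/eqP; ring.
Qed.

(** On (r, 2r) the Morrey condition bounds phi from below by a multiple of the integral of |f|^p
    over E(x, r). Inserted into the integral condition, this eliminates phi and leaves a pure power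
    of r. *)
Lemma power_integral_decay (C : R) x r : (0 < r)%R ->
  \int[@lebesgue_measure R]_(t in `]r, +oo[) (t `^ alpha * phi x t `^ p^-1 / t)%:E
    <= (C * r `^ (- (alpha * p / (q - p))))%:E ->
  power_integral p f (E x r) `^ p^-1 <=
  (2 * C * (unit_volume rho * 2 `^ gamma) `^ p^-1 * M * r `^ (gamma / p - b))%:E.
Proof.
move=> r0 hC.
have v0 := unit_volume_gt0 hrho trP.
have qp0 : (0 < q - p)%R by rewrite subr_gt0.
have p10 : (0 < p^-1)%R by rewrite invr_gt0.
have r20 : (0 < 2 * r)%R by rewrite mulr_gt0.
have rr : (r < 2 * r)%R by rewrite ltr_pMl// ltr1n.
have v2 : (0 < unit_volume rho * 2 `^ gamma)%R by rewrite mulr_gt0 ?powR_gt0.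
rewrite power_integral_fin//; set g := fine _.
have g0 : (0 <= g)%R by rewrite fine_ge0// power_integral_ge0.
pose V := (unit_volume rho * (2 * r) `^ gamma)%R.
have V0 : (0 < V)%R by rewrite mulr_gt0 ?powR_gt0.
have k0 : (0 < M `^ p * V)%R by rewrite mulr_gt0 ?powR_gt0.
(* A lower bound of the integrand on (r, 2r): each factor is replaced by its least value, with t <=
   2r in the volume and in 1/t. *)
pose kappa := (r `^ alpha * (g / (M `^ p * V)) `^ p^-1 / (2 * r))%R.
have kr : (kappa * r <= C * r `^ (- (alpha * p / (q - p))))%R.
  rewrite -lee_fin; apply: le_trans hC.
  have -> : (kappa * r)%:E = \int[@lebesgue_measure R]_(t in `]r, (2 * r)%R[) (cst kappa%:E t).
    rewrite integral_cst//= lebesgue_measure_itv/= lte_fin rr -EFinB -EFinM.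
    by congr (_%:E); congr (_ * _)%R; ring.
  apply: ge0_subset_le_integral.
  - by move=> t; rewrite /= !in_itv/= => /andP[->].
  - move=> t _; rewrite lee_fin /kappa !mulr_ge0 ?invr_ge0 ?powR_ge0//.
    + exact: ltW.
  - move=> t; rewrite /= in_itv/= andbT => rt.
    by rewrite lee_fin !mulr_ge0 ?invr_ge0 ?powR_ge0// ltW// (lt_trans r0).
  - move=> t; rewrite /= in_itv/= => /andP[rt t2].
    have t0 : (0 < t)%R by apply: lt_trans rt.
    rewrite lee_fin /kappa; apply: ler_pM; rewrite ?mulr_ge0 ?powR_ge0 ?invr_ge0 ?(ltW r20)//.
      apply: ler_pM; rewrite ?powR_ge0//.
        by apply: ge0_ler_powR; rewrite ?nnegrE ?(ltW alpha0) ?(ltW r0) ?(ltW t0) ?(ltW rt).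
      apply: ge0_ler_powR; rewrite ?nnegrE ?(ltW p10) ?(ltW (phi_gt0 _ t0)) ?divr_ge0 ?(ltW k0)//.
      rewrite ler_pdivrMr//.
      have := le_trans (power_integral_mono x (ltW rt)) (hM x t0).
      rewrite power_integral_fin// lee_fin -/g => /le_trans; apply.
      rewrite mulrCA ler_pM2l ?phi_gt0// ler_pM2l ?powR_gt0// ler_pM2l//.
      by apply: ge0_ler_powR; rewrite ?nnegrE ?(ltW trP) ?(ltW t0) ?(ltW r20) ?(ltW t2).
    by rewrite lef_pV2 ?posrE// ltW.
rewrite poweR_EFin lee_fin.
pose w := ((unit_volume rho * 2 `^ gamma) `^ p^-1)%R.
have w0 : (0 < w)%R by rewrite powR_gt0.
have rg0 : (0 < r `^ (gamma / p))%R by rewrite powR_gt0.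
have rD c1 c2 : (r `^ (c1 + c2) = r `^ c1 * r `^ c2)%R.
  by rewrite powRD//; apply/implyP => _; rewrite gt_eqF.
have kw : ((M `^ p * V)^-1 `^ p^-1 = (M * (w * r `^ (gamma / p)))^-1)%R.
  rewrite -powR_inv1 ?(ltW k0)// -powRrM mulN1r powRN; congr (_^-1)%R.
  rewrite powRM ?powR_ge0 ?(ltW V0)// -powRrM divff ?gt_eqF// powRr1 ?(ltW M0)//.
  rewrite /V (powRM _ (ler0n _ 2) (ltW r0)) mulrA powRM ?(ltW v2) ?powR_ge0//.
  by rewrite -powRrM.
have kE : (kappa * r = g `^ p^-1 * (r `^ (alpha - gamma / p) / (2 * M * w)))%R.
  rewrite /kappa powRM ?invr_ge0 ?(ltW k0)// kw rD powRN.
  by field; rewrite !gt_eqF.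
move: kr; rewrite kE -ler_pdivlMr; last first.
  by rewrite divr_gt0 ?powR_gt0// !mulr_gt0.
move=> /le_trans; apply; rewrite le_eqVlt; apply/orP; left; apply/eqP.
have -> : (gamma / p - b = - (alpha * p / (q - p)) + - (alpha - gamma / p))%R.
  by field; rewrite !gt_eqF.
rewrite -/w [in RHS]rD (powRN _ (alpha - gamma / p)) invf_div; ring.
Qed.

End morrey_averages.

(** * Boundedness *)

(** The sum is at most twice the larger term. *)
Lemma poweR_add_le {R : realType} (p : R) (a b : \bar R) : (0 <= p)%R ->
  (0 <= a -> 0 <= b -> (a + b) `^ p <= (2 `^ p)%:E * (a `^ p + b `^ p))%E.
Proof.
move=> p0 a0 b0.
have main x y : (0 <= x -> x <= y -> (x + y) `^ p <= (2 `^ p)%:E * (x `^ p + y `^ p))%E.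
  move=> x0 xy; have y0 := le_trans x0 xy.
  apply: (@le_trans _ _ ((2%:E * y) `^ p)%E).
    by apply: le_poweR => //; [exact: adde_ge0|rewrite mule_natl mule2n leeD2r].
  rewrite poweRM// poweR_EFin lee_wpmul2l ?lee_fin ?powR_ge0//.
  by rewrite leeDr// poweR_ge0.
have [ab|/ltW ba] := leP a b; first exact: main.
by rewrite addeC [X in (_ <= _ * X)%E]addeC; exact: main.
Qed.

Section strong_bound.
Context {R : realType} (n : nat) (P : 'M[R]_n) (rho : 'cV[R]_n -> R).
Hypothesis hrho : quasi_distance P rho.
Hypothesis trP : 0 < \tr P.
Local Notation U := 'cV[R]_n.
Local Notation mu := (lebesgue_cV n : {measure set U -> \bar R}).
Local Notation gamma := (\tr P).
Local Notation E := (ellipsoid rho).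
Local Open Scope ereal_scope.
Variables (Omega : U -> R) (s u p q alpha : R) (phi : U -> R -> R).
Hypothesis mOmega : measurable_fun setT Omega.
Hypothesis homOmega : homogeneous0 P Omega.
Hypotheses (s0 : (0 < s)%R) (u0 : (0 < u)%R) (su : (s^-1 + u^-1 = 1)%R).
Hypotheses (up : (u < p)%R) (pq : (p < q)%R) (alpha0 : (0 < alpha)%R).
Hypothesis Omega_int : \int[mu]_(x in [set x | (rho x < 1)%R]) (`|Omega x| `^ s)%:E < +oo.
Hypothesis phi_gt0 : forall x t, (0 < t)%R -> (0 < phi x t)%R.
Hypothesis phi_sup : exists C : R, forall x r, (0 < r)%R ->
  ereal_sup [set (t `^ (- gamma))%:E *
     ess_inf (mrestr (@lebesgue_measure R) (measurable_itv `]t, +oo[))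
       (fun tau => (phi x tau * tau `^ gamma)%:E) | t in `]r, +oo[] <= (C * phi x r)%:E.
Hypothesis phi_int : exists C : R, forall x r, (0 < r)%R ->
  \int[@lebesgue_measure R]_(t in `]r, +oo[) (t `^ alpha * phi x t `^ p^-1 / t)%:E
    <= (C * r `^ (- (alpha * p / (q - p))))%:E.
Local Notation b := (alpha * q / (q - p))%R.

Let p0 : (0 < p)%R. Proof. exact: lt_trans up. Qed.
Let q0 : (0 < q)%R. Proof. exact: lt_trans pq. Qed.
Let v0 : (0 < unit_volume rho)%R. Proof. exact: (unit_volume_gt0 hrho trP). Qed.

Definition power_integral_bounded f M := forall x r, (0 < r)%R ->
  power_integral p f (E x r) <= (M `^ p * (phi x r * (unit_volume rho * r `^ gamma)))%:E.

Lemma kernel_integral_decay : exists2 c : R, (0 < c)%R &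
  forall f M x t, measurable_fun setT f -> (0 < M)%R -> power_integral_bounded f M ->
  (0 < t)%R -> kernel_integral rho Omega f x t <= (c * M * t `^ (gamma - b))%:E.
Proof.
have [c c0 hc] := kernel_integral_le_power_mean hrho trP mOmega homOmega s0 u0 su up Omega_int.
have [C hC] := phi_int.
(* Enlarging C keeps the hypothesis true and makes the constant positive. *)
pose C1 := Num.max C 1%R.
have C10 : (0 < C1)%R by rewrite lt_max ltr01 orbT.
have v2 : (0 < unit_volume rho * 2 `^ gamma)%R by rewrite mulr_gt0 ?powR_gt0.
exists (c * (2 * C1 * (unit_volume rho * 2 `^ gamma) `^ p^-1))%R.
  by rewrite !mulr_gt0 ?powR_gt0.
move=> f M x t mf M0 hM t0; apply: (le_trans (hc f x t mf t0)).
have hC1 : \int[@lebesgue_measure R]_(t in `]t, +oo[) (t `^ alpha * phi x t `^ p^-1 / t)%:E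
    <= (C1 * t `^ (- (alpha * p / (q - p))))%:E.
  by apply: (le_trans (hC x t t0)); rewrite lee_fin ler_wpM2r ?powR_ge0// le_max lexx.
have h := power_integral_decay hrho trP phi_gt0 p0 pq M0 alpha0 hM t0 hC1.
apply: le_trans (lee_wpmul2l _ h) _; first by rewrite lee_fin mulr_ge0 ?powR_ge0// ltW.
rewrite -EFinM lee_fin le_eqVlt; apply/orP; left; apply/eqP.
have -> : (gamma - b = (gamma - gamma / p) + (gamma / p - b))%R by rewrite addrA subrK.
by rewrite [in RHS]powRD; [ring|apply/implyP => _; rewrite gt_eqF].
Qed.

Lemma power_integral_tail : exists2 c : R, (0 < c)%R &
  forall f M x r t, (0 < M)%R -> power_integral_bounded f M -> (0 < r)%R -> (r < t)%R ->
  power_integral p f (E x t) <= (c * M `^ p * phi x r * t `^ gamma)%:E.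
Proof.
have [C hC] := phi_sup.
pose C1 := Num.max C 1%R.
have C10 : (0 < C1)%R by rewrite lt_max ltr01 orbT.
exists (C1 * unit_volume rho)%R; first by rewrite mulr_gt0.
move=> f M x r t M0 hM r0 rt.
have hC1 := le_trans (hC x r r0) _.
have {}hC1 := hC1 (C1 * phi x r)%:E.
apply: (le_trans (power_integral_ess_inf hrho trP M0 hM r0 rt (hC1 _))).
  by rewrite lee_fin ler_wpM2r ?(ltW (phi_gt0 _ r0))// le_max lexx.
by rewrite lee_fin le_eqVlt; apply/orP; left; apply/eqP; ring.
Qed.

Lemma kernel_integral_local : exists K c5 c6 : R, [/\ (1 <= K)%R, (0 < c5)%R, (0 < c6)%R &
  forall f M x0 r x t, measurable_fun setT f -> (0 < M)%R -> power_integral_bounded f M ->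
  (0 < r)%R -> E x0 r x -> (0 < t)%R ->
  kernel_integral rho Omega f x t <= (t `^ gamma)%:E *
    (c5%:E * family_maximal P rho (rational_family n)
        ((fun y => `|f y| `^ u) \_ (E x0 (2 * K * r)%R)) x `^ u^-1
     + (c6 * M * phi x0 r `^ p^-1)%:E)].
Proof.
have [K K1 hK] := qdist_quasi_add hrho.
have K0 : (0 < K)%R by apply: lt_le_trans K1.
have [c1 c10 hc1] := kernel_integral_le_mean hrho trP mOmega homOmega s0 u0 su Omega_int.
have [c2 c20 hc2] := kernel_integral_le_power_mean hrho trP mOmega homOmega s0 u0 su up Omega_int.
have [c3 c30 hc3] := power_integral_tail.
have [D D0 hD] := family_dominates hrho trP.
exists K, (c1 * D `^ u^-1)%R, (c2 * (c3 * (2 * K) `^ gamma) `^ p^-1)%R; split => //.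
- by rewrite mulr_gt0 ?powR_gt0.
- by rewrite mulr_gt0 ?powR_gt0// mulr_gt0 ?powR_gt0// mulr_gt0.
move=> f M x0 r x t mf M0 hM r0 xE t0.
set g := _ \_ _.
have g0 y : 0 <= g y by apply: erestrict_ge0 => z _; exact: poweR_ge0.
have Mg0 : 0 <= family_maximal P rho (rational_family n) g x by exact: family_maximal_ge0.
(* K (r + t) is at most 2Kr when t <= r and at most 2Kt when t > r: small ellipsoids see f only near
   x0, large ones are contained in a comparable ellipsoid about x0. *)
have near_sub y : E x t y -> (rho (x0 - y) < K * (r + t))%R.
  rewrite /ellipsoid/= => yt.
  have -> : (x0 - y = (x0 - x) + (x - y))%R by rewrite addrA subrK.
  by apply: le_lt_trans (hK _ _) _; rewrite ltr_pM2l// ltrD.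
rewrite ge0_muleDr ?mule_ge0 ?poweR_ge0 ?lee_fin ?mulr_ge0 ?powR_ge0 ?(ltW M0) ?(ltW c20) ?(ltW c10)//.
have [tr|rt] := leP t r.
  apply: le_trans (leeDl _ _); last by rewrite -EFinM lee_fin !mulr_ge0 ?powR_ge0// ltW.
  apply: (le_trans (hc1 f x t mf t0)).
  have -> : \int[mu]_(y in E x t) `|f y| `^ u = \int[mu]_(y in E x t) g y.
    apply: eq_integral => y /set_mem yt; rewrite /g patchE mem_set//.
    rewrite /ellipsoid/=; apply: lt_le_trans (near_sub y yt) _.
    by rewrite (mulrC 2%R) -mulrA ler_pM2l// mulr_natl mulr2n lerD2l.
  have h : \int[mu]_(y in E x t) g y <= (t `^ gamma * D)%:E * family_maximal P rho (rational_family n) g x.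
    have := hD g x t g0 t0; rewrite powRN lee_pdivrMl ?powR_gt0// => /le_trans; apply.
    by rewrite EFinM muleA.
  have u10 : (0 <= u^-1)%R by rewrite invr_ge0 ltW.
  have {}h := le_poweR u10 (integral_ge0 _ (fun y _ => g0 y)) h.
  apply: le_trans (lee_wpmul2l _ h) _; first by rewrite lee_fin mulr_ge0 ?powR_ge0// ltW.
  rewrite poweRM ?lee_fin ?mulr_ge0 ?powR_ge0 ?(ltW D0)// poweR_EFin muleA -EFinM [leRHS]muleA -EFinM.
  rewrite le_eqVlt; apply/orP; left; apply/eqP; congr (_%:E * _).
  rewrite powRM ?powR_ge0 ?(ltW D0)// -powRrM.
  have -> : (t `^ gamma = t `^ (gamma / s) * t `^ (gamma / u))%R.
    rewrite -powRD; last by apply/implyP => _; rewrite gt_eqF.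
    by rewrite -mulrDr su mulr1.
  ring.
apply: le_trans (leeDr _ _); last first.
  by rewrite !mule_ge0 ?poweR_ge0 ?lee_fin ?mulr_ge0 ?powR_ge0// ltW.
apply: (le_trans (hc2 f x t mf t0)).
have h : power_integral p f (E x t) <= (c3 * M `^ p * phi x0 r * (2 * K * t) `^ gamma)%:E.
  have rKt : (r < 2 * K * t)%R.
    by apply: lt_le_trans rt _; rewrite ler_peMl ?(ltW t0)// (le_trans K1)// ler_peMl ?(ltW K0)// ler1n.
  apply: le_trans (hc3 f M x0 r _ M0 hM r0 rKt).
  apply: ge0_subset_le_integral => [y yt|y _|y _|//]; rewrite ?poweR_ge0//.
  rewrite /ellipsoid/=; apply: lt_le_trans (near_sub y yt) _.
  by rewrite (mulrC 2%R) -mulrA ler_pM2l// mulr_natl mulr2n lerD2r ltW.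
have p10 : (0 <= p^-1)%R by rewrite invr_ge0 ltW.
have {}h := le_poweR p10 (power_integral_ge0 _ _ _) h.
apply: le_trans (lee_wpmul2l _ h) _; first by rewrite lee_fin mulr_ge0 ?powR_ge0// ltW.
rewrite poweR_EFin -!EFinM lee_fin le_eqVlt; apply/orP; left; apply/eqP.
have ph0 := ltW (phi_gt0 x0 r0).
have K20 : (0 <= 2 * K)%R by rewrite mulr_ge0// ltW.
have -> : (c3 * M `^ p * phi x0 r * (2 * K * t) `^ gamma =
   (c3 * (2 * K) `^ gamma) * (M `^ p * (phi x0 r * t `^ gamma)))%R.
  by rewrite (powRM _ K20 (ltW t0)); ring.
rewrite powRM ?mulr_ge0 ?powR_ge0 ?(ltW c30)//.
rewrite (powRM _ (powR_ge0 M p)) ?mulr_ge0 ?powR_ge0// (powRM _ ph0) ?powR_ge0//.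
rewrite -!powRrM divff ?gt_eqF// powRr1 ?(ltW M0)//.
have -> : (t `^ gamma = t `^ (gamma - gamma / p) * t `^ (gamma / p))%R.
  rewrite -powRD; last by apply/implyP => _; rewrite gt_eqF.
  by rewrite subrK.
ring.
Qed.

Variable T : (U -> \bar R) -> U -> \bar R.
Hypothesis hT : interpolated_operator P rho Omega alpha p q T.

(** In the q-th power of the pointwise estimate the factor A^(p/q) becomes A^p, which is integrable
    by the maximal theorem, and the decay factor becomes M^(q - p); together they give M^q. *)
Lemma interpolated_strong_bound : exists2 C : R, (0 < C)%R &
  forall f M x r, measurable_fun setT f -> (0 < M)%R ->
  power_integral_bounded f M -> (0 < r)%R ->
  power_integral q (T f) (E x r) <= (C * M `^ q * (phi x r * (unit_volume rho * r `^ gamma)))%:E.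
Proof.
have [CT CT0 hCT] := hT.
have [c7 c70 hc7] := kernel_integral_decay.
have [c3 c30 hc3] := power_integral_tail.
have [K [c5 [c6 [K1 c50 c60 hloc]]]] := kernel_integral_local.
(* The strict inequality u < p admits the maximal theorem for |f|^u with exponent p / u. *)
have pu1 : (1 < p / u)%R by rewrite ltr_pdivlMr// mul1r.
have [A A0 hA] := family_maximal_strong hrho trP (@rational_family_gt0 R n) pu1.
have K0 : (0 < K)%R by apply: lt_le_trans K1.
have K20 : (0 < 2 * K)%R by rewrite mulr_gt0.
pose k := (CT `^ q * 2 `^ p * c7 `^ (q - p))%R.
have k0 : (0 < k)%R by rewrite !mulr_gt0 ?powR_gt0.
exists (k * (c5 `^ p * (A * (c3 * (2 * K) `^ gamma)) / unit_volume rho + c6 `^ p))%R.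
  by rewrite mulr_gt0// addr_gt0// ?powR_gt0// !mulr_gt0 ?powR_gt0 ?invr_gt0.
move=> f M x r mf M0 hM r0.
pose g := (fun y => `|f y| `^ u) \_ (E x (2 * K * r)%R).
pose Mg := family_maximal P rho (rational_family n) g.
have ph0 := phi_gt0 x r0.
have mg : measurable_fun setT g.
  apply/(measurable_restrictT _ _).1; first exact: measurable_ellipsoid hrho _ _.
  apply: measurable_funTS; apply: (measurableT_comp (measurable_poweR _)).
  exact: measurableT_comp.
have g0 y : 0 <= g y by apply: erestrict_ge0 => z _; exact: poweR_ge0.
have mMg : measurable_fun setT Mg by exact: (measurable_family_maximal hrho (rational_family n) g).
have Mg0 y : 0 <= Mg y by exact: family_maximal_ge0.
have pointwise y : E x r y -> `|T f y| `^ q <=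
    (k * M `^ (q - p))%:E * ((c5 `^ p)%:E * Mg y `^ (p / u) + (c6 `^ p * M `^ p * phi x r)%:E).
  move=> yE.
  have c6M0 : (0 <= c6 * M * phi x r `^ p^-1)%R by rewrite !mulr_ge0 ?powR_ge0// ltW.
  have c7M0 : (0 <= c7 * M)%R by rewrite mulr_ge0// ltW.
  pose Ay := c5%:E * Mg y `^ u^-1 + (c6 * M * phi x r `^ p^-1)%:E.
  have Ay0 : 0 <= Ay by rewrite adde_ge0// mule_ge0 ?poweR_ge0// lee_fin ltW.
  have h := hCT f y Ay (c7 * M)%R mf Ay0 c7M0 (fun t t0 => hloc f M x r y t mf M0 hM r0 yE t0)
     (fun t t0 => hc7 f M y t mf M0 hM t0).
  apply: (le_trans (le_poweR (ltW q0) (abse_ge0 _) h)).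
  have CT0' : 0 <= CT%:E by rewrite lee_fin ltW.
  rewrite poweRM ?mule_ge0 ?poweR_ge0 ?lee_fin ?powR_ge0//.
  rewrite poweRM ?poweR_ge0 ?lee_fin ?powR_ge0// -poweRrM mulfVK ?gt_eqF//.
  rewrite !poweR_EFin -powRrM.
  have -> : ((1 - p / q) * q = q - p)%R by field; rewrite gt_eqF.
  rewrite muleCA -EFinM.
  have c5M0 : 0 <= c5%:E * Mg y `^ u^-1 by rewrite mule_ge0 ?poweR_ge0// lee_fin ltW.
  have c6M0e : 0 <= (c6 * M * phi x r `^ p^-1)%:E by rewrite lee_fin.
  have hA1 := poweR_add_le (ltW p0) c5M0 c6M0e.
  apply: (le_trans (lee_wpmul2r _ hA1)); first by rewrite lee_fin mulr_ge0 ?powR_ge0.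
  rewrite poweRM ?poweR_ge0 ?lee_fin ?(ltW c50)// -poweRrM [(u^-1 * p)%R]mulrC.
  have c6M : (0 <= c6 * M)%R by rewrite mulr_ge0// ltW.
  rewrite !poweR_EFin muleAC -EFinM (powRM _ c6M (powR_ge0 _ _)).
  rewrite (powRM _ (ltW c60) (ltW M0)) -powRrM mulVf ?gt_eqF// powRr1 ?(ltW ph0)//.
  rewrite (powRM _ (ltW c70) (ltW M0)).
  rewrite le_eqVlt; apply/orP; left; apply/eqP; congr (_%:E * _); rewrite /k; ring.
have mMgp : measurable_fun setT (fun y => Mg y `^ (p / u)).
  exact: (measurableT_comp (measurable_poweR _)).
have kM0 : (0 <= k * M `^ (q - p))%R by rewrite mulr_ge0 ?powR_ge0 ?(ltW k0).
have c6p0 : (0 <= c6 `^ p * M `^ p * phi x r)%R by rewrite !mulr_ge0 ?powR_ge0 ?(ltW ph0).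
apply: (@le_trans _ _ (\int[mu]_(y in E x r)
    ((k * M `^ (q - p))%:E * ((c5 `^ p)%:E * Mg y `^ (p / u) + (c6 `^ p * M `^ p * phi x r)%:E)))).
  apply: ge0_subset_le_integral => // [y _|y _]; first exact: poweR_ge0.
  by rewrite mule_ge0 ?lee_fin// adde_ge0 ?mule_ge0 ?poweR_ge0 ?lee_fin ?powR_ge0.
have mE := measurable_ellipsoid hrho x r.
rewrite ge0_integralZl//; last 2 first.
- apply: measurable_funTS; apply: emeasurable_funD => //.
  exact: emeasurable_funM.
- by move=> y _; rewrite adde_ge0 ?mule_ge0 ?poweR_ge0 ?lee_fin ?powR_ge0.
rewrite ge0_integralD//; last 2 first.
- by move=> y _; rewrite mule_ge0 ?poweR_ge0 ?lee_fin ?powR_ge0.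
- by apply: measurable_funTS; exact: emeasurable_funM.
rewrite integral_cst// (ellipsoid_measure hrho trP)// ge0_integralZl//; last 3 first.
- exact: measurable_funTS.
- by move=> y _; rewrite poweR_ge0.
- by rewrite lee_fin powR_ge0.
have hMg : \int[mu]_(y in E x r) Mg y `^ (p / u) <=
    (A * (c3 * M `^ p * phi x r * (2 * K * r) `^ gamma))%:E.
  apply: (@le_trans _ _ (\int[mu]_y Mg y `^ (p / u))).
    by apply: ge0_subset_le_integral => // y _; exact: poweR_ge0.
  apply: (le_trans (hA g mg g0)); rewrite EFinM lee_pmul2l ?lte_fin//.
  have -> : \int[mu]_y g y `^ (p / u) = power_integral p f (E x (2 * K * r)).
    rewrite /power_integral [RHS]integral_mkcond; apply: eq_integral => y _.
    rewrite /g !patchE; case: ifPn => _.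
      by rewrite -poweRrM mulrCA divff ?gt_eqF// mulr1.
    by rewrite poweR0r// gt_eqF// divr_gt0.
  (* The essential infimum condition acts as a doubling condition: the integral over E(x, 2Kr) is
     bounded by phi at the original radius r. *)
  apply: hc3 => //; rewrite ltr_pMl//; apply: lt_le_trans (_ : 2 <= _)%R.
    by rewrite ltr1n.
  by rewrite ler_peMr.
apply: (@le_trans _ _ ((k * M `^ (q - p))%:E *
  ((c5 `^ p)%:E * (A * (c3 * M `^ p * phi x r * (2 * K * r) `^ gamma))%:E +
   (c6 `^ p * M `^ p * phi x r)%:E * (unit_volume rho * r `^ gamma)%:E))).
  apply: lee_wpmul2l; first by rewrite lee_fin.
  by apply: leeD => //; apply: lee_wpmul2l; rewrite ?lee_fin ?powR_ge0.
rewrite -!EFinM lee_fin le_eqVlt; apply/orP; left; apply/eqP.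
have -> : (M `^ q = M `^ (q - p) * M `^ p)%R.
  rewrite -powRD ?subrK//; by apply/implyP => _; rewrite gt_eqF.
rewrite (powRM _ (ltW K20) (ltW r0)); field; rewrite gt_eqF//.
Qed.

Hypothesis mT : forall f, measurable_fun setT f -> measurable_fun setT (T f).
Local Notation phi_root e := (fun x r => phi x r `^ e^-1)%R.

Lemma interpolated_bounded_operator : bounded_operator
  (morrey rho p (phi_root p)) (morrey_norm rho p (phi_root p))
  (morrey rho q (phi_root q)) (morrey_norm rho q (phi_root q)) T.
Proof.
have [C C0 hC] := interpolated_strong_bound.
pose c := (C `^ q^-1)%R.
have c0 : (0 < c)%R by rewrite powR_gt0.
exists c => f [mf _ Nf].
have N0 : 0 <= morrey_norm rho p (phi_root p) f.
  apply: le_ereal_sup_tmp; eexists.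
    by exists (0%R, 1%R); rewrite //=; split => //=; rewrite in_itv/= ltr01.
  by rewrite !mule_ge0 ?poweR_ge0 ?Lnorm_ge0// lee_fin invr_ge0 powR_ge0.
have bound M : (0 < M)%R -> morrey_norm rho p (phi_root p) f <= M%:E ->
    forall x r, (0 < r)%R -> power_integral q (T f) (E x r) <=
      ((c * M) `^ q * (phi x r * (unit_volume rho * r `^ gamma)))%:E.
  move=> M0 /(morrey_norm_leP hrho trP phi_gt0 f p0 (ltW M0)) hM x r r0.
  apply: (le_trans (hC f M x r mf M0 hM r0)).
  by rewrite (powRM _ (ltW c0) (ltW M0)) /c -powRrM mulVf ?gt_eqF// powRr1// ltW.
have norm_le M : (0 < M)%R -> morrey_norm rho p (phi_root p) f <= M%:E ->
    morrey_norm rho q (phi_root q) (T f) <= (c * M)%:E.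
  move=> M0 hM; apply/(morrey_norm_leP hrho trP phi_gt0 (T f) q0); last exact: bound.
  by rewrite mulr_ge0// ltW.
have NE : morrey_norm rho p (phi_root p) f = (fine (morrey_norm rho p (phi_root p) f))%:E.
  by rewrite fineK// ge0_fin_numE.
set N := fine _ in NE.
have fN0 : (0 <= N)%R by rewrite fine_ge0.
(* The bound requires M > 0 while the norm of f may vanish; it is applied to N + e, with e tending
   to 0 for the norm inequality and e = 1 for finiteness. *)
have N1 e : (0 < e)%R -> morrey_norm rho p (phi_root p) f <= (N + e)%:E.
  by move=> e0; rewrite NE lee_fin lerDl ltW.
have N1gt e : (0 < e)%R -> (0 < N + e)%R by move=> e0; rewrite ltr_wpDl.
split; last first.
  rewrite NE -EFinM; apply/lee_addgt0Pr => e e0.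
  have ec0 : (0 < e / c)%R by rewrite divr_gt0.
  apply: (le_trans (norm_le _ (N1gt _ ec0) (N1 _ ec0))).
  by rewrite -EFinD lee_fin mulrDr mulrCA divff ?gt_eqF// mulr1.
split.
- exact: mT.
(* A compact set lies in an ellipsoid about 0, because [rho] is bounded on bounded sets. *)
- move=> K cK; have [B hB] : exists B : R, forall y, K y -> (rho y <= B)%R.
    have [k [_ hk]] := compact_bounded cK.
    have [B hB] := qdist_locally_bounded hrho (k + 1).
    by exists B => y Ky; apply: hB; apply: hk Ky; rewrite ltrDl.
  rewrite Lnorm_onE// poweR_lty//.
  have t0 : (0 < Num.max B 0 + 1)%R by rewrite ltr_wpDl// le_max lexx orbT.
  apply: le_lt_trans (le_lt_trans (bound _ (N1gt _ ltr01) (N1 _ ltr01) 0%R _ t0) (ltry _)).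
  apply: ge0_subset_le_integral => [y Ky|y _|y _|//]; rewrite ?poweR_ge0//.
  rewrite /ellipsoid/= sub0r (qdistN hrho); apply: le_lt_trans (hB _ Ky) _.
  by rewrite (@le_lt_trans _ _ (Num.max B 0))%R ?le_max ?lexx// ltrDl.
- exact: le_lt_trans (norm_le _ (N1gt _ ltr01) (N1 _ ltr01)) (ltry _).
Qed.

End strong_bound.

Theorem corollary3 (R : realType) (n : nat) (P : 'M[R]_n) (rho : 'cV[R]_n -> R)
    (Omega : 'cV[R]_n -> R) (s : \bar R) (p q alpha : R)
    (phi : 'cV[R]_n -> R -> R)
    (hn : (2 <= n)%N)
    (hP : eigenvalues_Re_gt0 P)
    (hrho : quasi_distance P rho)
    (hs : (1 < s <= +oo)%E)
    (hOmega_meas : measurable_fun setT Omega)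
    (hOmega_hom : homogeneous0 P Omega)
    (hOmega_s : ('N[@sphere_measure R n]_s[EFin \o Omega] < +oo)%E)
    (hs' : (1 <= hoelder_conjugate s)%E)
    (hs'p : (hoelder_conjugate s < p%:E)%E)
    (hpq : p < q)
    (halpha : 0 < alpha < \tr P / p)
    (hphi_gt0 : forall x t, 0 < t -> 0 < phi x t)
    (hphi_meas : measurable_fun
                   ([set: 'cV[R]_n] `*` `]0, +oo[ : set ('cV[R]_n * R))
                   (fun z => phi z.1 z.2))
    (hphi_sup : exists C : R, forall x r, 0 < r ->
       (ereal_sup [set (t `^ (- \tr P))%:E *
           ess_inf (mrestr (@lebesgue_measure R) (measurable_itv `]t, +oo[))
             (fun tau => (phi x tau * tau `^ (\tr P))%:E)
          | t in `]r, +oo[] <= (C * phi x r)%:E)%E)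
    (hphi_int : exists C : R, forall x r, 0 < r ->
       (\int[@lebesgue_measure R]_(t in `]r, +oo[)
          (t `^ alpha * phi x t `^ p^-1 / t)%:E
        <= (C * r `^ (- (alpha * p / (q - p))))%:E)%E) :
  let phi_root u := fun x r => phi x r `^ u^-1 in
  let bounded_M := fun X NX Y NY =>
    bounded_operator X NX Y NY (frac_maximal P rho Omega alpha) in
  let bounded_I := fun X NX Y NY =>
    bounded_operator X NX Y NY (frac_integral P rho Omega alpha) in
  (1 < p ->
     bounded_M (morrey rho p (phi_root p)) (morrey_norm rho p (phi_root p))
               (morrey rho q (phi_root q)) (morrey_norm rho q (phi_root q)) /\
     bounded_I (morrey rho p (phi_root p)) (morrey_norm rho p (phi_root p))
               (morrey rho q (phi_root q)) (morrey_norm rho q (phi_root q)))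
  /\
  (p = 1 ->
     bounded_M (morrey rho 1 phi) (morrey_norm rho 1 phi)
               (weak_morrey rho q (phi_root q))
               (weak_morrey_norm rho q (phi_root q)) /\
     bounded_I (morrey rho 1 phi) (morrey_norm rho 1 phi)
               (weak_morrey rho q (phi_root q))
               (weak_morrey_norm rho q (phi_root q))).
Proof.
move=> phi_root bounded_M bounded_I; split; last first.
  by move=> p1; have := le_lt_trans hs' hs'p; rewrite p1 ltxx.
move=> p1; have p0 : 0 < p by apply: lt_trans p1.
have /andP[alpha0 alphap] := halpha.
(* Read off from 0 < alpha < gamma / p. *)
have trP : 0 < \tr P.
  by have := lt_trans alpha0 alphap; rewrite pmulr_lgt0// invr_gt0.
have alphag : alpha < \tr P.
  by apply: lt_trans alphap _; rewrite ltr_pdivrMr// ltr_pMr.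
have /andP[s1 _] := hs.
have [s0 [s01 s0p Omega_int]] := qball_kernel_exponent hrho hOmega_meas
  (ltnW hn) trP hOmega_hom s1 hOmega_s hs' hs'p.
have s00 : 0 < s0 by apply: lt_trans s01.
have s10 : 0 < s0 - 1 by rewrite subr_gt0.
have u0 : 0 < s0 / (s0 - 1) by rewrite divr_gt0.
have su : s0^-1 + (s0 / (s0 - 1))^-1 = 1 by field; rewrite !gt_eqF.
split; apply: (interpolated_bounded_operator hrho trP hOmega_meas hOmega_hom
    s00 u0 su s0p hpq alpha0 Omega_int hphi_gt0 hphi_sup hphi_int).
- exact: (interpolated_frac_maximal hrho trP Omega alpha p0 hpq).
- by move=> f; exact: (measurable_frac_maximal hrho trP hOmega_meas alphag).
- exact: (interpolated_frac_integral hrho hOmega_meas alpha0 alphag p0 hpq).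
- by move=> f; exact: (measurable_frac_integral hrho alpha hOmega_meas).
Qed.
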